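(* Let $p\geqslant 4$ be an integer. If $0\leqslant e\leqslant \frac{1}{2p}$, then there is no sublinear bilipschitz equivalence between $G_{p,p-1}$ and $L_p\times L_{p-2}$ with $v(t)=O(t^e)$.
   Context: For $p\geqslant 3$ let $\mathfrak l_p$ be the real Lie algebra with basis $x_1,\dots,x_p$ whose only nonzero brackets of basis elements (up to antisymmetry) are $[x_1,x_i]=x_{i+1}$ for $2\leqslant i\leqslant p-1$; also $\mathfrak l_2=\mathbf R^2$ (abelian). $L_p$ is the simply connected Lie group with Lie algebra $\mathfrak l_p$. For $3\leqslant q\leqslant p$, $\mathfrak g_{p,q}$ is the central product of $\mathfrak l_p$ and $\mathfrak l_q$, i.e. the quotient of $\mathfrak l_p\times\mathfrak l_q$ by the central ideal identifying the last basis vector of $\mathfrak l_p$ with the last basis vector of $\mathfrak l_q$, and $G_{p,q}$ is the simply connected Lie group with Lie algebra $\mathfrak g_{p,q}$. These groups carry left-invariant Riemannian metrics (or word metrics associated to compact generating sets). Sublinear bilipschitz equivalence (SBE): a map $F:(X,d_X)\to(Y,d_Y)$ between metric spaces for which there exist a non-decreasing $v:\mathbf R_+\to\mathbf R_+$ with $\lim_{t\to\infty}v(t)/t=0$, points $x_0\in X$, $y_0\in Y$ and $M\geqslant 1$ such that for all $r\geqslant 0$ and all $x,x'\in B(x_0,r)$ $$M^{-1}d_X(x,x')-v(r)\leqslant d_Y(F(x),F(x'))\leqslant M d_X(x,x')+v(r),$$ and for all $y\in B(y_0,r)$ there exists $x\in X$ with $d_Y(F(x),y)\leqslant v(r)$.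 The condition $v(t)=O(t^e)$ is understood as $t\to\infty$. *)

(* Defs.v *)
(* MathComp / MathComp-Analysis; real numbers are an arbitrary R : realType. *)
From HB Require Import structures.
From mathcomp Require Import all_boot all_order all_algebra.
From mathcomp Require Import all_classical all_reals all_analysis.
From mathcomp Require Import zify ring lra.

Set Implicit Arguments.
Unset Strict Implicit.
Unset Printing Implicit Defensive.

Import Order.TTheory GRing.Theory Num.Theory.
Import numFieldNormedType.Exports.

Local Open Scope classical_set_scope.
Local Open Scope ring_scope.

(* [:: z1; ...; zk] |-> [z1, [z2, ... [z(k-1), zk]]] *)
Fixpoint nested_bracket (V : zmodType) (br : V -> V -> V) (s : seq V) : V :=
  match s with
  | [::] => 0
  | [:: z] => z
  | z :: s' => br z (nested_bracket br s')
  end.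

(* The norm on the underlying space is only used for its topology and for
   derivatives, so its choice is irrelevant in finite dimension. *)
Record nilpotent_lie (R : realType) := NilpotentLie {
  lie_space :> normedModType R;
  lie_br : lie_space -> lie_space -> lie_space;
  (* an upper bound for the nilpotency class, not necessarily sharp *)
  lie_step : nat;
  lie_br_linearl : forall a u v w,
    lie_br (a *: u + v) w = a *: lie_br u w + lie_br v w;
  lie_br_linearr : forall a u v w,
    lie_br w (a *: u + v) = a *: lie_br w u + lie_br w v;
  lie_brxx : forall u, lie_br u u = 0;
  lie_jacobi : forall u v w,
    lie_br u (lie_br v w) + lie_br v (lie_br w u) + lie_br w (lie_br u v) = 0;
  lie_nilpotent : forall s,
    (lie_step < size s)%N -> nested_bracket lie_br s = 0
}.

Section Coordinates.
Variable R : realType.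

(* 1-indexed: [crd v k] is the k-th coordinate of v, and is 0 when k is not
   in {1, ..., n}; [xb n k] is the k-th basis vector x_k. *)
Definition crd n (v : 'rV[R]_n) (k : nat) : R :=
  \sum_(i < n | i.+1 == k) v 0 i.

Definition xb n (k : nat) : 'rV[R]_n := \row_(i < n) (i.+1 == k)%:R.

Lemma crdE n (v : 'rV[R]_n) (i : 'I_n) : crd v i.+1 = v 0 i.
Proof. by rewrite /crd (eq_bigl (pred1 i)) ?big_pred1_eq. Qed.

Lemma crd_out n (v : 'rV[R]_n) k : (k == 0)%N || (n < k)%N -> crd v k = 0.
Proof.
by move=> hk; rewrite /crd big_pred0 // => i; apply/eqP; have := ltn_ord i; lia.
Qed.

Lemma crd_linear n k (a : R) (u v : 'rV[R]_n) :
  crd (a *: u + v) k = a * crd u k + crd v k.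
Proof.
rewrite /crd mulr_sumr -big_split /=.
by apply: eq_bigr => i _; rewrite !mxE.
Qed.

Lemma crd_xb n j k : crd (xb n j) k = ((j == k) && (0 < k <= n)%N)%:R.
Proof.
have [h|h] := boolP (0 < k <= n)%N; last by rewrite andbF crd_out //; lia.
case: k h => // k /= h; rewrite (crdE _ (Ordinal h)) mxE /= andbT.
by rewrite eq_sym.
Qed.

Lemma crdP n (u v : 'rV[R]_n) : (forall k, crd u k = crd v k) -> u = v.
Proof. by move=> h; apply/rowP => i; rewrite -!crdE. Qed.

Lemma crd_sum n k I (r : seq I) (P : pred I) (F : I -> 'rV[R]_n) :
  crd (\sum_(i <- r | P i) F i) k = \sum_(i <- r | P i) crd (F i) k.
Proof.
apply: (big_morph (fun v : 'rV[R]_n => crd v k)) => [u v|].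
  by rewrite -[u]scale1r crd_linear mul1r scale1r.
by rewrite /crd big1 // => i _; rewrite mxE.
Qed.

Lemma crdZ n k a (u : 'rV[R]_n) : crd (a *: u) k = a * crd u k.
Proof.
by rewrite -[a *: u]addr0 crd_linear [crd 0 k]big1 ?addr0 // => i _; rewrite mxE.
Qed.

Lemma crdD n k (u v : 'rV[R]_n) : crd (u + v) k = crd u k + crd v k.
Proof. by rewrite -[u]scale1r crd_linear mul1r scale1r. Qed.

Lemma crdN n k (u : 'rV[R]_n) : crd (- u) k = - crd u k.
Proof. by rewrite -scaleN1r crdZ mulN1r. Qed.

Lemma crd0 n k : crd (0 : 'rV[R]_n) k = 0.
Proof. by rewrite -(scale0r 0) crdZ mul0r. Qed.

End Coordinates.

Section Filiform.
Variables (R : realType) (p : nat).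
Implicit Types u v w : 'rV[R]_p.

(* [x_i, x_j]; for p = 2 (and below) everything commutes. *)
Definition filiform_basis_br (i j : nat) : 'rV[R]_p :=
  if (i == 1%N) && (2 <= j <= p.-1)%N then xb R p j.+1
  else if (j == 1%N) && (2 <= i <= p.-1)%N then - xb R p i.+1
  else 0.

Definition filiform_br u v : 'rV[R]_p :=
  \sum_(i < p) \sum_(j < p) (u 0 i * v 0 j) *: filiform_basis_br i.+1 j.+1.

Lemma crd_filiform_br u v k : crd (filiform_br u v) k =
  if (3 <= k <= p)%N then crd u 1 * crd v k.-1 - crd u k.-1 * crd v 1 else 0.
Proof.
rewrite /filiform_br crd_sum; under eq_bigr do rewrite crd_sum.
have brE (i j : nat) : crd (filiform_basis_br i j) k =
    if (3 <= k <= p)%N then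
      ((i == 1%N) && (j == k.-1))%:R - ((i == k.-1) && (j == 1%N))%:R else 0.
  rewrite /filiform_basis_br; case: ifP => h1; [|case: ifP => h2];
    rewrite ?crdN ?crd_xb ?crd0; case: ifP => h3.
  - rewrite (_ : (i == k.-1) && _ = false) ?subr0; last by lia.
    by congr (_%:R); lia.
  - by rewrite (_ : _ && _ = false) //; lia.
  - rewrite (_ : (i == 1%N) && _ = false) ?sub0r; last by lia.
    by congr (- _%:R); lia.
  - by rewrite (_ : _ && _ = false) ?oppr0 //; lia.
  - rewrite (_ : (i == 1%N) && _ = false); last by lia.
    by rewrite (_ : (i == k.-1) && _ = false) ?subr0 //; lia.
  - by [].
under eq_bigr do under eq_bigr do rewrite crdZ brE.
case: ifP => h; last by rewrite big1 // => i _; rewrite big1 // => j _; rewrite mulr0.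
have dsum a b : \sum_(i < p) \sum_(j < p)
    u 0 i * v 0 j * ((i.+1 == a) && (j.+1 == b))%:R = crd u a * crd v b.
  rewrite /crd mulr_suml [RHS]big_mkcond; apply: eq_bigr => i _.
  have [_|_] /= := eqVneq i.+1 a; last first.
    by rewrite big1 // => j _; rewrite mulr0.
  rewrite mulr_sumr [RHS]big_mkcond; apply: eq_bigr => j _.
  by case: eqP => _; rewrite ?mulr1 ?mulr0.
under eq_bigr do (under eq_bigr do rewrite mulrBr; rewrite sumrB).
by rewrite sumrB !dsum.
Qed.

Lemma filiform_br_linearl (a : R) u v w :
  filiform_br (a *: u + v) w = a *: filiform_br u w + filiform_br v w.
Proof.
apply: crdP => k; rewrite crd_linear !crd_filiform_br !crd_linear.
by case: ifP => _; ring.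
Qed.

Lemma filiform_br_linearr (a : R) u v w :
  filiform_br w (a *: u + v) = a *: filiform_br w u + filiform_br w v.
Proof.
apply: crdP => k; rewrite crd_linear !crd_filiform_br !crd_linear.
by case: ifP => _; ring.
Qed.

Lemma filiform_brxx u : filiform_br u u = 0.
Proof.
apply: crdP => k; rewrite crd_filiform_br crd0; case: ifP => _ //; ring.
Qed.

Lemma filiform_jacobi u v w :
  filiform_br u (filiform_br v w) + filiform_br v (filiform_br w u)
    + filiform_br w (filiform_br u v) = 0.
Proof.
apply: crdP => k; rewrite !crdD !crd_filiform_br crd0 /=.
by do ?case: ifP => _; ring.
Qed.

Lemma filiform_nilpotent s :
  (p < size s)%N -> nested_bracket filiform_br s = 0.
Proof.
have low t k : (1 < size t)%N -> (k <= size t)%N ->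
    crd (nested_bracket filiform_br t) k = 0.
  elim: t k => [|z [|z' t] IH] k //= _ hk; rewrite crd_filiform_br.
  case: ifP => // hkp; case: t IH hk => [|z'' t] IH hk; first by exfalso; move: hk hkp => /=; lia.
  by rewrite !IH //= ?mulr0 ?subr0 //; move: hk hkp => /=; lia.
move=> hs; have [h1|h1] := ltnP 1 (size s); last first.
  have p0 : (p = 0)%N by lia.
  by apply: crdP => k; rewrite crd0 crd_out //; lia.
apply: crdP => k; rewrite crd0; have [hk|hk] := leqP k p.
  by rewrite low //; lia.
by rewrite crd_out // hk orbT.
Qed.

Definition filiform : nilpotent_lie R :=
  @NilpotentLie R 'rV[R]_p filiform_br p
    filiform_br_linearl filiform_br_linearr filiform_brxx filiform_jacobi
    filiform_nilpotent.

End Filiform.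

Section Product.
Variables (R : realType) (g h : nilpotent_lie R).

Let V : normedModType R := (g * h)%type.

Definition prod_br (u v : V) : V := (lie_br u.1 v.1, lie_br u.2 v.2).

Lemma prod_br_linearl (a : R) (u v w : V) :
  prod_br (a *: u + v) w = a *: prod_br u w + prod_br v w.
Proof.
by case: u v w => [u u'] [v v'] [w w']; rewrite /prod_br /= !lie_br_linearl.
Qed.

Lemma prod_br_linearr (a : R) (u v w : V) :
  prod_br w (a *: u + v) = a *: prod_br w u + prod_br w v.
Proof.
by case: u v w => [u u'] [v v'] [w w']; rewrite /prod_br /= !lie_br_linearr.
Qed.

Lemma prod_brxx (u : V) : prod_br u u = 0.
Proof. by rewrite /prod_br !lie_brxx. Qed.

Lemma prod_jacobi (u v w : V) :
  prod_br u (prod_br v w) + prod_br v (prod_br w u) + prod_br w (prod_br u v)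
  = 0.
Proof.
by apply: injective_projections; rewrite /= lie_jacobi.
Qed.

Lemma prod_nested (s : seq V) : nested_bracket prod_br s =
  (nested_bracket (@lie_br R g) (map fst s),
   nested_bracket (@lie_br R h) (map snd s)).
Proof.
elim: s => [|[z z'] [|y s] IH] //.
by rewrite [LHS](_ : _ = prod_br (z, z') (nested_bracket prod_br (y :: s))) // IH.
Qed.

Lemma prod_nilpotent (s : seq V) :
  (maxn (lie_step g) (lie_step h) < size s)%N -> nested_bracket prod_br s = 0.
Proof.
rewrite gtn_max => /andP[hg hh].
by rewrite prod_nested !lie_nilpotent ?size_map.
Qed.

Definition prod_lie : nilpotent_lie R :=
  @NilpotentLie R V prod_br (maxn (lie_step g) (lie_step h))
    prod_br_linearl prod_br_linearr prod_brxx prod_jacobi prod_nilpotent.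

End Product.

(* The quotient g / ker pi of g by a central ideal ker pi, realised on the
   target V of pi; the bracket does not depend on the section sec (see
   [central_quotient_morph]). *)
Section CentralQuotient.
Variables (R : realType) (g : nilpotent_lie R) (V : normedModType R).
Variables (pi : {linear g -> V}) (sec : {linear V -> g}).
Hypothesis piK : cancel sec pi.
Hypothesis ker_central : forall z u : g, pi z = 0 -> lie_br z u = 0.

Definition quotient_br (a b : V) : V := pi (lie_br (sec a) (sec b)).

Let brC (u v : g) : lie_br u v = - lie_br v u.
Proof.
have brDl (x y z : g) : lie_br (x + y) z = lie_br x z + lie_br y z.
  by have := lie_br_linearl 1 x y z; rewrite !scale1r.
have brDr (x y z : g) : lie_br z (x + y) = lie_br z x + lie_br z y.
  by have := lie_br_linearr 1 x y z; rewrite !scale1r.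
apply/eqP; rewrite -addr_eq0; apply/eqP.
by have := lie_brxx (u + v); rewrite brDl !brDr !lie_brxx addr0 add0r.
Qed.

Lemma central_quotient_morph (u v : g) :
  pi (lie_br u v) = quotient_br (pi u) (pi v).
Proof.
have eq_br (x x' y : g) : pi x = pi x' -> lie_br x y = lie_br x' y.
  move=> xx'; rewrite -[x](subrK x') -[x - x']scale1r lie_br_linearl.
  by rewrite ker_central ?scaler0 ?add0r // raddfB /= xx' subrr.
rewrite /quotient_br (@eq_br u (sec (pi u))) ?piK //.
by rewrite brC (@eq_br v (sec (pi v))) ?piK // -brC.
Qed.

Lemma quotient_br_linearl (a : R) (x y z : V) :
  quotient_br (a *: x + y) z = a *: quotient_br x z + quotient_br y z.
Proof. by rewrite /quotient_br linearP lie_br_linearl linearP. Qed.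

Lemma quotient_br_linearr (a : R) (x y z : V) :
  quotient_br z (a *: x + y) = a *: quotient_br z x + quotient_br z y.
Proof. by rewrite /quotient_br linearP lie_br_linearr linearP. Qed.

Lemma quotient_brxx (x : V) : quotient_br x x = 0.
Proof. by rewrite /quotient_br lie_brxx linear0. Qed.

Lemma quotient_jacobi (x y z : V) :
  quotient_br x (quotient_br y z) + quotient_br y (quotient_br z x)
    + quotient_br z (quotient_br x y) = 0.
Proof.
rewrite -[x]piK -[y]piK -[z]piK -!central_quotient_morph -!raddfD /=.
by rewrite lie_jacobi raddf0.
Qed.

Lemma quotient_nilpotent (s : seq V) :
  (lie_step g < size s)%N -> nested_bracket quotient_br s = 0.
Proof.
move=> hs; suff -> : nested_bracket quotient_br s =
    pi (nested_bracket (@lie_br R g) (map sec s)).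
  by rewrite lie_nilpotent ?size_map // linear0.
elim: s {hs} => [|z [|y s] IH]; rewrite ?linear0 //= ?piK //.
rewrite -[LHS]/(quotient_br z (nested_bracket quotient_br (y :: s))) IH.
by rewrite central_quotient_morph piK.
Qed.

Definition central_quotient : nilpotent_lie R :=
  @NilpotentLie R V quotient_br (lie_step g)
    quotient_br_linearl quotient_br_linearr quotient_brxx quotient_jacobi
    quotient_nilpotent.

End CentralQuotient.

Section CentralProduct.
Variables (R : realType) (p q : nat).

Let lpq : nilpotent_lie R := prod_lie (filiform R p) (filiform R q).
Let V : normedModType R := ('rV[R]_p * 'rV[R]_q.-1)%type.

(* g_{p,q} has basis x_1, ..., x_p, y_1, ..., y_(q-1), and y_q maps to x_p;
   by [central_proj_eq0] the kernel is the line spanned by x_p - y_q. *)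
Definition central_proj (w : lpq) : V :=
  (w.1 + crd w.2 q *: xb R p p, \row_(j < q.-1) crd w.2 j.+1).

Definition central_sec (w : V) : lpq := (w.1, \row_(j < q) crd w.2 j.+1).

Lemma central_proj_is_linear : linear central_proj.
Proof.
move=> a u v; apply: injective_projections => /=.
  rewrite crd_linear scalerDl scalerDr scalerA.
  by rewrite addrACA.
by apply/rowP => j; rewrite !mxE crd_linear.
Qed.
HB.instance Definition _ :=
  GRing.isLinear.Build R lpq V *:%R central_proj central_proj_is_linear.

Lemma central_sec_is_linear : linear central_sec.
Proof.
move=> a u v; apply: injective_projections => //=.
by apply/rowP => j; rewrite !mxE crd_linear.
Qed.
HB.instance Definition _ :=
  GRing.isLinear.Build R V lpq *:%R central_sec central_sec_is_linear.

Lemma crd_row n k (f : nat -> R) :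
  crd (\row_(j < n) f j.+1) k = if (0 < k <= n)%N then f k else 0.
Proof.
case: ifP => h; last by rewrite crd_out //; lia.
by case: k h => // k /= h; rewrite (crdE _ (Ordinal h)) mxE.
Qed.

Lemma central_secK : cancel central_sec central_proj.
Proof.
move=> [u w]; apply: injective_projections => /=.
  rewrite crd_row; case: ifP => h; last by rewrite scale0r addr0.
  by rewrite crd_out ?scale0r ?addr0 //; lia.
apply: crdP => k; rewrite crd_row.
by case: ifP => h; [rewrite crd_row; case: ifP => //|rewrite crd_out //]; lia.
Qed.

Lemma central_proj_ker (w : lpq) : central_proj w = 0 ->
  w = (- (crd w.2 q *: xb R p p), crd w.2 q *: xb R q q).
Proof.
case: w => [u v] [hu hv]; apply: injective_projections => /=.
  by apply/eqP; rewrite -addr_eq0 hu.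
apply: crdP => k; rewrite crdZ crd_xb.
have [h|h] := boolP (0 < k <= q)%N; last first.
  by rewrite andbF mulr0 crd_out //; lia.
have [<-|hk] := eqVneq q k; first by rewrite mulr1.
rewrite mulr0; have hk' : (0 < k <= q.-1)%N by lia.
by have := congr1 (fun w => crd w k) hv; rewrite crd_row crd0 hk'.
Qed.

Lemma central_proj_eq0 (hq : (0 < q)%N) (w : lpq) : central_proj w = 0 <->
  exists c : R, w = c *: (xb R p p, - xb R q q).
Proof.
split=> [/central_proj_ker ->|[c ->]].
  exists (- crd w.2 q); apply: injective_projections => /=.
    by rewrite scaleNr.
  by rewrite scalerN scaleNr opprK.
apply: injective_projections => /=.
  rewrite crdZ crdN crd_xb eqxx hq leqnn /= mulrN mulr1 scaleNr.
  by rewrite subrr.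
apply: crdP => k; rewrite crd_row crd0; case: ifP => // h.
by rewrite crdZ crdN crd_xb (_ : q == k = false) ?oppr0 ?mulr0 //; lia.
Qed.

Lemma xb_central n (u : 'rV[R]_n) : filiform_br (xb R n n) u = 0.
Proof.
apply: crdP => k; rewrite crd_filiform_br crd0; case: ifP => // h.
have n1 : (n == 1%N) = false by lia.
have nk : (n == k.-1) = false by lia.
by rewrite !crd_xb n1 nk !mul0r subr0.
Qed.

Lemma filiform_br0 n (u : 'rV[R]_n) : filiform_br 0 u = 0.
Proof.
by apply: crdP => k; rewrite crd_filiform_br !crd0 !mul0r subrr if_same.
Qed.

Lemma central_proj_ker_central (z u : lpq) :
  central_proj z = 0 -> lie_br z u = 0.
Proof.
move=> /central_proj_ker ->; apply: injective_projections => /=.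
  by rewrite -scaleNr -[X in filiform_br X]addr0 filiform_br_linearl
    xb_central filiform_br0 scaler0 addr0.
by rewrite -[X in filiform_br X]addr0 filiform_br_linearl
  xb_central filiform_br0 scaler0 addr0.
Qed.

Definition central_product : nilpotent_lie R :=
  central_quotient central_secK central_proj_ker_central.

End CentralProduct.

(* A group structure on a normed space; for simply connected nilpotent Lie
   groups, the space is the Lie algebra, identified with the group through the
   global chart exp. *)
Record group_law (R : realType) := GroupLaw {
  grp_space :> normedModType R;
  gmul : grp_space -> grp_space -> grp_space;
  ginv : grp_space -> grp_space;
  gone : grp_space
}.

(* Dynkin's form of the Baker-Campbell-Hausdorff series log(exp x exp y):
     sum_(n >= 1) (-1)^(n-1) / n
       sum_(r_1 + s_1 > 0, ..., r_n + s_n > 0)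
         [x^r_1 y^s_1 ... x^r_n y^s_n]
           / ((r_1 + s_1 + ... + r_n + s_n) r_1! s_1! ... r_n! s_n!).
   The omitted terms, those with n, some r_i or some s_i above [lie_step], are
   brackets of more than [lie_step] elements and thus vanish. *)
Section BCH.
Variables (R : realType) (g : nilpotent_lie R).
Let N := lie_step g.

Definition bch_word (x y : g) n (k : {ffun 'I_n -> 'I_N.+1 * 'I_N.+1}) :
    seq g :=
  flatten [seq nseq (k i).1 x ++ nseq (k i).2 y | i <- enum 'I_n].

Definition bch (x y : g) : g :=
  \sum_(n < N) ((-1) ^+ n / n.+1%:R) *:
    \sum_(k : {ffun 'I_n.+1 -> 'I_N.+1 * 'I_N.+1}
          | [forall i, (0 < (k i).1 + (k i).2)%N])
      ((size (bch_word x y k))%:R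
         * \prod_(i < n.+1) ((k i).1`! * (k i).2`!)%:R)^-1
      *: nested_bracket (@lie_br R g) (bch_word x y k).

(* The simply connected Lie group with Lie algebra g. *)
Definition simply_connected_group : group_law R :=
  @GroupLaw R g bch (fun x => - x) 0.

End BCH.

Definition prod_group (R : realType) (G H : group_law R) : group_law R :=
  @GroupLaw R (G * H)%type
    (fun x y => (gmul x.1 y.1, gmul x.2 y.2))
    (fun x => (ginv x.1, ginv x.2))
    (gone G, gone H).

Section Metrics.
Variables (R : realType) (G : group_law R).

(* An inner product on the tangent space at the identity, which the chart
   identifies with the ambient space. *)
Definition inner_product (ip : G -> G -> R) : Prop :=
  [/\ forall u v, ip u v = ip v u,
      forall a u v w, ip (a *: u + v) w = a * ip u w + ip v w
    & forall u, u != 0 -> 0 < ip u u].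

Definition C1_curve (c : R -> G) : Prop :=
  (forall t, derivable c t 1) /\ continuous (derive1 c).

(* The velocity at time t, translated to the identity by c(t)^-1. *)
Definition left_velocity (c : R -> G) (t : R) : G :=
  derive1 (fun s => gmul (ginv (c t)) (c s)) t.

Definition curve_length (ip : G -> G -> R) (c : R -> G) : R :=
  \int[lebesgue_measure]_(t in `[0, 1])
    Num.sqrt (ip (left_velocity c t) (left_velocity c t)).

Definition riemannian_dist (ip : G -> G -> R) (x y : G) : R :=
  inf [set l | exists c : R -> G,
    [/\ C1_curve c, c 0 = x, c 1 = y & l = curve_length ip c]].

Definition is_word (S : set G) (s : seq G) : Prop :=
  forall z, z \in s -> S z \/ exists2 y, S y & z = ginv y.

Definition word_value (s : seq G) : G := foldr (@gmul R G) (gone G) s.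

Definition generating (S : set G) : Prop :=
  forall x, exists2 s, is_word S s & word_value s = x.

Definition word_dist (S : set G) (x y : G) : R :=
  inf [set l | exists2 s, is_word S s &
    word_value s = gmul (ginv x) y /\ l = (size s)%:R].

Definition left_invariant_metric (d : G -> G -> R) : Prop :=
  (exists2 ip, inner_product ip & d = riemannian_dist ip) \/
  (exists2 S, compact S /\ generating S & d = word_dist S).

End Metrics.

Section SBE.
Variables (R : realType) (X Y : Type) (dX : X -> X -> R) (dY : Y -> Y -> R).

Definition sublinear_gauge (v : R -> R) : Prop :=
  [/\ forall t, 0 <= t -> 0 <= v t,
      forall s t, 0 <= s -> s <= t -> v s <= v t
    & v t / t @[t --> +oo] --> 0].

(* Only the values of v on [0, +oo[ are used. *)
Definition is_SBE (v : R -> R) (F : X -> Y) : Prop :=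
  sublinear_gauge v /\
  exists (x0 : X) (y0 : Y) (M : R), 1 <= M /\ forall r, 0 <= r ->
    (forall x x', dX x0 x <= r -> dX x0 x' <= r ->
       M^-1 * dX x x' - v r <= dY (F x) (F x') /\
       dY (F x) (F x') <= M * dX x x' + v r) /\
    (forall y, dY y0 y <= r -> exists x, dY (F x) y <= v r).

End SBE.

Definition big_O_power (R : realType) (v : R -> R) (e : R) : Prop :=
  exists C : R, \forall t \near +oo, `|v t| <= C * `|t `^ e|.

Definition filiform_group (R : realType) (p : nat) : group_law R :=
  simply_connected_group (filiform R p).

Definition central_product_group (R : realType) (p q : nat) : group_law R :=
  simply_connected_group (central_product R p q).

(* Main.v *)
(* In suitable coordinates L_p is R^p with a product hmul in which x_1 acts on
   the abelian ideal spanned by x_2, ..., x_p by the exponential of ad x_1; the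
   k-th coordinate has weight k - 1. The central extension of L_p by the next
   coordinate provides a function lamL of two points of L_p whose coboundary on
   a triangle of size D is O(D^p), whereas its sum along some closed path of
   O(N) steps of size s is (s N)^p.
   Let F be an SBE from G_(p,p-1) to L_p x L_(p-2), and let N = s^(2p-4). The
   condition e <= 1/(2p) makes v(s N) smaller than s, so that this path, with
   steps of size s, is close to the image by F of a closed path of G_(p,p-1)
   which, rescaled by s, lifts to a path of O(N) unit steps of L_p x L_(p-1)
   ending in the kernel of the map onto G_(p,p-1). The pull-back lam of lamL has
   coboundary O(s^p) on unit triangles and is invariant under this kernel, which
   identifies one unit of the centre of L_p with s units of that of L_(p-1).
   Contracting the path by dilations would take N^p triangles. But the top
   coordinate of L_p can be neglected: its centre can be traded for that of
   L_(p-1), where the degree is one less, which shows that the average of lam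
   over s^(2p-5) central translates is invariant, up to O(s^(p+3)), under central
   translations, even after summation over a whole path. The contraction then
   takes N^(p-1) steps, each costing O(s^(p+3)). So (s N)^p = O(N^(p-1) s^(p+3)),
   which is absurd as N >= s^4. *)

(* [F] need not be continuous, so nothing is known below the scale [s]: all that [lam] inherits is a
   bound on triangles of bounded size, and every filling is combinatorial. A direct ladder from a
   path of O(N) steps to its translate by one unit of the centre of L_p costs O(N) triangles, too
   much for the O(N) units that each level of a cone requires. A translation by J units is
   relatively cheaper: it is swept by a word of l letters in L_(p-1), where l^(p-2) = s J because
   that centre has weight p - 2. It costs O(N l + l^(p-1)) triangles, and averaging divides this by
   J. The two terms balance for N = l^(p-2) = s J, with quotient s l. The comparison is then between
   (s N)^p and N^(p-1) s^(p+1) l, and asks that l^(p-3) dominate s. For p = 4 the choice l = s just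
   fails; l = s^2 serves for all p, whence N = s^(2p-4) and J = s^(2p-5). The loop has size about s
   N = s^(2p-3), where v is O(s^((2p-3)/(2p))) by the bound on e: this exponent is below 1, so v is
   eventually less than any given multiple of s. *)
Require Import Defs.
From HB Require Import structures.
From mathcomp Require Import all_boot all_order all_algebra.
From mathcomp Require Import all_classical all_reals all_analysis.
From mathcomp Require Import zify ring lra.

Set Implicit Arguments.
Unset Strict Implicit.
Unset Printing Implicit Defensive.

Import Order.TTheory GRing.Theory Num.Theory.
Import numFieldNormedType.Exports.

Local Open Scope ring_scope.

(** * Truncated power series *)

Section TruncatedSeries.
Variable R : realType.
Implicit Types (p q r : {poly R}) (a b c : R) (K N : nat).

Definition eqX K p q := forall i, (i < K)%N -> p`_i = q`_i.

Lemma eqXP K p q : eqX K p q <-> exists r, p = q + r * 'X^K.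
Proof.
split=> [h|[r ->] i hi]; last first.
  by rewrite coefD coefMXn hi addr0.
exists (drop_poly K (p - q)).
rewrite -[X in _ + X](addrK (take_poly K (p - q))) addrC.
rewrite [X in X - _]addrC poly_take_drop.
suff -> : take_poly K (p - q) = 0 by rewrite subr0 subrK.
apply/polyP => i; rewrite coef_take_poly coef0; case: ifP => // hi.
by rewrite coefB h ?subrr.
Qed.

Lemma eqX_refl K p : eqX K p p. Proof. by []. Qed.

Lemma eqX_eq K p q : p = q -> eqX K p q. Proof. by move=> ->. Qed.

Lemma eqX_sym K p q : eqX K p q -> eqX K q p.
Proof. by move=> h i hi; rewrite h. Qed.

Lemma eqX_trans K q p r : eqX K p q -> eqX K q r -> eqX K p r.
Proof. by move=> h1 h2 i hi; rewrite h1 ?h2. Qed.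

Lemma eqXM K p q p' q' : eqX K p q -> eqX K p' q' -> eqX K (p * p') (q * q').
Proof.
move=> h h' i hi; rewrite !coefM; apply: eq_bigr => j _.
have := ltn_ord j => hj; rewrite h ?h' //; lia.
Qed.

Lemma eqXD K p q p' q' : eqX K p q -> eqX K p' q' -> eqX K (p + p') (q + q').
Proof. by move=> h h' i hi; rewrite !coefD h ?h'. Qed.

Lemma eqXN K p q : eqX K p q -> eqX K (- p) (- q).
Proof. by move=> h i hi; rewrite !coefN h. Qed.

Lemma eqXB K p q p' q' : eqX K p q -> eqX K p' q' -> eqX K (p - p') (q - q').
Proof. by move=> h h'; apply: eqXD => //; apply: eqXN. Qed.

Lemma eqX_leq K L p q : (L <= K)%N -> eqX K p q -> eqX L p q.
Proof. by move=> h h' i hi; apply: h'; lia. Qed.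

(** The derivation [X d/dX] respects congruences modulo ['X^K], which [d/dX] does not, and it undoes
    the division by the word length in Dynkin's formula. *)
Definition eulerX p := 'X * p^`().

Lemma coef_eulerX p i : (eulerX p)`_i = i%:R * p`_i.
Proof.
rewrite /eulerX mulrC coefMX; case: i => [|i] /=; first by rewrite mul0r.
by rewrite coef_deriv mulr_natl.
Qed.

Lemma eulerXM p q : eulerX (p * q) = eulerX p * q + p * eulerX q.
Proof. by rewrite /eulerX derivM; ring. Qed.

Lemma eulerXB p q : eulerX (p - q) = eulerX p - eulerX q.
Proof. by rewrite /eulerX derivB mulrBr. Qed.

Lemma eqX_euler K p q : eqX K p q -> eqX K (eulerX p) (eulerX q).
Proof. by move=> h i hi; rewrite !coef_eulerX h. Qed.

Definition expX N a : {poly R} := \poly_(i < N.+1) (a ^+ i / i`!%:R).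
(** The truncation of [(exp (a X) - 1) / (a X)], the series behind [hexp]. *)
Definition phiX N a : {poly R} := \poly_(i < N.+1) (a ^+ i / i.+1`!%:R).
(* (exp (a X) - 1) / a *)
Definition qX N a : {poly R} :=
  \poly_(i < N.+1) (if i is j.+1 then a ^+ j / j.+1`!%:R else 0).

Lemma factr_neq0 n : (n`!%:R : R) != 0.
Proof. by rewrite pnatr_eq0 -lt0n fact_gt0. Qed.

Lemma factSr n : (n.+1`!%:R : R) = n.+1%:R * n`!%:R.
Proof. by rewrite factS natrM. Qed.

Lemma natSr_neq0 n : (n.+1%:R : R) != 0. Proof. by rewrite pnatr_eq0. Qed.

Lemma expX_add N a b : eqX N.+1 (expX N a * expX N b) (expX N (a + b)).
Proof.
move=> i hi; rewrite coefM coef_poly hi addrC exprDn mulr_suml.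
apply: eq_bigr => j _; have hj := ltn_ord j.
have hj1 : (j < N.+1)%N by lia.
have hj2 : (i - j < N.+1)%N by lia.
rewrite !coef_poly hj1 hj2.
have hji : (j <= i)%N by lia.
rewrite -mulr_natr -mulrA -(bin_fact hji) !natrM.
have := factr_neq0 j; have := factr_neq0 (i - j).
have : ('C(i, j)%:R : R) != 0 by rewrite pnatr_eq0 -lt0n bin_gt0.
by move=> *; field; apply/and3P.
Qed.

Lemma expX_qX N a : expX N a = 1 + a *: qX N a.
Proof.
apply/polyP => i; rewrite coefD coef1 coefZ !coef_poly.
case: ltnP => hi; last by rewrite mulr0 addr0; case: i hi.
case: i hi => [|i] hi /=; first by rewrite mulr0 addr0 expr0 fact0 divr1.
by rewrite add0r exprS mulrA.
Qed.

Lemma qX_phiX N a : eqX N.+1 (qX N a) ('X * phiX N a).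
Proof.
move=> i hi; rewrite mulrC coefMX !coef_poly hi; case: i hi => //= i hi.
by rewrite (ltnW hi).
Qed.

Lemma euler_phiX N a : eulerX (phiX N a) = expX N a - phiX N a.
Proof.
apply/polyP => i; rewrite coef_eulerX coefB !coef_poly.
case: ltnP => hi; last by rewrite mulr0 subr0.
have := factr_neq0 i; have := natSr_neq0 i; rewrite factSr => h1 h2.
rewrite -(natr1 i) in h1 *.
by field; rewrite h1 h2.
Qed.

Lemma euler_qX N a : eqX N.+1 (eulerX (qX N a)) ('X * expX N a).
Proof.
move=> i hi; rewrite coef_eulerX mulrC coefXM !coef_poly hi.
case: i hi => [|i] hi /=; first by rewrite mulr0.
rewrite (ltnW hi) factSr.
by rewrite [_ * i`!%:R]mulrC invfM mulrA divfK ?natSr_neq0.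
Qed.

Lemma euler_expX N a : eqX N.+1 (eulerX (expX N a)) (a *: ('X * expX N a)).
Proof.
move=> i hi; rewrite expX_qX.
have -> : eulerX (1 + a *: qX N a) = a *: eulerX (qX N a).
  by rewrite /eulerX derivD derivC add0r derivZ -scalerAr.
by rewrite !coefZ euler_qX // expX_qX.
Qed.

Lemma coef0_expX N a : (expX N a)`_0 = 1.
Proof. by rewrite coef_poly expr0 fact0 divr1. Qed.

Lemma coef0_exprn p n K : p`_0 = 0 -> (K <= n)%N -> eqX K (p ^+ n) 0.
Proof.
move=> h0 hK.
have [r ->] : exists r, p = r * 'X.
  have : eqX 1 p 0 by case=> // _; rewrite h0 coef0.
  by case/eqXP => r; rewrite add0r expr1 => ->; exists r.
move=> i hi; rewrite exprMn coefMXn coef0.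
by rewrite (leq_trans hi hK).
Qed.

Lemma eqX_euler0 K p q : (forall i, (i < K)%N -> i%:R * p`_i = i%:R * q`_i) ->
  p`_0 = q`_0 -> eqX K p q.
Proof.
move=> h h0 [|i] hi //; apply: (mulfI (natSr_neq0 i)); exact: h.
Qed.

Lemma eqX_mulX K p q : eqX K.+1 ('X * p) ('X * q) -> eqX K p q.
Proof. by move=> h i hi; have := h i.+1 hi; rewrite !coefXM. Qed.

Lemma eulerXn p n : eulerX (p ^+ n.+1) = n.+1%:R *: (p ^+ n * eulerX p).
Proof.
by rewrite /eulerX deriv_exp /= scaler_nat mulrnAr; congr (_ *+ _); ring.
Qed.

Section Log.
Variables (N : nat) (a b : R).
Let c := a + b.
Let s := expX N a * expX N b - 1.
(** [log (1 + s) / s] with [1 + s = exp (a X) exp (b X)]: formally [c X / (exp (c X) - 1)], the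
    inverse of [phiX N c]. *)
Definition logX : {poly R} := \sum_(n < N) ((-1) ^+ n / n.+1%:R) *: s ^+ n.

Let s0 : s`_0 = 0.
Proof. by rewrite coefB coefM big_ord1 !coef0_expX coef1 mulr1 subrr. Qed.

Lemma blockX : eqX N.+1 s (c *: ('X * phiX N c)).
Proof.
apply: (@eqX_trans _ (expX N c - 1)).
  by apply: eqXB => //; exact: expX_add.
rewrite expX_qX addrAC subrr add0r => i hi.
by rewrite !coefZ qX_phiX.
Qed.

(** This is [log (exp (c X)) = c X]: [eulerX] turns the logarithmic series into a geometric one, and
    [eulerX s = c X (1 + s)], so both sides have the same image under [eulerX] once [1 + s] is
    cancelled. *)
Lemma mul_logX : eqX N.+1 (s * logX) (c *: 'X).
Proof.
have [->|N0] := posnP N.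
  by case=> // _; rewrite coefM big_ord1 s0 mul0r coefZ coefX mulr0.
apply: eqX_euler0; last by rewrite coefM big_ord1 s0 mul0r coefZ coefX mulr0.
move=> i hi; rewrite -!coef_eulerX; move: i hi.
rewrite -/(eqX N.+1 (eulerX (s * logX)) (eulerX (c *: 'X))).
have -> : eulerX (s * logX) = (\sum_(n < N) (- s) ^+ n) * eulerX s.
  rewrite /logX mulr_sumr mulr_suml /eulerX raddf_sum mulr_sumr.
  apply: eq_bigr => n _; rewrite -scalerAr -exprS /= derivZ -scalerAr.
  rewrite -[X in _ *: X]/(eulerX _) eulerXn scalerA divfK ?natSr_neq0 //.
  rewrite -/(eulerX s) (exprNn s n) -(signr_odd R n) -(signr_odd {poly R} n).
  by case: (odd n); rewrite /= ?expr0 ?expr1 ?scale1r ?mul1r // scaleN1r mulN1r mulNr.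
have hs : eqX N.+1 (eulerX s) (c *: ('X * (1 + s))).
  have -> : eulerX s = eulerX (expX N a * expX N b).
    by rewrite eulerXB /eulerX derivC mulr0 subr0.
  apply: (eqX_trans (eqX_euler (@expX_add N a b))).
  apply: (eqX_trans (@euler_expX N c)) => i hi; rewrite !coefZ.
  congr (_ * _); apply: (@eqXM N.+1) => //; apply: eqX_sym.
  by rewrite /s addrC subrK; apply: expX_add.
have -> : eulerX (c *: 'X) = c *: 'X by rewrite /eulerX derivZ derivX -scalerAr mulr1.
have hS : (1 + s) * ((\sum_(n < N) (- s) ^+ n) * eulerX s) =
    (1 - (- s) ^+ N) * eulerX s.
  rewrite mulrA; congr (_ * _).
  have -> : 1 + s = - (- s - 1) by ring.
  by rewrite mulNr -subrX1 opprB.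
(* The power [(- s) ^+ N] vanishes only to order [N]; the missing order comes from the factor ['X]
   of [eulerX s]. *)
have hSN : eqX N.+1 ((1 - (- s) ^+ N) * eulerX s) (eulerX s).
  have [r hr] : exists r, (- s) ^+ N = r * 'X^N.
    have : eqX N ((- s) ^+ N) 0 by apply: coef0_exprn; rewrite ?coefN ?s0 ?oppr0.
    by case/eqXP => r; rewrite add0r => ->; exists r.
  apply/eqXP; exists (- r * s^`()); rewrite hr /eulerX exprS; ring.
set Z := (\sum_(n < N) _) * _.
(* [expX N (- c)] inverts [1 + s] modulo ['X^N.+1]. *)
suff : eqX N.+1 (expX N (- c) * ((1 + s) * Z)) (expX N (- c) * ((1 + s) * (c *: 'X))).
  have inv : eqX N.+1 (expX N (- c) * (1 + s)) 1.
    apply: (@eqX_trans _ (expX N (- c) * expX N c)).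
      by apply: eqXM => //; rewrite /s addrC subrK; apply: expX_add.
    apply: (eqX_trans (@expX_add N (- c) c)); rewrite addNr expX_qX scale0r addr0.
    exact: eqX_refl.
  rewrite (mulrA _ _ Z) (mulrA _ _ (c *: 'X)) => h; have := @eqXM _ _ _ _ _ inv (@eqX_refl N.+1 Z).
  have := @eqXM _ _ _ _ _ inv (@eqX_refl N.+1 (c *: 'X)); rewrite !mul1r => h1 h2.
  by apply: (eqX_trans (eqX_sym h2)); apply: (eqX_trans h).
apply: eqXM => //; rewrite hS; apply: (eqX_trans hSN); apply: (eqX_trans hs).
by rewrite -scalerAr mulrC; apply: eqX_refl.
Qed.

Lemma log_phiX : eqX N (logX * phiX N c) 1.
Proof.
have [c0|c0] := eqVneq c 0.
  have hs : eqX N.+1 s 0.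
    by apply: (eqX_trans blockX); rewrite c0 scale0r; apply: eqX_refl.
  have -> : phiX N c = 1.
    apply/polyP => i; rewrite coef_poly c0 coef1 expr0n.
    by case: i => [|i] /=; rewrite ?mul0r ?if_same // (_ : 1`! = 1%N) // divr1.
  rewrite mulr1 /logX; case: N hs => [|n] hs; first by move=> i.
  rewrite big_ord_recl expr0 divr1 scale1r expr0 => i hi.
  rewrite coefD coef_sum big1 ?addr0 // => j _.
  rewrite coefZ lift0 (exprS s) (@eqXM n.+2 _ 0 _ _ hs (@eqX_refl _ _)) ?mul0r ?coef0 ?mulr0 //.
  by lia.
apply: eqX_mulX; apply: (@eqX_trans _ (c^-1 *: (s * logX))).
  move=> i hi; rewrite coefZ.
  have := @eqXM N.+1 _ _ _ _ blockX (@eqX_refl N.+1 logX) i hi => ->.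
  by rewrite -scalerAl coefZ mulKf // -mulrA [logX * _]mulrC.
move=> i hi; rewrite coefZ mul_logX // coefZ mulKf // mulr1.
by [].
Qed.

(** [Q] is meant to be the series of x or of y in the product of the exponentials, [A] the one in
    Dynkin's sum, on which [hexp] acts as multiplication by [phiX N c]. The difference [Y] of the
    two sides satisfies [eulerX Y = (E - phi) psi Y] modulo ['X^N]. As [E - phi] has no constant
    term, [i] times coefficient [i] of [Y] is a combination of earlier coefficients, so all of them
    vanish. *)
Lemma dynkin_coef (w Q A : {poly R}) (chi := \sum_(n < N.-1)
    ((-1) ^+ n.+1 / n.+2%:R) *: s ^+ n) :
  (0 < N)%N -> w`_0 = 0 -> A`_0 = 0 -> Q`_0 = 0 ->
  eqX N (eulerX Q) (w + c *: ('X * Q)) ->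
  eqX N (eulerX A) (logX * w - chi * (c *: ('X * Q))) ->
  eqX N (phiX N c * A) Q.
Proof.
move=> N0 w0 A0 Q0 hQ hA.
have slog : logX = 1 + chi * s.
  have gen n : \sum_(i < n.+1) ((-1) ^+ i / i.+1%:R) *: s ^+ i =
      1 + (\sum_(i < n) ((-1) ^+ i.+1 / i.+2%:R) *: s ^+ i) * s.
    rewrite big_ord_recl expr0 divr1 scale1r expr0.
    congr (_ + _); rewrite mulr_suml; apply: eq_bigr => i _.
    by rewrite -scalerAl -exprSr.
  by rewrite /chi -gen prednK.
set phi := phiX N c; set E := expX N c; set psi := logX.
have hb : eqX N s (c *: ('X * phi)) := eqX_leq (leqnSn N) blockX.
have hl : eqX N (psi * phi) 1 := log_phiX.
have hE : E = 1 + c *: qX N c := expX_qX N c.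
have hE' : eqX N E (1 + c *: ('X * phi)).
  rewrite hE; apply: eqXD => // i hi; rewrite !coefZ qX_phiX //; lia.
set Y := phi * A - Q.
suff hY : eqX N (eulerX Y) ((E - phi) * psi * Y).
  have Y0 : eqX N Y 0.
    move=> i; elim/ltn_ind: i => i IH hi.
    case: i IH hi => [|i] IH hi.
      by rewrite /Y coefB coefM big_ord1 A0 mulr0 Q0 subrr coef0.
    have := hY i.+1 hi; rewrite coef_eulerX coefM big_ord_recl.
    rewrite [((E - phi) * psi)`_ord0](_ : _ = 0) ?mul0r ?add0r; last first.
      by rewrite coefM big_ord1 coefB !coef_poly !expr0 !fact0 subrr mul0r.
    rewrite big1 => [|j _]; last first.
      by rewrite (IH (i.+1 - lift ord0 j)%N) ?coef0 ?mulr0 //; rewrite /= /bump; lia.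
    by move/eqP; rewrite mulf_eq0 (negPf (natSr_neq0 i)) => /eqP ->; rewrite coef0.
  by move=> i hi; have := Y0 i hi; rewrite coefB coef0 => /eqP; rewrite subr_eq0 => /eqP.
have [r1 e1] := (eqXP _ _ _).1 hb; have [r2 e2] := (eqXP _ _ _).1 hl.
have [r3 e3] := (eqXP _ _ _).1 hE'; have [r4 e4] := (eqXP _ _ _).1 hQ.
have [r5 e5] := (eqXP _ _ _).1 hA.
have e6 : eulerX phi = E - phi := euler_phiX N c.
rewrite /Y eulerXB eulerXM e6 e4 e5 -![c *: _]mul_polyC in e1 e3 *.
apply/eqXP; exists (r2 * w + chi * r1 * Q + phi * r5 - r4 - (E - phi) * r2 * A
  + c%:P * 'X * r2 * Q + r3 * psi * Q - r2 * Q).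
apply/eqP; rewrite -subr_eq0; apply/eqP.
transitivity ((psi * phi - (1 + r2 * 'X^N)) *
    (w - (E - phi) * A + c%:P * 'X * Q - Q)
  + (s - (c%:P * ('X * phi) + r1 * 'X^N)) * (chi * Q)
  + (psi - (1 + chi * s)) * Q
  + (E - (1 + c%:P * ('X * phi) + r3 * 'X^N)) * (psi * Q)); last first.
  by rewrite -e1 -e2 -e3 -slog !subrr !mul0r !addr0.
by rewrite -/psi; ring.
Qed.
End Log.
End TruncatedSeries.

(** * The Baker-Campbell-Hausdorff formula on filiform algebras *)

Section DynkinSum.
Variables (R : realType) (N : nat).
Let B : finType := ('I_N.+1 * 'I_N.+1)%type.

Definition block (k : B) : seq bool := nseq k.1 true ++ nseq k.2 false.

Definition block_word n (k : {ffun 'I_n -> B}) : seq bool :=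
  flatten [seq block (k i) | i <- enum 'I_n].

(** Dynkin's inner sum for an arbitrary function of the word, where [true] stands for x and [false]
    for y. Freed from the bracket, it obeys a recursion on the number of blocks that can be solved
    in a small module of coefficients. *)
Definition block_sum (M : lmodType R) n (H : seq bool -> M) : M :=
  \sum_(k : {ffun 'I_n -> B} | [forall i, (0 < (k i).1 + (k i).2)%N])
    (\prod_(i < n) ((k i).1`! * (k i).2`!)%:R)^-1 *: H (block_word k).

Definition ffun_cons n (b : B) (k : {ffun 'I_n -> B}) : {ffun 'I_n.+1 -> B} :=
  [ffun i => if unlift ord0 i is Some j then k j else b].

Lemma ffun_cons0 n b (k : {ffun 'I_n -> B}) : ffun_cons b k ord0 = b.
Proof. by rewrite ffunE unlift_none. Qed.

Lemma ffun_consS n b (k : {ffun 'I_n -> B}) i : ffun_cons b k (lift ord0 i) = k i.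
Proof. by rewrite ffunE liftK. Qed.

Lemma sum_ffun_cons (M : nmodType) n (F : {ffun 'I_n.+1 -> B} -> M) :
  \sum_k F k = \sum_b \sum_k F (ffun_cons b k).
Proof.
rewrite pair_big /=; apply: (reindex (fun bk => ffun_cons bk.1 bk.2)).
exists (fun k : {ffun 'I_n.+1 -> B} => (k ord0, [ffun i : 'I_n => k (lift ord0 i)])) => [[b k] _|k _] /=.
  by rewrite ffun_cons0; congr (_, _); apply/ffunP => i; rewrite ffunE ffun_consS.
by apply/ffunP => i; rewrite ffunE; case: unliftP => [j ->|->]; rewrite ?ffunE.
Qed.

Lemma block_word_cons n b (k : {ffun 'I_n -> B}) :
  block_word (ffun_cons b k) = block b ++ block_word k.
Proof.
rewrite /block_word enum_ordSl /= ffun_cons0 -map_comp; congr (_ ++ flatten _).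
by apply: eq_map => i /=; rewrite ffun_consS.
Qed.

Lemma block_sum0 (M : lmodType R) (H : seq bool -> M) : block_sum 0 H = H [::].
Proof.
rewrite /block_sum (big_pred1 [ffun=> (ord0, ord0)]) => [|k].
  rewrite big_ord0 invr1 scale1r /block_word.
  by have -> : enum 'I_0 = [::] by apply: size0nil; rewrite size_enum_ord.
apply/idP/eqP => [_|->]; first by apply/ffunP; case.
by apply/forallP; case.
Qed.

Lemma block_sumS (M : lmodType R) n (H : seq bool -> M) :
  block_sum n.+1 H = \sum_(b : B | (0 < b.1 + b.2)%N)
    ((b.1`! * b.2`!)%:R)^-1 *: block_sum n (fun w => H (block b ++ w)).
Proof.
rewrite /block_sum big_mkcond sum_ffun_cons [RHS]big_mkcond.
apply: eq_bigr => b _.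
have P k : [forall i, (0 < (ffun_cons b k i).1 + (ffun_cons b k i).2)%N] =
    (0 < b.1 + b.2)%N && [forall i, (0 < (k i).1 + (k i).2)%N].
  apply/forallP/andP => [h|[h1 /forallP h2] i].
    split; first by have := h ord0; rewrite ffun_cons0.
    by apply/forallP => i; have := h (lift ord0 i); rewrite ffun_consS.
  by case: (unliftP ord0 i) => [j|] ->; rewrite ?ffun_cons0 ?ffun_consS.
case: ifP => hb; last by apply: big1 => k _; rewrite P hb.
rewrite scaler_sumr [RHS]big_mkcond; apply: eq_bigr => k _.
rewrite P hb /=; case: ifP => // _; rewrite block_word_cons big_ord_recl.
rewrite ffun_cons0 invfM scalerA; congr (_ * _^-1 *: _).
by apply: eq_bigr => i _; rewrite ffun_consS.
Qed.

Lemma block_sum_linear (M M' : lmodType R) (f : {linear M -> M'}) n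
    (H : seq bool -> M) :
  f (block_sum n H) = block_sum n (fun w => f (H w)).
Proof.
by rewrite /block_sum linear_sum; apply: eq_bigr => k _; rewrite linearZ.
Qed.

Lemma eq_block_sum (M : lmodType R) n (H H' : seq bool -> M) :
  (forall w, H w = H' w) -> block_sum n H = block_sum n H'.
Proof. by move=> h; apply: eq_bigr => k _; rewrite h. Qed.

(** The truncation order is independent of the algebra, unlike in [bch]: the projections of a
    product carry its series to those of the factors at the same, possibly larger, order. *)
Definition dynkin_bch (V : lmodType R) (br : V -> V -> V) (x y : V) : V :=
  \sum_(n < N) ((-1) ^+ n / n.+1%:R) *: block_sum n.+1 (fun w =>
    (size w)%:R^-1 *: nested_bracket br [seq if c then x else y | c <- w]).

Lemma dynkin_morph (V V' : lmodType R) (br : V -> V -> V) (br' : V' -> V' -> V')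
    (f : {linear V -> V'}) x y :
  (forall u v, f (br u v) = br' (f u) (f v)) ->
  f (dynkin_bch br x y) = dynkin_bch br' (f x) (f y).
Proof.
move=> hf; rewrite /dynkin_bch linear_sum; apply: eq_bigr => n _.
rewrite linearZ block_sum_linear; congr (_ *: _).
apply: eq_block_sum => w; rewrite linearZ; congr (_ *: _).
elim: w => [|c [|d w] IH] /=; rewrite ?linear0 //; first by case: c.
by rewrite hf; congr br'; [case: c|exact: IH].
Qed.

End DynkinSum.

Lemma bchE (R : realType) (g : nilpotent_lie R) (x y : g) :
  bch x y = dynkin_bch (lie_step g) (@lie_br R g) x y.
Proof.
apply: eq_bigr => n _; congr (_ *: _); apply: eq_bigr => k _.
have -> : bch_word x y k =
    [seq if c then x else y | c <- block_word k].
  rewrite /bch_word /block_word map_flatten -map_comp; congr flatten.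
  by apply: eq_map => i /=; rewrite map_cat !map_nseq.
by rewrite size_map invfM mulrC scalerA.
Qed.

Section FiliformDynkin.
Variables (R : realType) (p N : nat).
Variables x y : 'rV[R]_p.
Let a := crd x 1.
Let b := crd y 1.
Let c := a + b.

(* In a nested bracket of m >= 2 letters, coordinate k is a combination of
   the coordinates k + 1 - m of x and y; (g, A, B) records the coefficients of
   X^m in A and B, together with the first coordinate g. *)
Let M : lmodType R := (R^o * ({poly R} * {poly R}))%type.

Definition letter_vec (l : bool) : M :=
  if l then (a, ('X, 0)) else (b, (0, 'X)).

(** The bracket with a letter: coordinate [k] of [[x, z]] is [a z_(k-1) - z_1 x_(k-1)], and a shift
    of the index is a factor ['X]. The term [x_(k-1)] has exponent 2 because [x_k] has exponent
    1. *)
Definition letter_act (l : bool) (t : M) : M :=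
  if l then (0, (a *: ('X * t.2.1) - t.1 *: ('X * 'X), a *: ('X * t.2.2)))
  else (0, (b *: ('X * t.2.1), b *: ('X * t.2.2) - t.1 *: ('X * 'X))).

Definition word_vec (w : seq bool) : M :=
  if w is l :: w' then foldr letter_act (letter_vec (last l w')) (belast l w')
  else 0.

Lemma word_vec_cons l l' w : word_vec (l :: l' :: w) = letter_act l (word_vec (l' :: w)).
Proof. by []. Qed.

(** Coordinate 1 is cut off: it acts on the others and is recorded apart, as [g]. *)
Definition tail_crd (u : 'rV[R]_p) k := if (2 <= k)%N then crd u k else 0.

Definition conv_crd (P : {poly R}) (u : 'rV[R]_p) k : R :=
  \sum_(m < k) P`_m * tail_crd u (k.+1 - m).

(** The inverse of [eulerX] on series without constant term; on words of length [m] it is the factor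
    [1 / m] of Dynkin's formula. *)
Definition int_poly (P : {poly R}) : {poly R} := \poly_(m < size P) (P`_m / m%:R).

Lemma coef_int_poly P m : (int_poly P)`_m = P`_m / m%:R.
Proof.
by rewrite coef_poly; case: ltnP => // h; rewrite nth_default // mul0r.
Qed.

Definition bracket_crd k (t : M) : R :=
  conv_crd (int_poly t.2.1) x k + conv_crd (int_poly t.2.2) y k.

Lemma bracket_crd_is_linear k : linear (bracket_crd k : M -> R^o).
Proof.
have lin e A B u : conv_crd (int_poly (e *: A + B)) u k =
    e * conv_crd (int_poly A) u k + conv_crd (int_poly B) u k.
  rewrite /conv_crd mulr_sumr -big_split; apply: eq_bigr => m _ /=.
  by rewrite !coef_int_poly coefD coefZ; ring.
move=> e [u [A A']] [v [B B']]; rewrite /bracket_crd /= !lin.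
by rewrite scalerDr; exact: addrACA.
Qed.
HB.instance Definition _ k :=
  GRing.isLinear.Build R M R^o *:%R (bracket_crd k) (bracket_crd_is_linear k).

Let sel (l : bool) := if l then x else y.

Lemma word_vecP w : (0 < size w)%N ->
  exists g al be : R, [/\ word_vec w = (g, (al *: 'X^(size w), be *: 'X^(size w))),
    (1 < size w)%N -> g = 0,
    crd (nested_bracket (@filiform_br R p) (map sel w)) 1 = g &
    forall k, (2 <= k <= p)%N ->
      crd (nested_bracket (@filiform_br R p) (map sel w)) k =
      al * tail_crd x (k.+1 - size w) + be * tail_crd y (k.+1 - size w)].
Proof.
case: w => // l w _; elim: w l => [|l' w IH] l.
  case: l; [exists a, 1, 0 | exists b, 0, 1]; split => //=;
    rewrite ?expr1 ?scale1r ?scale0r // => k hk;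
    by rewrite /tail_crd subn1 /= (_ : (2 <= k)%N) ?mul1r ?mul0r ?addr0 ?add0r //; lia.
have [g [al [be [h1 h2 h3 h4]]]] := IH l'.
pose g1 := crd (sel l) 1.
exists 0, (g1 * al - (if l then g else 0)), (g1 * be - (if l then 0 else g)).
rewrite word_vec_cons h1 /letter_act.
have sc (e f : R) (n : nat) : e *: ('X * (f *: 'X^n)) = (e * f) *: 'X^(n.+1) :> {poly R}.
  by rewrite -scalerAr scalerA -exprS.
have g0 : g *: ('X * 'X) = g *: 'X^(size (l :: l' :: w)) :> {poly R}.
  by case: w {IH h1 h3 h4} h2 => [|l2 w] h2 /=; [rewrite expr2|rewrite h2 // !scale0r].
split => //.
- rewrite /g1; clear g1; move: g0; case: l => /= g0; rewrite !sc g0 -?scalerBl ?subr0 //.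
- by rewrite crd_filiform_br.
move=> k hk; rewrite [map _ _]/= -/(map sel (l' :: w)).
rewrite -[nested_bracket _ _]/(filiform_br (sel l) (nested_bracket (@filiform_br R p) (map sel (l' :: w)))).
rewrite crd_filiform_br h3.
have e : (k.-1.+1 - (size w).+1 = k.+1 - (size w).+2)%N by lia.
case: ifP => hk3; last first.
  have k2 : k = 2%N by lia.
  by rewrite /tail_crd k2 /= (_ : (1 < 3 - (size w).+2)%N = false) ?mulr0 ?addr0 //; lia.
rewrite h4 /=; last by lia.
rewrite e -/g1.
suff : crd (sel l) k.-1 * g = (if l then g else 0) * tail_crd x (k.+1 - (size w).+2)
    + (if l then 0 else g) * tail_crd y (k.+1 - (size w).+2).
  by move: (if l then g else 0) (if l then 0 else g) => gx gy ->; ring.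
case: w {IH h1 h3 h4 g0 e} h2 => [|l2 w] h2 /=; last first.
  by rewrite h2 // !if_same !mul0r mulr0 addr0.
rewrite (_ : (k.+1 - 2 = k.-1)%N); last by lia.
have hk1 : (2 <= k.-1)%N by lia.
by rewrite /tail_crd hk1; clear g1; case: l => /=; ring.
Qed.

Lemma bracket_crd_word k w : (2 <= k <= p)%N ->
  bracket_crd k (word_vec w) =
  (size w)%:R^-1 * crd (nested_bracket (@filiform_br R p) (map sel w)) k.
Proof.
move=> hk; case: w => [|l w]; first by rewrite invr0 mul0r linear0.
have [g [al [be [-> _ _ ->//]]]] := @word_vecP (l :: w) isT.
set m := size _; have m0 : (0 < m)%N by [].
rewrite /bracket_crd /conv_crd -big_split /=.
have cf e j : (int_poly (e *: 'X^m))`_j = if j == m then e / m%:R else 0.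
  by rewrite coef_int_poly coefZ coefXn; case: eqP => [->|_]; rewrite ?mulr1 ?mulr0 ?mul0r.
have [hm|hm] := ltnP m k; last first.
  rewrite big1 => [|j _]; last first.
    by rewrite !cf (_ : _ == m = false) ?mul0r ?addr0 //; have := ltn_ord j; lia.
  by rewrite /tail_crd (_ : (1 < k.+1 - m)%N = false) ?mulr0 ?addr0 ?mulr0 //; lia.
rewrite (bigD1 (Ordinal hm)) //= !cf eqxx big1 ?addr0; first by ring.
move=> j hj; rewrite !cf (_ : _ == m = false) ?mul0r ?addr0 //.
by apply: contraNF hj => /eqP e; apply/eqP/val_inj.
Qed.

Lemma letter_act_is_linear l : linear (letter_act l).
Proof.
have z0 (e : R) : 0 = e *: (0 : R^o) + 0 by rewrite scaler0 addr0.
have l1 (e f : R) (A B : {poly R}) :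
    f *: ('X * (e *: A + B)) = e *: (f *: ('X * A)) + f *: ('X * B).
  by rewrite -!mul_polyC; ring.
have l2 (e f : R) (u v : R) (A B : {poly R}) : f *: ('X * (e *: A + B)) -
    (e * u + v) *: ('X * 'X) = e *: (f *: ('X * A) - u *: ('X * 'X)) +
    (f *: ('X * B) - v *: ('X * 'X)).
  by rewrite -!mul_polyC polyCD polyCM; ring.
move=> e [u [A A']] [v [B B']]; case: l; rewrite /letter_act /=.
  congr (_, (_, _)); [exact: z0|exact: l2|exact: l1].
by congr (_, (_, _)); [exact: z0|exact: l1|exact: l2].
Qed.
HB.instance Definition _ l :=
  GRing.isLinear.Build R M M *:%R (letter_act l) (letter_act_is_linear l).

Definition word_act (w : seq bool) (t : M) : M := foldr letter_act t w.

Lemma word_act_is_linear w : linear (word_act w).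
Proof.
by move=> e u v; rewrite /word_act; elim: w => //= l w ->; rewrite linearP.
Qed.
HB.instance Definition _ w :=
  GRing.isLinear.Build R M M *:%R (word_act w) (word_act_is_linear w).

Lemma word_vec_cat u w : (0 < size w)%N -> word_vec (u ++ w) = word_act u (word_vec w).
Proof.
move=> hw; rewrite /word_act; elim: u => //= l u <-.
by case: (u ++ w) (size_cat u w) => //= h; exfalso; move: h hw; lia.
Qed.

(** Up to the factorial, the coefficients of [(exp (e X) - 1) / e]. *)
Definition shifted_pow (e : R) j : R := if j is i.+1 then e ^+ i else 0.

(** Only the letter that acts first, the last one of the block, meets the first coordinate of [t],
    which is 0 afterwards. Hence the tests on [s]. *)
Lemma word_act_block (r s : nat) (t : M) :
  word_act (nseq r true ++ nseq s false) t =
  (if (r == 0%N) && (s == 0%N) then t.1 else 0,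
   ((a ^+ r * b ^+ s) *: ('X^(r + s) * t.2.1)
      - (t.1 * (if s == 0%N then shifted_pow a r else 0)) *: 'X^(r.+1),
    (a ^+ r * b ^+ s) *: ('X^(r + s) * t.2.2)
      - (t.1 * (a ^+ r * shifted_pow b s)) *: 'X^((r + s).+1))).
Proof.
have Es : word_act (nseq s false) t = (if s == 0%N then t.1 else 0,
    (b ^+ s *: ('X^s * t.2.1),
     b ^+ s *: ('X^s * t.2.2) - (t.1 * shifted_pow b s) *: 'X^(s.+1))).
  case: t => g [A A'] /=; elim: s => [|s IH].
    by rewrite /= !expr0 !scale1r !mul1r mulr0 scale0r subr0.
  rewrite -[LHS]/(letter_act false (word_act (nseq s false) _)) IH /letter_act /=.
  congr (_, (_, _)); rewrite !exprS -![_ *: _]mul_polyC ?polyCM ?polyCD; first by ring.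
  case: s {IH} => [|s] /=; rewrite ?mul0r ?polyC0 ?expr0 ?exprS ?polyCM; ring.
rewrite /word_act foldr_cat -/(word_act _ t) Es.
elim: r => [|r IH] /=.
  congr (_, (_, _)); rewrite ?add0n ?expr0 ?mul1r //.
  by rewrite if_same mulr0 scale0r subr0.
rewrite IH /letter_act /=; congr (_, (_, _)).
  rewrite addSn !exprS -![_ *: _]mul_polyC ?polyCM ?polyCD.
  by case: eqP => _; case: r {IH} => [|r] /=; rewrite ?mul0r ?mulr0 ?polyC0 ?expr0 ?exprS ?polyCM; ring.
rewrite addSn !exprS -![_ *: _]mul_polyC ?polyCM ?polyCD; ring.
Qed.

Lemma word_vec_block0 r : word_vec (nseq r.+1 true) = if r == 0%N then (a, ('X, 0)) else 0.
Proof.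
elim: r => // r IH; rewrite -[LHS]/(letter_act true (word_vec (nseq r.+1 true))) IH.
case: eqP => _; last by rewrite linear0.
by rewrite /letter_act /= mulr0 scaler0 subrr.
Qed.

Lemma word_vec_block r s : word_vec (nseq r true ++ nseq s.+1 false) =
  if s == 0%N then (if r == 0%N then b else 0,
    (- (b * shifted_pow a r) *: 'X^(r.+1), a ^+ r *: 'X^(r.+1))) else 0.
Proof.
rewrite word_vec_cat; last by rewrite size_nseq.
have -> : word_vec (nseq s.+1 false) = if s == 0%N then (b, (0, 'X)) else 0.
  elim: s => // s IH; rewrite -[LHS]/(letter_act false (word_vec (nseq s.+1 false))) IH.
  case: eqP => _; last by rewrite linear0.
  by rewrite /letter_act /= mulr0 scaler0 subrr.
case: eqP => _; last by rewrite linear0.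
have := word_act_block r 0 (b, (0, 'X)); rewrite cats0 => ->.
rewrite /= !andbT !addn0 !expr0 !mulr1 !mulr0 scaler0 scale0r subr0 add0r scaleNr.
by rewrite exprSr.
Qed.

Let s := expX N a * expX N b - 1.
(** [Qu] and [Qv] are the series of x and of y in [hmul (hexp x) (hexp y)], which Dynkin's sum has
    to reproduce. *)
Let Qu := qX N a.
Let Qv := expX N a * qX N b.
Let wu := 'X - b *: ('X * Qu).
Let wv := 'X * expX N a.

Lemma sum_pairs (V : nmodType) (F : nat -> nat -> V) :
  \sum_(k : 'I_N.+1 * 'I_N.+1) F k.1 k.2 = \sum_(r < N.+1) \sum_(t < N.+1) F r t.
Proof. by rewrite pair_big. Qed.

Lemma sum_nz_pairs (V : zmodType) (F : nat -> nat -> V) :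
  \sum_(k : 'I_N.+1 * 'I_N.+1 | (0 < k.1 + k.2)%N) F k.1 k.2 =
  \sum_(r < N.+1) \sum_(t < N.+1) F r t - F 0%N 0%N.
Proof.
rewrite -sum_pairs [X in _ = X - _](bigD1 (ord0, ord0)) //=.
rewrite addrAC subrr add0r.
apply: eq_bigl => -[[r hr] [t ht]]; rewrite -[X in _ = ~~ X]/(_ && _) -!val_eqE /=.
by case: r {hr} => [|r]; case: t {ht} => [|t].
Qed.

Lemma sum_expX (e : R) : expX N e = \sum_(r < N.+1) (e ^+ r / r`!%:R) *: 'X^r.
Proof. by rewrite /expX poly_def. Qed.

Lemma sum_qX (e : R) : qX N e = \sum_(r < N.+1) (shifted_pow e r / r`!%:R) *: 'X^r.
Proof.
by rewrite /qX poly_def; apply: eq_bigr => -[[|r] hr] _ //=; rewrite mul0r.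
Qed.

(** Over all pairs of exponents the weights factor into two exponentials; excluding the empty block
    subtracts 1 and turns [exp (a X) exp (b X)] into [s]. *)
Lemma sum_word_act (t : M) :
  \sum_(k : 'I_N.+1 * 'I_N.+1 | (0 < k.1 + k.2)%N)
     ((k.1`! * k.2`!)%:R : R)^-1 *: word_act (block k) t =
  (0, (s * t.2.1 - t.1 *: ('X * Qu), s * t.2.2 - t.1 *: ('X * Qv))).
Proof.
pose om r i : R := (r`! * i`!)%:R^-1.
have omE r i : om r i = r`!%:R^-1 * i`!%:R^-1 by rewrite /om natrM invfM.
pose F1 r i := om r i *: ((a ^+ r * b ^+ i) *: ('X^(r + i) * t.2.1)
      - (t.1 * (if i == 0%N then shifted_pow a r else 0)) *: 'X^(r.+1)).
pose F2 r i := om r i *: ((a ^+ r * b ^+ i) *: ('X^(r + i) * t.2.2)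
      - (t.1 * (a ^+ r * shifted_pow b i)) *: 'X^((r + i).+1)).
rewrite (eq_bigr (fun k : 'I_N.+1 * 'I_N.+1 =>
    (0, (F1 k.1 k.2, F2 k.1 k.2)) : M)); last first.
  move=> k hk; rewrite word_act_block.
  have -> : ((k.1 : nat) == 0%N) && ((k.2 : nat) == 0%N) = false.
    by move: hk; case: (k.1 : nat) => [|?]; case: (k.2 : nat).
  by congr (_, (_, _)); rewrite /= scaler0.
have pr (I : Type) (r : seq I) (P : pred I) (f g : I -> {poly R}) :
    \sum_(i <- r | P i) ((0, (f i, g i)) : M) =
    (0, (\sum_(i <- r | P i) f i, \sum_(i <- r | P i) g i)).
  by apply: (big_rec3 (fun (u v : {poly R}) (w : M) => w = (0, (u, v)))) => // i u v _ _ ->;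
    congr (_, _); rewrite /= addr0.
rewrite pr (sum_nz_pairs F1) (sum_nz_pairs F2).
have main (A : {poly R}) : \sum_(r < N.+1) \sum_(i < N.+1)
    om r i *: ((a ^+ r * b ^+ i) *: ('X^(r + i) * A)) = expX N a * expX N b * A.
  rewrite !sum_expX mulr_suml mulr_suml; apply: eq_bigr => r _.
  rewrite mulr_sumr mulr_suml; apply: eq_bigr => i _.
  by rewrite omE -!mul_polyC exprD !polyCM; ring.
congr (_, (_, _)).
- rewrite /F1; under eq_bigr do under eq_bigr do rewrite scalerBr.
  under eq_bigr do rewrite sumrB.
  rewrite sumrB main /= expr0 !mul1r mulr0 scale0r subr0 omE fact0 invr1 mul1r !scale1r.
  rewrite /s mulrBl mul1r addrAC; congr (_ - _).
  rewrite /Qu sum_qX mulr_sumr scaler_sumr; apply: eq_bigr => r _.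
  rewrite big_ord_recl /= big1 ?addr0 => [|i _]; last by rewrite mulr0 scale0r scaler0.
  by rewrite omE fact0 invr1 mulr1 -!mul_polyC exprS !polyCM; ring.
rewrite /F2; under eq_bigr do under eq_bigr do rewrite scalerBr.
under eq_bigr do rewrite sumrB.
rewrite sumrB main /= expr0 !mul1r mulr0 scale0r subr0 omE fact0 invr1 mul1r !scale1r.
rewrite /s mulrBl mul1r addrAC; congr (_ - _).
rewrite /Qv sum_qX sum_expX mulr_suml mulr_sumr scaler_sumr; apply: eq_bigr => r _.
rewrite mulr_sumr mulr_sumr scaler_sumr; apply: eq_bigr => i _.
by rewrite omE -!mul_polyC exprS exprD !polyCM; ring.
Qed.

Lemma sum_first2 (V : nmodType) n (G : nat -> V) : (0 < n)%N ->
  (forall i, G i.+2 = 0) -> \sum_(i < n.+1) G i = G 0%N + G 1%N.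
Proof.
case: n => // n _ h; rewrite !big_ord_recl big1 ?addr0 // => i _.
exact: h.
Qed.

(** A nested bracket that ends in two equal letters vanishes, so only the blocks x and x ... x y
    (possibly y alone) contribute. *)
Lemma block_sum1 : (0 < N)%N -> block_sum N 1 word_vec = (c, (wu, wv)).
Proof.
move=> N0; rewrite block_sumS.
pose om r i : R := (r`! * i`!)%:R^-1.
have omE r i : om r i = r`!%:R^-1 * i`!%:R^-1 by rewrite /om natrM invfM.
pose F r i : M := om r i *: word_vec (nseq r true ++ nseq i false).
rewrite (eq_bigr (fun k : 'I_N.+1 * 'I_N.+1 => F k.1 k.2)); last first.
  by move=> k _; rewrite block_sum0 cats0.
have omr1 : om 1%N 0%N = 1%:R^-1 by rewrite /om (_ : (1`! * 0`!)%N = 1%N).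
have om1 r : om r 1%N = r`!%:R^-1 by rewrite /om (_ : 1`! = 1%N) // muln1.
rewrite sum_nz_pairs [F 0%N 0%N]/F /= scaler0 subr0.
have F2 r i : F r i.+2 = 0 by rewrite /F word_vec_block scaler0.
under eq_bigr do rewrite (sum_first2 N0 (F2 _)).
rewrite big_split /=.
have -> : \sum_(r < N.+1) F r 0%N = (a, ('X, 0)).
  rewrite (@sum_first2 M N (fun r => F r 0%N)) // => [|r].
    by rewrite /F omr1 /= scaler0 add0r invr1 scale1r.
  by rewrite /F cats0 word_vec_block0 scaler0.
have -> : \sum_(r < N.+1) F r 1%N = (b, (- (b *: ('X * Qu)), wv)).
  have Fr r : F r 1%N = (if r == 0%N then b else 0,
      (- (b *: ('X * ((shifted_pow a r / r`!%:R) *: 'X^r))),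
      'X * ((a ^+ r / r`!%:R) *: 'X^r))).
    rewrite /F word_vec_block om1; congr (_, (_, _)) => /=.
    - by case: r => [|r] /=; rewrite ?invr1 ?scale1r ?scaler0.
    - by rewrite -!mul_polyC exprS !polyCN !polyCM; ring.
    by rewrite -!mul_polyC exprS !polyCM; ring.
  under eq_bigr do rewrite Fr.
  have pr (I : Type) (r : seq I) (f : I -> R^o) (g h : I -> {poly R}) :
    \sum_(i <- r) ((f i, (g i, h i)) : M) =
    (\sum_(i <- r) f i, (\sum_(i <- r) g i, \sum_(i <- r) h i)).
    by elim: r => [|i r IH]; rewrite ?big_nil ?big_cons // IH.
  rewrite pr; congr (_, (_, _)).
  - by rewrite big_ord_recl big1 ?addr0.
  - by rewrite sumrN -scaler_sumr -mulr_sumr /Qu sum_qX.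
  by rewrite -mulr_sumr /wv sum_expX.
by congr (_, (_, _)); rewrite /= ?add0r.
Qed.

Let psi := logX N a b.
Let chi := \sum_(n < N.-1) ((-1) ^+ n.+1 / n.+2%:R) *: s ^+ n.

Lemma block_sum_succ n (w : {poly R} * {poly R}) (g : R) :
  block_sum N n.+1 word_vec = (g, w) ->
  block_sum N n.+2 word_vec = (0, (s * w.1 - g *: ('X * Qu), s * w.2 - g *: ('X * Qv))).
Proof.
move=> h; rewrite block_sumS -[RHS](sum_word_act (g, w)) -h; apply: eq_bigr => k _.
congr (_ *: _); rewrite block_sum_linear /block_sum; apply: eq_bigr => f /forallP hf.
congr (_ *: _); rewrite word_vec_cat // /block_word enum_ordSl /= size_cat.
by rewrite addn_gt0 /block size_cat !size_nseq; move: (hf ord0) => ->.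
Qed.

(** A bracket of at least two letters has first coordinate 0: [c] contributes once, when the second
    block is put in front, and each further block multiplies by [s]. *)
Lemma block_sum_all n : (0 < N)%N -> block_sum N n.+2 word_vec =
  (0, (s ^+ n * (s * wu - c *: ('X * Qu)), s ^+ n * (s * wv - c *: ('X * Qv)))).
Proof.
move=> N0; elim: n => [|n IH].
  by rewrite (block_sum_succ (block_sum1 N0)) /= !mul1r.
by rewrite (block_sum_succ IH) /= !scale0r !subr0 !exprS !mulrA.
Qed.

Lemma dynkin_total : (0 < N)%N ->
  \sum_(n < N) ((-1) ^+ n / n.+1%:R) *: block_sum N n.+1 word_vec =
  (c, (psi * wu - chi * (c *: ('X * Qu)), psi * wv - chi * (c *: ('X * Qv)))).
Proof.
move=> N0.
have -> : \sum_(n < N) ((-1) ^+ n / n.+1%:R) *: block_sum N n.+1 word_vec =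
   (c, (wu, wv)) + \sum_(n < N.-1) ((-1) ^+ n.+1 / n.+2%:R) *: block_sum N n.+2 word_vec.
  have gen m (G : nat -> M) : (0 < m)%N ->
      \sum_(n < m) ((-1) ^+ n / n.+1%:R) *: G n =
      G 0%N + \sum_(n < m.-1) ((-1) ^+ n.+1 / n.+2%:R) *: G n.+1.
    by case: m => // m _; rewrite big_ord_recl expr0 divr1 scale1r.
  by rewrite (gen N (fun n => block_sum N n.+1 word_vec)) // block_sum1.
have pr n (g h : 'I_n -> {poly R}) :
    \sum_(i < n) ((0, (g i, h i)) : M) =
    (0, (\sum_(i < n) g i, \sum_(i < n) h i)).
  by elim/big_rec3: _ => //= i u v w _ ->; congr (_, _); rewrite /= add0r.
under eq_bigr => n _ do rewrite block_sum_all //.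
rewrite (eq_bigr (fun n : 'I_N.-1 => (0, (
   (((-1) ^+ n.+1 / n.+2%:R) *: s ^+ n) * (s * wu - c *: ('X * Qu)),
   (((-1) ^+ n.+1 / n.+2%:R) *: s ^+ n) * (s * wv - c *: ('X * Qv)))) : M)); last first.
  by move=> n _; congr (_, (_, _)); rewrite /= ?scaler0 // scalerAl.
rewrite pr -!mulr_suml -/chi.
have hpsi : psi = 1 + chi * s.
  have gen m : \sum_(i < m.+1) ((-1) ^+ i / i.+1%:R) *: s ^+ i =
      1 + (\sum_(i < m) ((-1) ^+ i.+1 / i.+2%:R) *: s ^+ i) * s.
    rewrite big_ord_recl expr0 divr1 scale1r expr0.
    congr (_ + _); rewrite mulr_suml; apply: eq_bigr => i _.
    by rewrite -scalerAl -exprSr.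
  by rewrite /psi /logX -/s -[N in LHS](prednK N0) gen.
by congr (_, (_, _)); rewrite /= ?addr0 // hpsi; ring.
Qed.

End FiliformDynkin.

Section ExpCoordinates.
Variables (R : realType) (p : nat).
Implicit Types u v x y : 'rV[R]_p.

Definition hmul u v : 'rV[R]_p := \row_(i < p)
  (fun k => if k == 1%N then crd u 1 + crd v 1 else
     crd u k + \sum_(j < k.-1) crd u 1 ^+ j / j`!%:R * crd v (k - j)) i.+1.

(* The transvections exp(a ad x_1) turn the Lie group L_p into [hmul], and [hexp]
   is its exponential map, with second-kind coordinates on the target. *)
Definition hexp u : 'rV[R]_p := \row_(i < p)
  (fun k => if k == 1%N then crd u 1 else
     \sum_(j < k.-1) crd u 1 ^+ j / j.+1`!%:R * crd u (k - j)) i.+1.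

Lemma crd_hmul1 u v : crd (hmul u v) 1 = crd u 1 + crd v 1.
Proof.
rewrite crd_row /=; case: ifP => // h.
by rewrite !crd_out ?addr0 //; lia.
Qed.

Lemma crd_hmul u v k : (2 <= k <= p)%N -> crd (hmul u v) k =
  crd u k + \sum_(j < k.-1) crd u 1 ^+ j / j`!%:R * crd v (k - j).
Proof.
move=> hk; rewrite crd_row (_ : (0 < k <= p)%N); last by lia.
by case: k hk => [|[|k]].
Qed.

Lemma crd_hexp1 u : crd (hexp u) 1 = crd u 1.
Proof. by rewrite crd_row /=; case: ifP => // h; rewrite crd_out //; lia. Qed.

Lemma crd_hexp u k : (2 <= k <= p)%N -> crd (hexp u) k =
  \sum_(j < k.-1) crd u 1 ^+ j / j.+1`!%:R * crd u (k - j).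
Proof.
move=> hk; rewrite crd_row (_ : (0 < k <= p)%N); last by lia.
by case: k hk => [|[|k]].
Qed.

Lemma sum_triangle (V : nmodType) k (F : nat -> nat -> V) :
  \sum_(i < k) \sum_(j < i.+1) F j (i - j)%N = \sum_(j < k) \sum_(m < k - j) F j m.
Proof.
elim: k => [|k IH]; first by rewrite !big_ord0.
rewrite big_ord_recr /= IH [RHS]big_ord_recr /= subSnn big_ord1.
rewrite [X in _ + X]big_ord_recr /= subnn addrA; congr (_ + _).
rewrite -big_split; apply: eq_bigr => j _ /=.
by rewrite subSn ?big_ord_recr // ltnW.
Qed.

Lemma conv_crdM (C P : {poly R}) u k : P`_0 = 0 -> (0 < k)%N ->
  \sum_(j < k.-1) C`_j * conv_crd P u (k - j) = conv_crd (C * P) u k.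
Proof.
case: k => // k P0 _ /=.
transitivity (\sum_(j < k.+1) C`_j * conv_crd P u (k.+1 - j)).
  by rewrite big_ord_recr /= subSnn /conv_crd big_ord1 P0 mul0r mulr0 addr0.
rewrite /conv_crd; under eq_bigr do rewrite mulr_sumr.
rewrite -(@sum_triangle _ k.+1 (fun j m => C`_j * (P`_m * tail_crd u ((k.+1 - j).+1 - m)))).
apply: eq_bigr => i _; rewrite coefM mulr_suml; apply: eq_bigr => j _.
rewrite mulrA; congr (_ * tail_crd u _); have := ltn_ord i; have := ltn_ord j; lia.
Qed.

Lemma eq_conv_crd N (P Q : {poly R}) u k : (k <= N)%N -> eqX N P Q ->
  conv_crd P u k = conv_crd Q u k.
Proof.
move=> hk h; apply: eq_bigr => m _; rewrite h //; have := ltn_ord m; lia.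
Qed.

Lemma conv_crd_qX N u k : (2 <= k <= p)%N -> (p <= N)%N ->
  conv_crd (qX N (crd u 1)) u k = crd (hexp u) k.
Proof.
move=> hk hp; rewrite crd_hexp //; case: k hk => // k hk.
rewrite /conv_crd big_ord_recl coef_poly /= mul0r add0r; apply: eq_bigr => j _.
have hj := ltn_ord j; rewrite coef_poly /= ifT; last by rewrite /bump /=; lia.
congr (_ * _); rewrite /tail_crd subSS /= /bump /= ifT; last by lia.
by congr (crd u _); lia.
Qed.

(** On both sides each coordinate is a convolution of x and y with series: [phiX] times Dynkin's
    series on the left, [Qu] and [Qv] on the right. The latter solve [eulerX Q = w + c X Q] modulo
    ['X^N], with [w] the one-block sum, so [dynkin_coef] applies to each. *)
Lemma hexp_dynkin N x y : (0 < p)%N -> (p <= N)%N ->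
  hexp (dynkin_bch N (@filiform_br R p) x y) = hmul (hexp x) (hexp y).
Proof.
move=> p0 hpN; have N0 : (0 < N)%N by lia.
set a := crd x 1; set b := crd y 1.
have tot := dynkin_total x y N0.
set T := \sum_(n < N) _ in tot.
set z := dynkin_bch _ _ _ _.
have z1 : crd z 1 = a + b.
  transitivity (T.1 : R^o); last by rewrite tot.
  rewrite /z /dynkin_bch crd_sum /T.
  rewrite (raddf_sum (fst : {additive R^o * ({poly R} * {poly R}) -> R^o})).
  apply: eq_bigr => n _; rewrite crdZ; congr (_ * _).
  rewrite /block_sum crd_sum (raddf_sum (fst : {additive R^o * ({poly R} * {poly R}) -> R^o})).
  apply: eq_bigr => k _; rewrite !crdZ; congr (_ * _).
  case: (block_word k) => [|l w]; first by rewrite invr0 mul0r.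
  have [g [al [be [-> h -> _]]]] := @word_vecP _ _ x y (l :: w) isT.
  case: w h => [|l' w] h; first by rewrite invr1 mul1r.
  by rewrite h // mulr0.
have zk k : (2 <= k <= p)%N -> crd z k = bracket_crd x y k T.
  move=> hk; rewrite /z /dynkin_bch crd_sum /T linear_sum; apply: eq_bigr => n _.
  rewrite crdZ linearZ; congr (_ * _).
  rewrite block_sum_linear /block_sum crd_sum; apply: eq_bigr => f _.
  by rewrite !crdZ; congr (_ * _); exact/esym/bracket_crd_word.
apply: crdP => k; have [hk|hk] := boolP (2 <= k <= p)%N; last first.
  have [->|k1] := eqVneq k 1%N; first by rewrite crd_hmul1 !crd_hexp1.
  by rewrite !crd_out //; lia.
rewrite crd_hmul // !crd_hexp1 crd_hexp // z1.
rewrite -/a -/b.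
pose Qu := qX N a; pose Qv := expX N a * qX N b.
pose al := T.2.1; pose be := T.2.2.
have al0 : al`_0 = 0.
  rewrite /al tot /= coefB !coefM !big_ord1 coefB coefZ !coefXM !coefZ coefXM /=.
  by rewrite coefX; rewrite /= !(mulr0, subr0).
have be0 : be`_0 = 0.
  rewrite /be tot /= coefB !coefM !big_ord1 coefZ !coefXM /=.
  by rewrite /= !(mulr0, subr0).
have int0 P : (int_poly P)`_0 = 0 :> R by rewrite coef_int_poly invr0 mulr0.
have eul (P : {poly R}) : P`_0 = 0 -> eulerX (int_poly P) = P :> {poly R}.
  move=> P0; apply/polyP => i; rewrite coef_eulerX coef_int_poly.
  by case: i => [|i]; rewrite ?mul0r ?P0 // mulrC divfK // natSr_neq0.
have Qu0 : Qu`_0 = 0 by rewrite coef_poly.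
have Qv0 : Qv`_0 = 0 by rewrite coefM big_ord1 [(qX _ _)`__]coef_poly /= mulr0.
have eu : eqX N (phiX N (a + b) * int_poly al) Qu.
  apply: (@dynkin_coef _ _ a b ('X - b *: ('X * Qu))) => //.
  - by rewrite coefB coefX coefZ coefXM /= mulr0 subr0.
  - apply: (@eqX_trans _ _ ('X * expX N a)).
      by apply: (@eqX_leq _ N.+1) => //; exact: euler_qX.
    by apply: eqX_eq; rewrite expX_qX -/Qu -!mul_polyC polyCD; ring.
  by rewrite eul // /al tot; apply: eqX_refl.
have ev : eqX N (phiX N (a + b) * int_poly be) Qv.
  apply: (@dynkin_coef _ _ a b ('X * expX N a)) => //.
  - by rewrite coefXM.
  - rewrite /Qv eulerXM.
    apply: (@eqX_trans _ _ ((a *: ('X * expX N a)) * qX N b + expX N a * ('X * expX N b))).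
      apply: (@eqX_leq _ N.+1) => //; apply: eqXD.
        by apply: eqXM => //; exact: euler_expX.
      by apply: eqXM => //; exact: euler_qX.
    by apply: eqX_eq; rewrite [expX N b]expX_qX -!mul_polyC polyCD; ring.
  by rewrite eul // /be tot; apply: eqX_refl.
transitivity (conv_crd (phiX N (a + b) * int_poly al) x k
            + conv_crd (phiX N (a + b) * int_poly be) y k).
  rewrite -!conv_crdM //; [|lia..].
  rewrite -[RHS]big_split; apply: eq_bigr => j _ /=; have hj := ltn_ord j.
  rewrite -mulrDr coef_poly ifT; last by lia.
  by rewrite zk //; lia.
rewrite (eq_conv_crd _ _ eu) ?(eq_conv_crd _ _ ev); [|lia..].
rewrite conv_crd_qX //; congr (_ + _).
rewrite /Qv -conv_crdM //; [|by rewrite coef_poly|lia].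
apply: eq_bigr => j _; have hj := ltn_ord j.
rewrite conv_crd_qX //; last by lia.
by rewrite coef_poly ifT //; lia.
Qed.

End ExpCoordinates.

(** * The group law in second-kind coordinates *)

Section Convolution.
Variable R : realType.
Implicit Types (P Q : {poly R}) (f : nat -> R).

(** A polynomial in the shift of the coordinates of the ideal, index 1 excluded. These operators
    compose as the polynomials multiply ([convfM]), so that identities between series become
    identities in the group. *)
Definition convf P f k := \sum_(j < k.-1) P`_j * f (k - j)%N.

Lemma convfM P Q f k : convf P (convf Q f) k = convf (P * Q) f k.
Proof.
rewrite /convf; set K := k.-1.
transitivity (\sum_(j < K) \sum_(m < K - j) P`_j * Q`_m * f (k - (j + m))%N).
  apply: eq_bigr => j _; rewrite mulr_sumr (_ : (k - j).-1 = (K - j)%N); last by lia.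
  by apply: eq_bigr => m _; rewrite mulrA subnDA.
rewrite -(sum_triangle K (fun j m => P`_j * Q`_m * f (k - (j + m))%N)).
apply: eq_bigr => i _; rewrite coefM mulr_suml; apply: eq_bigr => j _.
by congr (_ * f _); have := ltn_ord j; lia.
Qed.

Lemma eq_convf N P Q f g k : eqX N P Q -> (k.-1 <= N)%N ->
  (forall i, (2 <= i <= k)%N -> f i = g i) -> convf P f k = convf Q g k.
Proof.
move=> h hk hf; apply: eq_bigr => j _; have := ltn_ord j => hj.
by rewrite h ?hf //; lia.
Qed.

Lemma convf1 f k : (2 <= k)%N -> convf 1 f k = f k.
Proof.
case: k => [|[|k]] // _; rewrite /convf /= big_ord_recl coef1 mul1r subn0.
by rewrite big1 ?addr0 // => j _; rewrite coef1 mul0r.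
Qed.

Lemma convfD P f g k : convf P (fun i => f i + g i) k = convf P f k + convf P g k.
Proof. by rewrite -big_split; apply: eq_bigr => j _; rewrite mulrDr. Qed.

Lemma convfZ P f a k : convf P (fun i => a * f i) k = a * convf P f k.
Proof. by rewrite /convf mulr_sumr; apply: eq_bigr => j _; rewrite mulrCA. Qed.

End Convolution.

Section HMul.
Variables (R : realType) (p : nat).
Implicit Types u v w x y : 'rV[R]_p.

Lemma crd_eqP u v : crd u 1 = crd v 1 ->
  (forall k, (2 <= k <= p)%N -> crd u k = crd v k) -> u = v.
Proof.
move=> h1 h; apply: crdP => k; have [hk|hk] := boolP (2 <= k <= p)%N; first exact: h.
by have [->|k1] := eqVneq k 1%N => //; rewrite !crd_out //; lia.
Qed.

Lemma crd_hmulE u v k : (2 <= k <= p)%N ->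
  crd (hmul u v) k = crd u k + convf (expX p (crd u 1)) (crd v) k.
Proof.
move=> hk; rewrite crd_hmul //; congr (_ + _); apply: eq_bigr => j _.
by rewrite coef_poly ifT //; have := ltn_ord j; lia.
Qed.

Lemma crd_hexpE u k : (2 <= k <= p)%N ->
  crd (hexp u) k = convf (phiX p (crd u 1)) (crd u) k.
Proof.
move=> hk; rewrite crd_hexp //; apply: eq_bigr => j _.
by rewrite coef_poly ifT //; have := ltn_ord j; lia.
Qed.

Lemma expX0 N : expX N (0 : R) = 1.
Proof. by rewrite expX_qX scale0r addr0. Qed.

Lemma hmulA : associative (@hmul R p).
Proof.
move=> u v w; apply: crd_eqP => [|k hk]; first by rewrite !crd_hmul1 addrA.
rewrite !(crd_hmulE _ _ hk) crd_hmul1 -addrA; congr (_ + _).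
transitivity (convf (expX p (crd u 1))
    (fun i => crd v i + convf (expX p (crd v 1)) (crd w) i) k).
  by apply: (@eq_convf _ p) => //; [lia|move=> i hi; rewrite crd_hmulE //; lia].
rewrite convfD convfM; congr (_ + _).
by apply: (@eq_convf _ p.+1) => //; [exact: expX_add|lia].
Qed.

Lemma hmul0x u : hmul 0 u = u.
Proof.
apply: crd_eqP => [|k hk]; first by rewrite crd_hmul1 crd0 add0r.
by rewrite crd_hmulE // !crd0 expX0 convf1 ?add0r //; lia.
Qed.

Lemma hmulx0 u : hmul u 0 = u.
Proof.
apply: crd_eqP => [|k hk]; first by rewrite crd_hmul1 crd0 addr0.
rewrite crd_hmulE // (_ : convf _ _ _ = 0) ?addr0 //.
by rewrite /convf big1 // => j _; rewrite crd0 mulr0.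
Qed.

Definition hinv u : 'rV[R]_p := \row_(i < p)
  (fun k => if k == 1%N then - crd u 1 else
     - \sum_(j < k.-1) (- crd u 1) ^+ j / j`!%:R * crd u (k - j)) i.+1.

Lemma crd_hinv1 u : crd (hinv u) 1 = - crd u 1.
Proof.
by rewrite crd_row /=; case: ifP => // h; rewrite crd_out ?oppr0 //; lia.
Qed.

Lemma crd_hinv u k : (2 <= k <= p)%N -> crd (hinv u) k =
  - \sum_(j < k.-1) (- crd u 1) ^+ j / j`!%:R * crd u (k - j).
Proof.
move=> hk; rewrite crd_row (_ : (0 < k <= p)%N); last by lia.
by case: k hk => [|[|k]].
Qed.

Lemma crd_hinvE u k : (2 <= k <= p)%N ->
  crd (hinv u) k = - convf (expX p (- crd u 1)) (crd u) k.
Proof.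
move=> hk; rewrite crd_hinv //; congr (- _); apply: eq_bigr => j _.
by rewrite coef_poly ifT //; have := ltn_ord j; lia.
Qed.

Lemma hmulxV u : hmul u (hinv u) = 0.
Proof.
apply: crd_eqP => [|k hk]; first by rewrite crd_hmul1 crd_hinv1 subrr crd0.
rewrite crd_hmulE // crd0.
rewrite (@eq_convf _ p _ (expX p (crd u 1)) _
    (fun i => -1 * convf (expX p (- crd u 1)) (crd u) i)) //; first last.
- by move=> i hi; rewrite crd_hinvE ?mulN1r //; lia.
- by lia.
rewrite convfZ convfM (@eq_convf _ p.+1 _ 1 _ (crd u)) ?convf1 ?mulN1r ?subrr //; [lia| |lia].
by rewrite -(expX0 p) -(subrr (crd u 1)); exact: expX_add.
Qed.

Lemma hmulVx u : hmul (hinv u) u = 0.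
Proof.
by rewrite -{2}[u]hmulx0 -[X in hmul u X](hmulxV (hinv u)) (hmulA u) hmulxV hmul0x hmulxV.
Qed.

Lemma hmulKx u v : hmul (hinv u) (hmul u v) = v.
Proof. by rewrite hmulA hmulVx hmul0x. Qed.

Lemma hmulVKx u v : hmul u (hmul (hinv u) v) = v.
Proof. by rewrite hmulA hmulxV hmul0x. Qed.

Lemma hinv_uniq u v : hmul u v = 0 -> v = hinv u.
Proof. by move=> h; rewrite -[v]hmul0x -(hmulVx u) -hmulA h hmulx0. Qed.

Lemma hinvM u v : hinv (hmul u v) = hmul (hinv v) (hinv u).
Proof.
by apply/esym/hinv_uniq; rewrite -hmulA (hmulA v) hmulxV hmul0x hmulxV.
Qed.

Lemma hinv0 : hinv 0 = 0 :> 'rV[R]_p.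
Proof. by apply/esym/hinv_uniq; exact: hmulx0. Qed.

Definition hlog u : 'rV[R]_p := \row_(i < p)
  (fun k => if k == 1%N then crd u 1 else
     convf (logX p (crd u 1) 0) (crd u) k) i.+1.

Lemma crd_hlog1 u : crd (hlog u) 1 = crd u 1.
Proof. by rewrite crd_row /=; case: ifP => // h; rewrite crd_out //; lia. Qed.

Lemma crd_hlog u k : (2 <= k <= p)%N ->
  crd (hlog u) k = convf (logX p (crd u 1) 0) (crd u) k.
Proof.
move=> hk; rewrite crd_row (_ : (0 < k <= p)%N); last by lia.
by case: k hk => [|[|k]].
Qed.

Lemma hexpK : cancel (@hexp R p) hlog.
Proof.
move=> u; apply: crd_eqP => [|k hk]; first by rewrite crd_hlog1 crd_hexp1.
rewrite crd_hlog // crd_hexp1.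
rewrite (@eq_convf _ p _ (logX p (crd u 1) 0) _ (convf (phiX p (crd u 1)) (crd u))) //; first last.
- by move=> i hi; rewrite crd_hexpE //; lia.
- by lia.
rewrite convfM (@eq_convf _ p _ 1 _ (crd u)) ?convf1 //; [lia| |lia].
by have := @log_phiX R p (crd u 1) 0; rewrite addr0.
Qed.

Lemma hlogK : cancel hlog (@hexp R p).
Proof.
move=> u; apply: crd_eqP => [|k hk]; first by rewrite crd_hexp1 crd_hlog1.
rewrite crd_hexpE // crd_hlog1.
rewrite (@eq_convf _ p _ (phiX p (crd u 1)) _ (convf (logX p (crd u 1) 0) (crd u))) //; first last.
- by move=> i hi; rewrite crd_hlog //; lia.
- by lia.
rewrite convfM (@eq_convf _ p _ 1 _ (crd u)) ?convf1 //; [lia| |lia].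
by rewrite mulrC; have := @log_phiX R p (crd u 1) 0; rewrite addr0.
Qed.

Lemma hexp0 : hexp 0 = 0 :> 'rV[R]_p.
Proof.
apply: crd_eqP => [|k hk]; first by rewrite crd_hexp1.
by rewrite crd_hexpE // !crd0 /convf big1 // => j _; rewrite crd0 mulr0.
Qed.

Lemma hlog0 : hlog 0 = 0.
Proof. by rewrite -[in LHS]hexp0 hexpK. Qed.

Lemma hlog_hmul N u v : (0 < p)%N -> (p <= N)%N ->
  hlog (hmul u v) = dynkin_bch N (@filiform_br R p) (hlog u) (hlog v).
Proof. by move=> p0 hp; rewrite -[RHS]hexpK hexp_dynkin // !hlogK. Qed.

(** The two charts agree on the lines of x_1 and x_2, so horizontal letters are one-parameter
    subgroups in either. *)
Lemma hlog_basis i a : (i <= 2)%N -> hlog (a *: xb R p i) = a *: xb R p i.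
Proof.
move=> hi; rewrite -[RHS]hexpK; congr (hlog _); apply/esym.
have tail k : (2 < k)%N -> crd (a *: xb R p i) k = 0.
  by move=> hk; rewrite crdZ crd_xb (_ : i == k = false) ?mulr0 //; lia.
apply: crd_eqP => [|k hk]; first by rewrite crd_hexp1.
set b := crd (a *: xb R p i) 1.
rewrite crd_hexp //; case: k hk => [|[|k]] // hk /=.
rewrite big_ord_recl subn0 expr0 invr1 !mul1r.
have [i2|i2] := eqVneq i 2%N; last first.
  have t2 j : (2 <= j)%N -> crd (a *: xb R p i) j = 0.
    by move=> hj; rewrite crdZ crd_xb (_ : i == j = false) ?mulr0 //; lia.
  rewrite big1 ?addr0 // => j _; rewrite (t2 (_ - _)%N) ?mulr0 //.
  by have := ltn_ord j; rewrite /= /bump /=; lia.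
have b0 : crd (a *: xb R p i) 1 = 0 by rewrite crdZ crd_xb i2 /= mulr0.
by rewrite big1 ?addr0 // => j _; rewrite b0 /= /bump add1n exprS !mul0r.
Qed.

End HMul.

(** * Dilations, homogeneous balls and horizontal words *)

Section Homogeneous.
Variables (R : realType) (p : nat).
Implicit Types (u v w x y : 'rV[R]_p) (s t a b c : R).

Definition hwt (k : nat) := maxn 1 k.-1.

Definition hdil t u : 'rV[R]_p := \row_(i < p) (fun k => t ^+ hwt k * crd u k) i.+1.

Lemma crd_hdil t u k : crd (hdil t u) k = t ^+ hwt k * crd u k.
Proof.
by rewrite crd_row; case: ifP => // h; rewrite crd_out ?mulr0 //; lia.
Qed.

Lemma hdilM t u v : hdil t (hmul u v) = hmul (hdil t u) (hdil t v).
Proof.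
apply: crd_eqP => [|k hk]; first by rewrite crd_hdil !crd_hmul1 !crd_hdil mulrDr.
rewrite crd_hdil !crd_hmul // !crd_hdil mulrDr; congr (_ + _).
rewrite [LHS]mulr_sumr; apply: eq_bigr => j _; have hj := ltn_ord j.
rewrite exprMn crd_hdil [hwt 1]/hwt expr1; have -> : hwt k = (j + hwt (k - j))%N by rewrite /hwt; lia.
by rewrite exprD; ring.
Qed.

Lemma hdil_dil s t u : hdil s (hdil t u) = hdil (s * t) u.
Proof. by apply: crdP => k; rewrite !crd_hdil exprMn mulrA. Qed.

Lemma hdil1 u : hdil 1 u = u.
Proof. by apply: crdP => k; rewrite crd_hdil expr1n mul1r. Qed.

Lemma hdil0 u : hdil 0 u = 0.
Proof. by apply: crdP => k; rewrite crd_hdil crd0 /hwt expr0n (_ : _ == _ = false) ?mul0r //; lia. Qed.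

Lemma hdilx0 t : hdil t 0 = 0.
Proof. by apply: crdP => k; rewrite crd_hdil !crd0 mulr0. Qed.

Lemma hdilV t u : hdil t (hinv u) = hinv (hdil t u).
Proof. by apply: hinv_uniq; rewrite -hdilM hmulxV hdilx0. Qed.

Definition hball t u := forall k, `|crd u k| <= t ^+ hwt k.

Lemma hball_ge0 t u : hball t u -> 0 <= t.
Proof. by move=> /(_ 1%N); rewrite expr1; apply: le_trans. Qed.

Lemma hball_leq t t' u : hball t u -> t <= t' -> hball t' u.
Proof.
move=> h tt' k; apply: (le_trans (h k)); apply: lerXn2r => //; rewrite nnegrE;
  have := hball_ge0 h; lra.
Qed.

Lemma hball0 t : 0 <= t -> hball t 0.
Proof. by move=> t0 k; rewrite crd0 normr0 exprn_ge0. Qed.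

Lemma hballP t u : 0 <= t -> `|crd u 1| <= t ->
  (forall k, (2 <= k <= p)%N -> `|crd u k| <= t ^+ k.-1) -> hball t u.
Proof.
move=> t0 h1 h k; have [hk|hk] := boolP (2 <= k <= p)%N.
  by have := h k hk; congr (_ <= _ ^+ _); rewrite /hwt; lia.
have [->|k1] := eqVneq k 1%N; first by rewrite /hwt expr1.
by rewrite crd_out ?normr0 ?exprn_ge0 //; lia.
Qed.

Lemma hball_dil s t u : 0 <= s -> hball t u -> hball (s * t) (hdil s u).
Proof.
move=> s0 h k; rewrite crd_hdil exprMn normrM ger0_norm ?exprn_ge0 //.
by rewrite ler_wpM2l // exprn_ge0.
Qed.

Lemma hball_dil1 s t u : 0 <= s <= 1 -> hball t u -> hball t (hdil s u).
Proof.
move=> /andP[s0 s1] h; apply: hball_leq (hball_dil s0 h) _.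
by have := hball_ge0 h; nra.
Qed.

Lemma hball_undil s u : 0 < s -> hball s u -> exists2 v, hball 1 v & u = hdil s v.
Proof.
move=> s0 h; exists (hdil s^-1 u); last by rewrite hdil_dil mulfV ?hdil1 // gt_eqF.
rewrite -(mulVf (lt0r_neq0 s0)); apply: hball_dil => //.
by rewrite invr_ge0 ltW.
Qed.

Lemma inv_fact_ge0 n : 0 <= (n`!%:R : R)^-1. Proof. by rewrite invr_ge0. Qed.

Lemma inv_fact_le1 n : (n`!%:R : R)^-1 <= 1.
Proof. by rewrite invf_le1 ?ltr0n ?fact_gt0 // ler1n fact_gt0. Qed.

(** As [1 / j! <= 1 <= 'C(k.-1, j)], the sum is dominated by the binomial expansion of
    [(t + t') ^+ k.-1] without its last term [t ^+ k.-1], which is left for the coordinate of the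
    other factor. Hence the radii simply add in [hballM]. *)
Lemma hconv_bound a t t' u k : 0 <= t' -> (2 <= k <= p)%N -> `|a| <= t -> hball t' u ->
  t ^+ k.-1 + `|\sum_(j < k.-1) a ^+ j / j`!%:R * crd u (k - j)| <= (t + t') ^+ k.-1.
Proof.
move=> t'0 hk ha hu; have t0 : 0 <= t by exact: le_trans ha.
rewrite addrC [t + t']addrC exprDn big_ord_recr /= subnn expr0 mul1r binn mulr1n.
rewrite lerD2r; apply: le_trans (ler_norm_sum _ _ _) _; apply: ler_sum => j _.
have hj := ltn_ord j; rewrite !normrM normrX normfV (ger0_norm (ler0n _ _)).
have -> : t' ^+ (k.-1 - j) * t ^+ j *+ 'C(k.-1, j) =
    t ^+ j * 'C(k.-1, j)%:R * t' ^+ (k.-1 - j).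
  by rewrite -mulr_natr; ring.
apply: ler_pM => //.
  apply: ler_pM => //.
    by apply: lerXn2r; rewrite ?nnegrE.
  apply: (le_trans (inv_fact_le1 j)); rewrite ler1n bin_gt0; lia.
apply: (le_trans (hu _)); rewrite (_ : hwt _ = (k.-1 - j)%N) //.
by rewrite /hwt; lia.
Qed.

Lemma hballM t t' u v : hball t u -> hball t' v -> hball (t + t') (hmul u v).
Proof.
move=> hu hv; have t0 := hball_ge0 hu; have t'0 := hball_ge0 hv.
have h1 := hu 1%N; rewrite /hwt expr1 in h1.
apply: hballP => [||k hk]; first exact: addr_ge0.
  rewrite crd_hmul1; apply: (le_trans (ler_normD _ _)); apply: lerD => //.
rewrite crd_hmul //; apply: (le_trans (ler_normD _ _)).
apply: le_trans (hconv_bound t'0 hk h1 hv); rewrite lerD2r.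
by have := hu k; rewrite (_ : hwt k = k.-1) // /hwt; lia.
Qed.

Lemma hballV t u : hball t u -> hball (2 * t) (hinv u).
Proof.
move=> hu; have t0 := hball_ge0 hu.
have h1 := hu 1%N; rewrite /hwt expr1 in h1.
apply: hballP => [||k hk]; first by rewrite mulr_ge0.
  by rewrite crd_hinv1 normrN; lra.
rewrite crd_hinv // normrN mulr_natl mulr2n.
rewrite -normrN in h1; apply: le_trans (hconv_bound t0 hk h1 hu).
by rewrite lerDr exprn_ge0.
Qed.

(** The centre of L_p, of weight [p.-1]. *)
Definition hz c : 'rV[R]_p := c *: xb R p p.

Lemma crd_hz c k : crd (hz c) k = if (k == p) && (0 < p)%N then c else 0.
Proof.
rewrite crdZ crd_xb eq_sym; case: eqP => [->|_] /=; last by rewrite mulr0.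
by rewrite leqnn andbT; case: ifP => _; rewrite ?mulr1 ?mulr0.
Qed.

Lemma crd_hmulV u v k : (2 <= k <= p)%N -> crd (hmul (hinv u) v) k =
  \sum_(j < k.-1) (- crd u 1) ^+ j / j`!%:R * (crd v (k - j) - crd u (k - j)).
Proof.
move=> hk; rewrite crd_hmul // crd_hinv // crd_hinv1 addrC -sumrB.
by apply: eq_bigr => j _; rewrite mulrBr.
Qed.

(* For t' - t = 1 / M, the k-th coordinate is bounded once M >= r ^+ hwt k: this
   fixes the number M of levels of the cones below. *)
Lemma hdil_increment r t t' u k : hball r u -> 0 <= t <= t' -> t' <= 1 ->
  `|crd (hmul (hinv (hdil t u)) (hdil t' u)) k| <= (p ^ 2)%:R * (t' - t) * r ^+ hwt k.
Proof.
move=> hu /andP[t0 tt'] t'1; have r0 := hball_ge0 hu.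
have B0 n : 0 <= (p ^ 2)%:R * (t' - t) * r ^+ n.
  by rewrite !mulr_ge0 ?exprn_ge0 // subr_ge0.
have pw n : 0 <= t' ^+ n - t ^+ n <= n%:R * (t' - t).
  rewrite subr_ge0 lerXn2r ?nnegrE //=; last by lra.
  elim: n => [|n IH]; first by rewrite !expr0 subrr mul0r.
  rewrite !exprS -natr1.
  have x1 : t' ^+ n <= 1 by rewrite exprn_ile1 //; lra.
  have x0 : t ^+ n <= t' ^+ n by rewrite lerXn2r ?nnegrE //; lra.
  have x2 : 0 <= t ^+ n by rewrite exprn_ge0.
  have e : t' * t' ^+ n - t * t ^+ n = (t' - t) * t' ^+ n + t * (t' ^+ n - t ^+ n) by ring.
  have : (t' - t) * t' ^+ n <= t' - t by rewrite ler_piMr // subr_ge0.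
  have : t * (t' ^+ n - t ^+ n) <= t' ^+ n - t ^+ n by rewrite ler_piMl ?subr_ge0 //; lra.
  rewrite e; lra.
have [hk|hk] := boolP (2 <= k <= p)%N; last first.
  have [k1|k1] := eqVneq k 1%N; last by rewrite crd_out ?normr0 //; lia.
  have [p0|p0] := posnP p; first by rewrite crd_out ?normr0 //; lia.
  rewrite k1 crd_hmul1 crd_hinv1 !crd_hdil /hwt !expr1 addrC -mulrBl normrM.
  rewrite ger0_norm ?subr_ge0 //; apply: ler_pM => //; first by rewrite subr_ge0.
  by rewrite ler_peMl ?subr_ge0 // ler1n expn_gt0 p0.
rewrite crd_hmulV //; apply: le_trans (ler_norm_sum _ _ _) _.
apply: (@le_trans _ _ (\sum_(j < k.-1) p%:R * (t' - t) * r ^+ hwt k)); last first.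
  rewrite sumr_const card_ord -[_ *+ k.-1]mulr_natl !mulrA; apply: ler_wpM2r; first exact: exprn_ge0.
  apply: ler_wpM2r; first by rewrite subr_ge0.
  by rewrite -natrM ler_nat expnS expn1 leq_mul2r; lia.
apply: ler_sum => j _; have hj := ltn_ord j.
rewrite !crd_hdil -mulrBl normrM.
have wE : hwt (k - j) = (k.-1 - j)%N by rewrite /hwt; lia.
rewrite (_ : hwt k = (j + hwt (k - j))%N); last by rewrite /hwt; lia.
rewrite exprD normrM normfV normrX normrN normrM !(ger0_norm (ler0n _ _)).
have := pw (hwt (k - j)); set d := t' ^+ _ - _ => /andP[d0 d1].
rewrite normrM (ger0_norm d0) [hwt 1]/hwt expr1 (ger0_norm t0).
have -> : (t * `|crd u 1|) ^+ j / j`!%:R * (d * `|crd u (k - j)|) =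
  d * ((t * `|crd u 1|) ^+ j * j`!%:R^-1) * `|crd u (k - j)| by ring.
have -> : p%:R * (t' - t) * (r ^+ j * r ^+ hwt (k - j)) =
  p%:R * (t' - t) * (r ^+ j * 1) * r ^+ hwt (k - j) by ring.
have ta : 0 <= t * `|crd u 1| by exact: mulr_ge0.
apply: ler_pM => //.
  apply: mulr_ge0 => //; apply: mulr_ge0; [exact: exprn_ge0|exact: inv_fact_ge0].
apply: ler_pM => //.
- by apply: mulr_ge0; [exact: exprn_ge0|exact: inv_fact_ge0].
- apply: (le_trans d1); apply: ler_wpM2r; first by rewrite subr_ge0.
  by rewrite ler_nat; lia.
apply: ler_pM; [exact: exprn_ge0|exact: inv_fact_ge0| |exact: inv_fact_le1].
apply: lerXn2r; rewrite ?nnegrE //.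
have u1 := hu 1%N; rewrite /hwt expr1 in u1.
by have := normr_ge0 (crd u 1); nra.
Qed.

End Homogeneous.

Section Center.
Variables (R : realType) (p : nat).
Hypothesis p2 : (2 <= p)%N.
Implicit Types (u v w : 'rV[R]_p) (a b c t : R).

Lemma hz_tail c k : (k < p)%N -> crd (hz p c) k = 0.
Proof. by move=> hk; rewrite crd_hz (_ : k == p = false) //; lia. Qed.

Lemma hz_top c : crd (hz p c) p = c.
Proof. by rewrite crd_hz eqxx (ltnW p2). Qed.

Lemma hmul_z u c : hmul u (hz p c) = u + hz p c.
Proof.
apply: crd_eqP => [|k hk]; first by rewrite crd_hmul1 crdD.
rewrite crd_hmul // crdD; congr (_ + _); case: k hk => [|[|k]] // hk /=.
rewrite big_ord_recl subn0 expr0 fact0 divr1 mul1r big1 ?addr0 // => j _.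
by rewrite hz_tail ?mulr0 //; have := ltn_ord j; rewrite /= /bump /=; lia.
Qed.

Lemma hzmul c u : hmul (hz p c) u = u + hz p c.
Proof.
apply: crd_eqP => [|k hk]; first by rewrite crd_hmul1 crdD addrC.
rewrite crd_hmulE // crdD addrC hz_tail // expX0 convf1 //; lia.
Qed.

Lemma hz0 : hz p 0 = 0 :> 'rV[R]_p. Proof. exact: scale0r. Qed.

Lemma hzD a b : hz p a + hz p b = hz p (a + b). Proof. by rewrite /hz scalerDl. Qed.

Lemma hmulDz u v c : hmul u (v + hz p c) = hmul u v + hz p c.
Proof. by rewrite -!hmul_z hmulA. Qed.

Lemma hDzmul u v c : hmul (u + hz p c) v = hmul u v + hz p c.
Proof. by rewrite -hmul_z -hmulA hzmul hmulDz. Qed.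

Lemma hinvDz u c : hinv (u + hz p c) = hinv u + hz p (- c).
Proof.
by apply/esym/hinv_uniq; rewrite hDzmul hmulDz hmulxV add0r hzD addNr hz0.
Qed.

Lemma hinv_z c : hinv (hz p c) = hz p (- c).
Proof. by rewrite -[hz p c]add0r hinvDz hinv0 add0r. Qed.

Lemma hdil_z t c : hdil t (hz p c) = hz p (t ^+ p.-1 * c).
Proof.
apply: crdP => k; rewrite crd_hdil !crd_hz; case: ifP => [/andP[/eqP -> _]|_]; rewrite ?mulr0 //.
by congr (_ ^+ _ * _); rewrite /hwt; lia.
Qed.

Lemma hdilDz t u c : hdil t (u + hz p c) = hdil t u + hz p (t ^+ p.-1 * c).
Proof. by rewrite -hmul_z hdilM hdil_z hmul_z. Qed.

Lemma hball_z t c : 0 <= t -> `|c| <= t ^+ p.-1 -> hball t (hz p c).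
Proof.
move=> t0 ht k; rewrite crd_hz; case: ifP => [/andP[/eqP -> _]|_].
  by rewrite (_ : hwt p = p.-1) // /hwt; lia.
by rewrite normr0 exprn_ge0.
Qed.

End Center.

Section Horizontal.
Variables (R : realType) (p : nat).
Hypothesis p2 : (2 <= p)%N.
Implicit Types (u v w : 'rV[R]_p) (a b c t : R) (l : seq (bool * R)).

Definition hor (x : bool * R) : 'rV[R]_p := x.2 *: xb R p (if x.1 then 1 else 2)%N.

Definition hword l : 'rV[R]_p := foldr (fun x => hmul (hor x)) 0 l.

Lemma hword_cat l l' : hword (l ++ l') = hmul (hword l) (hword l').
Proof. by elim: l => [|x l IH]; rewrite /= ?hmul0x // IH hmulA. Qed.

Lemma hdil_hor t x : hdil t (hor x) = hor (x.1, t * x.2).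
Proof.
apply: crdP => k; rewrite crd_hdil !crdZ !crd_xb mulrAC -!mulrA; case: x => [[] a] /=.
  by case: eqP => [<-|_]; rewrite /= ?(mul0r, mulr0) // /hwt expr1; ring.
by case: eqP => [<-|_]; rewrite /= ?(mul0r, mulr0) // /hwt expr1; ring.
Qed.

Lemma hdil_word t l : hdil t (hword l) = hword [seq (x.1, t * x.2) | x <- l].
Proof. by elim: l => [|x l IH] /=; rewrite ?hdilx0 // hdilM IH hdil_hor. Qed.

Lemma hmul_crd1 u v k : crd u 1 = 0 -> crd (hmul u v) k = crd u k + crd v k.
Proof.
move=> u0; have [hk|hk] := boolP (2 <= k <= p)%N.
  by rewrite crd_hmulE // u0 expX0 convf1 //; lia.
have [->|k1] := eqVneq k 1%N; first by rewrite crd_hmul1.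
by rewrite !crd_out ?addr0 //; lia.
Qed.

(* Conjugating x_2 by the powers of x_1 gives vectors (a^j / j!)_j, which span
   the ideal by Vandermonde. *)
Definition conj_word a b := [:: (true, a); (false, b); (true, - a)].

Lemma crd_conj_word a b k : crd (hword (conj_word a b)) k =
  if (2 <= k <= p)%N then a ^+ (k - 2) / (k - 2)`!%:R * b else 0.
Proof.
rewrite /hword /= hmulx0; set v := hmul (hor (false, b)) _.
have b0 : crd (hor (false, b)) 1 = 0 by rewrite crdZ crd_xb mulr0.
have vE i : crd v i = b * ((i == 2) && (2 <= p))%N%:R - a * ((i == 1) && (1 <= p))%N%:R.
  rewrite /v hmul_crd1 // !crdZ !crd_xb mulNr.
  by congr (_ * _%:R - _ * _%:R); case: i => [|[|[|i]]].
case: ifP => hk; last first.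
  have [->|k1] := eqVneq k 1%N; last by rewrite crd_out //; lia.
  rewrite crd_hmul1 vE crdZ crd_xb /= mulr0 sub0r.
  by rewrite (_ : (0 < p)%N) ?mulr1 ?subrr //; lia.
rewrite crd_hmul // crdZ crd_xb /= (_ : 1%N == k = false) ?mulr0 ?add0r; last by lia.
have hk2 : (k - 2 < k.-1)%N by lia.
rewrite (bigD1 (Ordinal hk2)) //= big1 ?addr0 => [|j /eqP hj].
  rewrite crdZ crd_xb /= (_ : (0 < p)%N) ?mulr1; last by lia.
  rewrite vE (_ : k - (k - 2) = 2)%N; last by lia.
  by rewrite eqxx p2 mulr1 /= mulr0 subr0.
have h1 : (k - j)%N != 2%N.
  by apply/eqP => h; apply: hj; apply: val_inj => /=; have := ltn_ord j; lia.
have h2 : (k - j)%N != 1%N by have := ltn_ord j; lia.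
by rewrite vE (negPf h1) (negPf h2) /= !mulr0 subrr mulr0.
Qed.

(** The conjugates have first coordinate 0, so they multiply by adding up; their coefficients [be u]
    solve a linear system and are therefore bounded on the unit ball. The last letter restores the
    first coordinate. After a dilation the same number of letters serves for every radius. *)
Lemma horizontal_words : exists n (C : R), 0 <= C /\
  forall u, hball 1 u -> exists l,
    [/\ (size l <= n)%N, forall x, x \in l -> `|x.2| <= C & hword l = u].
Proof.
pose q := p.-1; pose V : 'M[R]_q := Vandermonde q (\row_(i < q) (i : nat)%:R).
have Vu : V \in unitmx.
  rewrite unitmxE unitfE /V det_Vandermonde; apply/prodf_neq0 => i _.
  apply/prodf_neq0 => j hij; rewrite !mxE subr_eq0 eqr_nat; lia.
pose be (u : 'rV[R]_p) : 'cV[R]_q :=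
  invmx V *m \col_(j < q) ((j : nat)`!%:R * crd u j.+2).
have beP u (j : 'I_q) : \sum_(a < q) (a : nat)%:R ^+ j * be u a 0 = (j : nat)`!%:R * crd u j.+2.
  have : (V *m be u) j 0 = (j : nat)`!%:R * crd u j.+2.
    by rewrite mulmxA mulmxV // mul1mx mxE.
  by rewrite mxE => <-; apply: eq_bigr => a _; rewrite !mxE.
pose S := \sum_a \sum_(j < q) (`|invmx V a j| * (j : nat)`!%:R).
have T0 (a : 'I_q) : 0 <= \sum_(j < q) (`|invmx V a j| * (j : nat)`!%:R).
  by rewrite sumr_ge0 // => j _; exact: mulr_ge0.
have S0 : 0 <= S by apply: sumr_ge0 => a _; exact: T0.
pose C := S + q%:R + 1; have q0 : (0 : R) <= q%:R by [].
have C0 : 0 <= C by rewrite /C; lra.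
exists (3 * q + 1)%N, C; split => // u hu.
exists (flatten [seq conj_word (i : nat)%:R (be u i 0) | i : 'I_q <- enum 'I_q] ++ [:: (true, crd u 1)]).
split.
- rewrite size_cat size_flatten /shape -map_comp /= leq_add2r sumnE big_map.
  by rewrite (eq_bigr (fun=> 3%N)) // big_enum /= sum_nat_const card_ord mulnC.
- have u1 : `|crd u 1| <= C.
    by apply: (le_trans (hu 1%N)); rewrite expr1n /C; lra.
  move=> x; rewrite mem_cat => /orP[/flatten_mapP[a _]|]; last first.
    by rewrite inE => /eqP ->.
  have aC : `|(a : nat)%:R : R| <= C.
    rewrite ger0_norm //; apply: (@le_trans _ _ (q%:R)); last by rewrite /C; lra.
    by rewrite ler_nat ltnW.
  rewrite !inE => /or3P[] /eqP -> //=; last by rewrite normrN.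
  apply: (@le_trans _ _ S); last by rewrite /C; lra.
  rewrite /S (bigD1 a) //= ler_wpDr //; first by apply: sumr_ge0 => i _; exact: T0.
  rewrite mxE; apply: le_trans (ler_norm_sum _ _ _) _; apply: ler_sum => j _.
  rewrite mxE normrM; apply: ler_wpM2l => //; rewrite normrM (ger0_norm (ler0n _ _)).
  by rewrite ler_piMr //; apply: (le_trans (hu _)); rewrite expr1n.
have wE (s : seq 'I_q) k : crd (hword (flatten [seq conj_word (i : nat)%:R (be u i 0) | i : 'I_q <- s])) k =
    \sum_(i <- s) if (2 <= k <= p)%N then (i : nat)%:R ^+ (k - 2) / (k - 2)`!%:R * be u i 0 else 0.
  elim: s => [|i s IH]; first by rewrite big_nil crd0.
  rewrite map_cons -[flatten (_ :: _)]/(_ ++ flatten _) hword_cat hmul_crd1 ?crd_conj_word //.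
  by rewrite big_cons IH.
have w1 s : crd (hword (flatten [seq conj_word (i : nat)%:R (be u i 0) | i : 'I_q <- s])) 1 = 0.
  by rewrite wE big1.
apply: crd_eqP => [|k hk]; rewrite hword_cat hmul_crd1 ?w1 // /= hmulx0 crdZ crd_xb /=.
  by rewrite (_ : (0 < p)%N) ?mulr1 ?add0r //; lia.
rewrite (_ : 1%N == k = false) ?mulr0 ?addr0; last by lia.
rewrite wE hk big_enum /=; have hk2 : (k - 2 < q)%N by rewrite /q; lia.
have := beP u (Ordinal hk2); rewrite /= (_ : (k - 2).+2 = k); last by lia.
move=> h; apply: (mulfI (factr_neq0 R (k - 2))); rewrite -h mulr_sumr.
apply: eq_bigr => a _; have := factr_neq0 R (k - 2).
by move=> ?; field.
Qed.

End Horizontal.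

Local Open Scope classical_set_scope.
Local Open Scope ring_scope.

(** * Groups with a polynomial law and their Riemannian metrics *)

Section Polyf.
Variables (R : realType) (T : Type) (J : finType) (v : J -> T -> R).

(** A predicate rather than a type of polynomials: the chain rule, continuity and bounds on bounded
    sets follow by induction on the way the function is built. *)
Inductive polyf : (T -> R) -> Prop :=
| polyf_cst a : polyf (fun _ => a)
| polyf_var j : polyf (v j)
| polyfD f g : polyf f -> polyf g -> polyf (fun x => f x + g x)
| polyfM f g : polyf f -> polyf g -> polyf (fun x => f x * g x).

Lemma polyf_ext f g : polyf f -> f =1 g -> polyf g.
Proof. by move=> hf /funext <-. Qed.

Lemma polyfZ a f : polyf f -> polyf (fun x => a * f x).
Proof. by move=> hf; apply: polyfM => //; apply: polyf_cst. Qed.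

Lemma polyfX f n : polyf f -> polyf (fun x => f x ^+ n).
Proof.
move=> hf; elim: n => [|n IH].
  by apply: (polyf_ext (polyf_cst 1)) => x; rewrite expr0.
by apply: (polyf_ext (polyfM hf IH)) => x; rewrite exprS.
Qed.

Lemma polyf_sum (I : Type) (r : seq I) (F : I -> T -> R) :
  (forall i, polyf (F i)) -> polyf (fun x => \sum_(i <- r) F i x).
Proof.
move=> hF; elim: r => [|i r IH].
  by apply: (polyf_ext (polyf_cst 0)) => x; rewrite big_nil.
by apply: (polyf_ext (polyfD (hF i) IH)) => x; rewrite big_cons.
Qed.

Lemma is_derive_polyf f : polyf f -> exists2 G : J -> T -> R,
  (forall j, polyf (G j)) &
  forall (c : R -> T) (t : R) (d : J -> R),
    (forall j, is_derive t 1 (v j \o c) (d j)) ->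
    is_derive t 1 (f \o c) (\sum_j G j (c t) * d j).
Proof.
elim=> [a|j|f1 f2 _ [G1 p1 h1] _ [G2 p2 h2]|f1 f2 q1 [G1 p1 h1] q2 [G2 p2 h2]].
- exists (fun _ _ => 0) => [j|c t d _]; first exact: polyf_cst.
  by rewrite big1 => [|j _]; [exact: is_derive_cst|rewrite mul0r].
- exists (fun i _ => (i == j)%:R) => [i|c t d h]; first exact: polyf_cst.
  rewrite (bigD1 j) //= eqxx mul1r big1 ?addr0 // => i /negPf ->.
  by rewrite mul0r.
- exists (fun j x => G1 j x + G2 j x) => [j|c t d h]; first exact: polyfD.
  have -> : \sum_j (G1 j (c t) + G2 j (c t)) * d j =
      \sum_j G1 j (c t) * d j + \sum_j G2 j (c t) * d j.
    by rewrite -big_split; apply: eq_bigr => j _; rewrite mulrDl.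
  exact: is_deriveD (h1 _ _ _ h) (h2 _ _ _ h).
exists (fun j x => f1 x * G2 j x + f2 x * G1 j x) => [j|c t d h].
  by apply: polyfD; apply: polyfM.
apply: is_derive_eq (is_deriveM (h1 _ _ _ h) (h2 _ _ _ h)) _.
rewrite /= /GRing.scale /= !mulr_sumr -big_split; apply: eq_bigr => j _ /=; ring.
Qed.

Lemma continuous_polyf (S : topologicalType) f (c : S -> T) : polyf f ->
  (forall j, continuous (v j \o c)) -> continuous (f \o c).
Proof.
move=> hf hc; elim: hf => [a|j|f1 f2 _ h1 _ h2|f1 f2 _ h1 _ h2] //.
- by move=> x; apply: cvg_cst.
- by move=> x; apply: cvgD; [exact: h1|exact: h2].
by move=> x; apply: cvgM; [exact: h1|exact: h2].
Qed.

Lemma bounded_polyf f (b : R) : polyf f -> exists2 C, 0 <= C &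
  forall x, (forall j, `|v j x| <= b) -> `|f x| <= C.
Proof.
elim=> [a|j|f1 f2 _ [C1 p1 h1] _ [C2 p2 h2]|f1 f2 _ [C1 p1 h1] _ [C2 p2 h2]].
- by exists `|a|.
- by exists (Num.max b 0) => [|x h]; rewrite le_max ?lexx ?orbT // h.
- exists (C1 + C2) => [|x h]; first exact: addr_ge0.
  by apply: le_trans (ler_normD _ _) _; apply: lerD; [exact: h1|exact: h2].
exists (C1 * C2) => [|x h]; first exact: mulr_ge0.
by rewrite normrM; apply: ler_pM => //; [exact: h1|exact: h2].
Qed.

End Polyf.

Lemma is_deriveP (R : realType) (V : normedModType R) (c : R -> V) (t : R) d :
  is_derive t 1 c d <-> h^-1 *: (c (h + t) - c t) @[h --> 0^'] --> d.
Proof.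
have E : (fun h => h^-1 *: ((c \o shift t) (h *: (1 : R)) - c t)) =
    (fun h => h^-1 *: (c (h + t) - c t)).
  by apply/funext => h; rewrite /= [h *: _]mulr1.
split=> [[h1 h2]|h]; first by rewrite -h2 /derive E; move: h1; rewrite /derivable E.
split; first by rewrite /derivable E; apply/cvg_ex; exists d.
by rewrite /derive E; apply: cvg_lim.
Qed.

Definition pair_crd (R : realType) (T I : Type) (cr : I -> T -> R)
    (k : I + I) (x : T * T) : R :=
  match k with inl i => cr i x.1 | inr i => cr i x.2 end.

(** What the metric estimates use of a simply connected nilpotent group in its exponential chart. By
    [gmul_line], lines through 0 are one-parameter subgroups; by [gmul_poly], the left velocity is
    polynomial in the curve and linear in its derivative. *)
Record polynomial_group (R : realType) (G : group_law R) (I : finType)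
    (cr : I -> G -> R) (ba : I -> G) : Prop := PolynomialGroup {
  cr_linear : forall i a u v, cr i (a *: u + v) = a * cr i u + cr i v;
  cr_continuous : forall i, continuous (cr i);
  cr_ba : forall i j, cr i (ba j) = (i == j)%:R;
  cr_sum : forall x, x = \sum_i cr i x *: ba i;
  gmulA : associative (@gmul R G);
  gmul0 : forall x : G, gmul x 0 = x;
  gone0 : gone G = 0;
  ginvE : forall x : G, ginv x = - x;
  gmul_line : forall a b (x : G), gmul (a *: x) (b *: x) = (a + b) *: x;
  gmul_poly : forall i, polyf (pair_crd cr) (fun x => cr i (gmul x.1 x.2))
}.

Section PolynomialGroup.
Variables (R : realType) (G : group_law R) (I : finType).
Variables (cr : I -> G -> R) (ba : I -> G).
Hypothesis hG : polynomial_group cr ba.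

Lemma crD i x y : cr i (x + y) = cr i x + cr i y.
Proof. by have := cr_linear hG i 1 x y; rewrite scale1r mul1r. Qed.

Lemma cr0 i : cr i 0 = 0.
Proof. by apply: (addIr (cr i 0)); rewrite -crD !add0r. Qed.

Lemma crZ i a x : cr i (a *: x) = a * cr i x.
Proof. by have := cr_linear hG i a x 0; rewrite !addr0 cr0 addr0. Qed.

Lemma crN i x : cr i (- x) = - cr i x.
Proof. by rewrite -scaleN1r crZ mulN1r. Qed.

Lemma cr_sumZ i (f : I -> R) : cr i (\sum_j f j *: ba j) = f i.
Proof.
have -> : cr i (\sum_j f j *: ba j) = \sum_j f j * cr i (ba j).
  by rewrite (big_morph (cr i) (crD i) (cr0 i)); apply: eq_bigr => j _; rewrite crZ.
rewrite (bigD1 i) //= (cr_ba hG) eqxx mulr1 big1 ?addr0 // => j ji.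
by rewrite (cr_ba hG) eq_sym (negPf ji) mulr0.
Qed.

Lemma gmulxN (x : G) : gmul x (- x) = 0.
Proof.
by have := gmul_line hG 1 (-1) x; rewrite scale1r scaleN1r subrr scale0r.
Qed.

Lemma gmulNx (x : G) : gmul (- x) x = 0.
Proof.
by have := gmul_line hG (-1) 1 x; rewrite scale1r scaleN1r addNr scale0r.
Qed.

Lemma gmul0x (x : G) : gmul 0 x = x.
Proof. by rewrite -(gmulxN x) -(gmulA hG) gmulNx (gmul0 hG). Qed.

Lemma gmulKx (x y : G) : gmul (- x) (gmul x y) = y.
Proof. by rewrite (gmulA hG) gmulNx gmul0x. Qed.

Lemma gmulxK (x y : G) : gmul x (gmul (- x) y) = y.
Proof. by rewrite (gmulA hG) gmulxN gmul0x. Qed.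

Lemma oppg_gmul (x y : G) : - gmul x y = gmul (- y) (- x).
Proof.
have e : gmul (gmul x y) (gmul (- y) (- x)) = 0.
  by rewrite -(gmulA hG) gmulxK gmulxN.
by rewrite -[RHS](gmulKx (gmul x y)) e (gmul0 hG).
Qed.

Lemma is_derive_cr (c : R -> G) (t : R) d i :
  is_derive t 1 c d -> is_derive t 1 (cr i \o c) (cr i d).
Proof.
move=> /is_deriveP h; apply/is_deriveP.
have := @continuous_cvg _ _ _ _ _ _ (cr i) _ (@cr_continuous _ _ _ _ _ hG i d) h.
have -> : (fun e => e^-1 *: ((cr i \o c) (e + t) - (cr i \o c) t)) =
    cr i \o (fun e => e^-1 *: (c (e + t) - c t)).
  by apply/funext => e; rewrite /= crZ crD crN.
exact.
Qed.

Lemma is_derive_scale (g : R -> R) (t : R) d (x : G) :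
  is_derive t 1 g d -> is_derive t 1 (fun s => g s *: x) (d *: x).
Proof.
move=> /is_deriveP h; apply/is_deriveP.
have -> : (fun e => e^-1 *: (g (e + t) *: x - g t *: x)) =
    (fun e => (e^-1 *: (g (e + t) - g t)) *: x).
  by apply/funext => e; rewrite -scalerBl scalerA.
exact: cvgZr_tmp.
Qed.

Lemma is_derive_crP (c : R -> G) (t : R) (d : I -> R) :
  (forall i, is_derive t 1 (cr i \o c) (d i)) ->
  is_derive t 1 c (\sum_i d i *: ba i).
Proof.
move=> h; have -> : c = (fun s => \sum_i cr i (c s) *: ba i).
  by apply/funext => s; rewrite -(cr_sum hG).
elim: (index_enum I) => [|i r IH].
  have -> : (fun s => \sum_(i <- [::]) cr i (c s) *: ba i) = cst 0.
    by apply/funext => s; rewrite big_nil.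
  by rewrite big_nil; exact: is_derive_cst.
rewrite big_cons.
have -> : (fun s => \sum_(i <- i :: r) cr i (c s) *: ba i) =
   (fun s => cr i (c s) *: ba i) + (fun s => \sum_(i <- r) cr i (c s) *: ba i).
  by apply/funext => s; rewrite big_cons.
by apply: is_deriveD => //; exact: is_derive_scale.
Qed.

Definition C1_fun (f : R -> R) := exists2 f', continuous f' &
  forall t : R, is_derive t 1 f (f' t).

Lemma continuous_crP (S : topologicalType) (c : S -> G) :
  (forall i, continuous (cr i \o c)) -> continuous c.
Proof.
move=> h; have -> : c = (fun s => \sum_i cr i (c s) *: ba i).
  by apply/funext => s; rewrite -(cr_sum hG).
elim: (index_enum I) => [|i r IH].
  have -> : (fun s => \sum_(i <- [::]) cr i (c s) *: ba i) = cst 0.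
    by apply/funext => s; rewrite big_nil.
  exact: cst_continuous.
have -> : (fun s => \sum_(i <- i :: r) cr i (c s) *: ba i) =
   (fun s => cr i (c s) *: ba i) + (fun s => \sum_(i <- r) cr i (c s) *: ba i).
  by apply/funext => s; rewrite big_cons.
by move=> x; apply: cvgD; [apply: cvgZr_tmp; exact: h|exact: IH].
Qed.

Lemma C1_curveP (c : R -> G) : C1_curve c <-> forall i, C1_fun (cr i \o c).
Proof.
split=> [[h1 h2] i|h].
  exists (cr i \o derive1 c) => [x|t].
    apply: (@continuous_comp _ _ _ (derive1 c) (cr i)); first exact: h2.
    exact: (@cr_continuous _ _ _ _ _ hG i).
  by apply: is_derive_cr; rewrite /= derive1E; exact/derivableP.
have /choice[f' f'P] : forall i, exists g, continuous g /\
    forall t : R, is_derive t 1 (cr i \o c) (g t).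
  by move=> i; case: (h i) => g; exists g.
have D t := is_derive_crP (fun i => (f'P i).2 t).
split=> [t|]; first exact: (@ex_derive _ _ _ _ _ _ _ (D t)).
have -> : derive1 c = (fun t => \sum_i f' i t *: ba i).
  by apply/funext => t; rewrite derive1E; apply: derive_val.
apply: continuous_crP => i; rewrite (_ : _ \o _ = f' i); first exact: (f'P i).1.
by apply/funext => t; rewrite /= cr_sumZ.
Qed.

End PolynomialGroup.

Section Curves.
Variables (R : realType) (G : group_law R) (I : finType).
Variables (cr : I -> G -> R) (ba : I -> G).
Hypothesis hG : polynomial_group cr ba.

Lemma C1_fun_continuous (f : R -> R) : C1_fun f -> continuous f.
Proof.
move=> [f' _ h] t; apply/differentiable_continuous/derivable1_diffP.
exact: (@ex_derive _ _ _ _ _ _ _ (h t)).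
Qed.

Lemma is_derive_affine (a b t : R) : is_derive t 1 (fun s : R => a * s + b) a.
Proof.
rewrite -[a in X in is_derive _ _ _ X]addr0.
have h1 : is_derive t 1 (fun s : R => a * s) a.
  have := @is_deriveZ _ _ _ id a t 1 1 (is_derive_id _ _).
  by rewrite [a *: _]mulr1.
exact: is_deriveD h1 (is_derive_cst _ _ _).
Qed.

Lemma C1_fun_affine (a b : R) : C1_fun (fun s : R => a * s + b).
Proof. by exists (cst a); [exact: cst_continuous|move=> t; exact: is_derive_affine]. Qed.

Lemma C1_fun_polyf (T : Type) (J : finType) (v : J -> T -> R) f (c : R -> T) :
  polyf v f -> (forall j, C1_fun (v j \o c)) -> C1_fun (f \o c).
Proof.
move=> hf hc; have [D pD hD] := is_derive_polyf hf.
have /choice[d dP] : forall j, exists g, continuous g /\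
    forall t : R, is_derive t 1 (v j \o c) (g t).
  by move=> j; case: (hc j) => g; exists g.
exists (fun t => \sum_j D j (c t) * d j t); last by move=> t; apply: hD => j; apply (dP j).2.
elim: (index_enum J) => [|j r IH].
  have -> : (fun t => \sum_(i <- [::]) D i (c t) * d i t) = cst 0.
    by apply/funext => t; rewrite big_nil.
  exact: cst_continuous.
have -> : (fun t => \sum_(i <- j :: r) D i (c t) * d i t) =
    (fun t => D j (c t) * d j t) + (fun t => \sum_(i <- r) D i (c t) * d i t).
  by apply/funext => t; rewrite big_cons.
move=> t; apply: cvgD; last exact: IH.
apply: cvgM; last exact: (dP j).1.
by apply: (continuous_polyf (pD j)) => i; apply: C1_fun_continuous.
Qed.

Lemma C1_cst (x : G) : C1_curve (fun _ : R => x).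
Proof.
apply/(C1_curveP hG) => i; exists (cst 0); first exact: cst_continuous.
by move=> t; exact: is_derive_cst.
Qed.

Lemma C1_gmul (c1 c2 : R -> G) : C1_curve c1 -> C1_curve c2 ->
  C1_curve (fun t => gmul (c1 t) (c2 t)).
Proof.
move=> /(C1_curveP hG) h1 /(C1_curveP hG) h2; apply/(C1_curveP hG) => i.
apply: (@C1_fun_polyf _ _ _ _ (fun t => (c1 t, c2 t)) (gmul_poly hG i)).
by case=> j; [exact: h1|exact: h2].
Qed.

Lemma C1_affine (c : R -> G) a b : C1_curve c -> C1_curve (fun t => c (a * t + b)).
Proof.
move=> /(C1_curveP hG) h; apply/(C1_curveP hG) => i; have [f' cf' df] := h i.
exists (fun t => f' (a * t + b) * a) => [t|t].
  apply: cvgM; last exact: cvg_cst.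
  apply: (@continuous_comp _ _ _ (fun t => a * t + b) f'); last exact: cf'.
  exact: C1_fun_continuous (C1_fun_affine _ _) _.
apply: (@is_derive1_comp _ (cr i \o c) (fun t => a * t + b)).
exact: is_derive_affine.
Qed.

(** The [V i j] are the partial derivatives of the product in its second factor. *)
Lemma left_velocity_formula : exists2 V : I -> I -> G * G -> R,
  (forall i j, polyf (pair_crd cr) (V i j)) &
  forall (c : R -> G) (t : R) (d : I -> R),
    (forall j, is_derive t 1 (cr j \o c) (d j)) ->
    is_derive t 1 (fun s => gmul (ginv (c t)) (c s))
      (\sum_i (\sum_j V i j (- c t, c t) * d j) *: ba i).
Proof.
have /choice[V VP] : forall i, exists D : I -> G * G -> R,
  (forall j, polyf (pair_crd cr) (D j)) /\
  forall (c : R -> G) (t : R) (d : I -> R),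
    (forall j, is_derive t 1 (cr j \o c) (d j)) ->
    is_derive t 1 (cr i \o (fun s => gmul (- c t) (c s)))
      (\sum_j D j (- c t, c t) * d j).
  move=> i; have [D pD hD] := is_derive_polyf (gmul_poly hG i).
  exists (fun j => D (inr j)); split => // c t d hd.
  pose e (k : I + I) : R := if k is inr j then d j else 0.
  have := hD (fun s => (- c t, c s)) t e.
  rewrite big_sumType /= big1 ?add0r => [|j _]; last by rewrite mulr0.
  by apply; case=> j; [exact: (is_derive_cst (cr j (- c t)) t 1)|exact: hd].
exists V => [i|c t d hd]; first exact: (VP i).1.
rewrite (ginvE hG); apply: (is_derive_crP hG) => i; exact: (VP i).2.
Qed.

Lemma left_velocity_gmul (g : G) c : left_velocity (fun t => gmul g (c t)) = left_velocity c.
Proof.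
apply/funext => t; rewrite /left_velocity; congr (derive1 _ t); apply/funext => s.
by rewrite !(ginvE hG) (oppg_gmul hG) -(gmulA hG) (gmulKx hG).
Qed.

Lemma C1_deriv (c : R -> G) : C1_curve c -> exists d : I -> R -> R, forall j,
  continuous (d j) /\ forall t : R, is_derive t 1 (cr j \o c) (d j t).
Proof.
move=> /(C1_curveP hG) hc.
have /choice[d dP] : forall j, exists g, continuous g /\
    forall t : R, is_derive t 1 (cr j \o c) (g t).
  by move=> j; case: (hc j) => g; exists g.
by exists d.
Qed.

Lemma left_velocity_affine (c : R -> G) a b t : C1_curve c ->
  left_velocity (fun s => c (a * s + b)) t = a *: left_velocity c (a * t + b).
Proof.
move=> hc; have [V _ hV] := left_velocity_formula.
have [d dP] := C1_deriv hc; rewrite /left_velocity !derive1E.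
have -> := @derive_val _ _ _ _ _ _ _ (hV _ _ _ (fun j => (dP j).2 (a * t + b))).
have h j : is_derive t 1 (cr j \o (fun s => c (a * s + b))) (d j (a * t + b) * a).
  apply: (@is_derive1_comp _ (cr j \o c) (fun t => a * t + b)); first exact: (dP j).2.
  exact: is_derive_affine.
have -> := @derive_val _ _ _ _ _ _ _ (hV (fun s => c (a * s + b)) _ _ h).
rewrite scaler_sumr; apply: eq_bigr => i _; rewrite scalerA; congr (_ *: _).
by rewrite mulr_sumr; apply: eq_bigr => j _; ring.
Qed.

Lemma continuous_left_velocity (c : R -> G) i : C1_curve c ->
  continuous (fun t => cr i (left_velocity c t)).
Proof.
move=> hc; have [V pV hV] := left_velocity_formula.
have [d dP] := C1_deriv hc.
have -> : (fun t => cr i (left_velocity c t)) =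
    (fun t => \sum_j V i j (- c t, c t) * d j t).
  apply/funext => t; rewrite /left_velocity derive1E.
  have -> := @derive_val _ _ _ _ _ _ _ (hV _ _ _ (fun j => (dP j).2 t)).
  by rewrite (cr_sumZ hG).
have cc k : continuous (pair_crd cr k \o (fun t => (- c t, c t))).
  have cj j : continuous (cr j \o c).
    by apply: C1_fun_continuous; exists (d j); [exact: (dP j).1|exact: (dP j).2].
  case: k => j; last exact: cj.
  have -> : pair_crd cr (inl j) \o (fun t => (- c t, c t)) = - (cr j \o c).
    by apply/funext => t; rewrite /= (crN hG).
  by move=> t; apply: cvgN; exact: cj.
elim: (index_enum I) => [|j r IH].
  have -> : (fun t => \sum_(j <- [::]) V i j (- c t, c t) * d j t) = cst 0.
    by apply/funext => t; rewrite big_nil.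
  exact: cst_continuous.
have -> : (fun t => \sum_(k <- j :: r) V i k (- c t, c t) * d k t) =
    (fun t => V i j (- c t, c t) * d j t) +
    (fun t => \sum_(k <- r) V i k (- c t, c t) * d k t).
  by apply/funext => t; rewrite big_cons.
move=> t; apply: cvgD; last exact: IH.
by apply: cvgM; [exact: (continuous_polyf (pV i j))|exact: (dP j).1].
Qed.

Section Riemannian.
Variable ip : G -> G -> R.
Hypothesis hip : inner_product ip.

Definition speed (c : R -> G) t := Num.sqrt (ip (left_velocity c t) (left_velocity c t)).

Lemma ip_sym u v : ip u v = ip v u. Proof. by case: hip. Qed.

Lemma ipDZl a u v w : ip (a *: u + v) w = a * ip u w + ip v w.
Proof. by case: hip. Qed.

Lemma ip0l w : ip 0 w = 0.
Proof.
have := ipDZl 1 0 0 w; rewrite scaler0 addr0 mul1r => h.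
by apply: (addIr (ip 0 w)); rewrite add0r -h.
Qed.

Lemma ipZl a u w : ip (a *: u) w = a * ip u w.
Proof. by have := ipDZl a u 0 w; rewrite addr0 ip0l addr0. Qed.

Lemma ip_ge0 u : 0 <= ip u u.
Proof.
by have [->|u0] := eqVneq u 0; rewrite ?ip0l // ltW //; case: hip => _ _; apply.
Qed.

Lemma ip_sumZl (f : I -> R) w : ip (\sum_i f i *: ba i) w = \sum_i f i * ip (ba i) w.
Proof.
elim/big_rec2: _ => [|i y x _ <-]; first exact: ip0l.
by rewrite -ipDZl.
Qed.

Lemma ip_cr u v : ip u v = \sum_i \sum_j cr i u * cr j v * ip (ba i) (ba j).
Proof.
rewrite {1}(cr_sum hG u) ip_sumZl; apply: eq_bigr => i _.
rewrite ip_sym {1}(cr_sum hG v) ip_sumZl mulr_sumr; apply: eq_bigr => j _.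
by rewrite mulrA [ip (ba j) _]ip_sym.
Qed.

Lemma continuous_speed c : C1_curve c -> continuous (speed c).
Proof.
move=> hc t; rewrite /speed.
apply: (@continuous_comp _ _ _ (fun s => ip (left_velocity c s) (left_velocity c s))
  (@Num.sqrt R)); last exact: sqrt_continuous.
have -> : (fun s => ip (left_velocity c s) (left_velocity c s)) =
   (fun x => \sum_i \sum_j cr i x * cr j x * ip (ba i) (ba j)) \o left_velocity c.
  by apply/funext => s; rewrite /= -ip_cr.
apply: (@continuous_polyf _ _ _ cr).
  apply: polyf_sum => i; apply: polyf_sum => j.
  by apply: polyfM; [apply: polyfM; apply: polyf_var|apply: polyf_cst].
by move=> i; apply: continuous_left_velocity.
Qed.

Lemma speed_ge0 c t : 0 <= speed c t. Proof. exact: sqrtr_ge0. Qed.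

Lemma speed_affine (c : R -> G) a b t : C1_curve c -> 0 <= a ->
  speed (fun s => c (a * s + b)) t = a * speed c (a * t + b).
Proof.
move=> hc a0; rewrite /speed left_velocity_affine // ipZl ip_sym ipZl mulrA.
by rewrite -expr2 sqrtrM ?sqr_ge0 // sqrtr_sqr ger0_norm.
Qed.

End Riemannian.
End Curves.

(** * Upper bounds for Riemannian distances *)

Section Plateau.
Variable R : realType.
Implicit Types t h : R.

Lemma is_derive_mul_norm t : is_derive t 1 (fun s : R => s * `|s|) (2 * `|t|).
Proof.
have sq (u : R) : is_derive u 1 (fun s : R => s * s) (2 * u).
  apply: is_derive_eq (is_deriveM (is_derive_id u 1) (is_derive_id u 1)) _.
  by rewrite /GRing.scale /= mulr1 -mulr2n mulr_natl.
have [t0|t0|->] := ltgtP t 0.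
- have e : \near t, (fun s : R => - (s * s)) t = t * `|t|.
    near=> s; rewrite ltr0_norm ?mulrN //.
    by near: s; exact: lt_nbhsl.
  apply: (near_eq_is_derive e); rewrite ltr0_norm // mulrN.
  exact: is_deriveN.
- have e : \near t, (fun s : R => s * s) t = t * `|t|.
    near=> s; rewrite gtr0_norm //.
    by near: s; exact: lt_nbhsr.
  by apply: (near_eq_is_derive e); rewrite gtr0_norm.
apply/is_deriveP; rewrite normr0.
apply: (@cvg_trans _ ((fun h : R => `|h|) @ 0^')).
  apply: near_eq_cvg; near=> h; rewrite addr0 mulr0 subr0 /GRing.scale /= mulKf //.
  by near: h; exact: nbhs_dnbhs_neq.
rewrite mulr0; have : `|h| @[h --> (0 : R)] --> `|0 : R|.
  by apply: cvg_norm; exact: cvg_id.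
rewrite normr0; apply: cvg_trans; apply: cvg_app; exact: nbhs_dnbhs.
Unshelve. all: by end_near. Qed.

(** A C^1 step from 0 to 1: the primitive of a tent of height 2 over [[0, 1]]. A path run through
    with this clock stops at both ends, so that it can be joined to others without losing C^1
    regularity. *)
Definition plateau t : R :=
  t * `|t| - 2 * ((t - 2^-1) * `|t - 2^-1|) + (t - 1) * `|t - 1| + 2^-1.

Definition plateau' t : R := 2 * (`|t| - 2 * `|t - 2^-1| + `|t - 1|).

Lemma is_derive_plateau t : is_derive t 1 plateau (plateau' t).
Proof.
have sh (u : R) : is_derive t 1 (fun s : R => (s - u) * `|s - u|) (2 * `|t - u|).
  rewrite -[X in is_derive _ _ _ X]mulr1.
  apply: (@is_derive1_comp _ (fun s : R => s * `|s|) (fun s => s - u)).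
    exact: is_derive_mul_norm.
  by rewrite -[X in is_derive _ _ _ X]subr0; apply: is_deriveB.
have h1 := is_derive_mul_norm t.
have h2 := @is_deriveZ _ _ _ _ 2 _ _ _ (sh 2^-1).
have := is_deriveD (is_deriveD (is_deriveB h1 h2) (sh 1)) (is_derive_cst (2^-1 : R) t (1 : R)).
by move=> h; apply: (is_derive_eq h); rewrite /plateau' /GRing.scale /=; ring.
Qed.

Lemma plateau_le0 t : t <= 0 -> plateau t = 0.
Proof.
move=> h; rewrite /plateau !ler0_norm; [by field|lra..].
Qed.

Lemma plateau_ge1 t : 1 <= t -> plateau t = 1.
Proof.
move=> h; rewrite /plateau !ger0_norm; [by field|lra..].
Qed.

Lemma normr_plateau' t : `|plateau' t| <= 2.
Proof.
rewrite /plateau' ler_norml; apply/andP.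
by case: (ler0P t); case: (ler0P (t - 2^-1)); case: (ler0P (t - 1)); lra.
Qed.

Lemma continuous_plateau' : continuous plateau'.
Proof.
have h (u : R) : continuous (fun s : R => `|s - u|).
  by move=> t; apply: cvg_norm; apply: cvgB; [exact: cvg_id|exact: cvg_cst].
have h0 : continuous (fun s : R => `|s|) by move=> t; apply: cvg_norm; exact: cvg_id.
move=> t; rewrite /plateau'; apply: cvgM; first exact: cvg_cst.
apply: cvgD; last exact: h.
apply: cvgB; first exact: h0.
by apply: cvgM; [exact: cvg_cst|exact: h].
Qed.

End Plateau.

Section RiemannianUpper.
Variables (R : realType) (G : group_law R) (I : finType).
Variables (cr : I -> G -> R) (ba : I -> G).
Hypothesis hG : polynomial_group cr ba.
Variable ip : G -> G -> R.
Hypothesis hip : inner_product ip.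

(** The curve is constant outside [[0, l]]; two such curves are concatenated by the pointwise
    product of the first with the second delayed by [l], which is C^1 at once. *)
Definition unit_path (l : R) (x : G) := 0 <= l /\ exists c : R -> G,
  [/\ C1_curve c, forall t, t <= 0 -> c t = 0, forall t, l <= t -> c t = x &
      forall t, speed ip c t <= 1].

Lemma near_speed (c c' : R -> G) (t : R) : (\near t, c t = c' t) ->
  speed ip c t = speed ip c' t.
Proof.
move=> h; rewrite /speed; suff -> : left_velocity c t = left_velocity c' t by [].
have ht : c t = c' t := nbhs_singleton h.
rewrite /left_velocity ht !derive1E; apply: near_eq_derive.
by near=> s; congr (gmul _ _); near: s.
Unshelve. all: by end_near. Qed.

Lemma unit_path_gmul l x l' x' : unit_path l x -> unit_path l' x' ->
  unit_path (l + l') (gmul x x').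
Proof.
move=> [l0 [c [hc c0 cl sc]]] [l0' [c' [hc' c0' cl' sc']]].
split; first exact: addr_ge0.
pose d t := gmul (c t) (c' (1 * t + (- l))).
have hd : C1_curve d by apply: (C1_gmul hG) => //; apply: (C1_affine hG).
exists d; split => // [t ht|t ht|].
- by rewrite /d c0 // c0' ?(gmul0 hG) //; lra.
- by rewrite /d cl ?cl' //; lra.
have sne t : t != l -> speed ip d t <= 1.
  move=> tl; have [ht|ht|e] := ltgtP t l; last by rewrite e eqxx in tl.
    rewrite (@near_speed d c) //; near=> s; rewrite /d c0' ?(gmul0 hG) //.
    have : s < l by near: s; exact: lt_nbhsl.
    lra.
  rewrite (@near_speed d (fun t => gmul x (c' (1 * t + (- l))))); last first.
    near=> s; rewrite /d cl //; have : l < s by near: s; exact: lt_nbhsr.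
    lra.
  rewrite /speed (left_velocity_gmul hG) -/(speed ip _ t).
  by rewrite (speed_affine hG hip) // mul1r.
(* At the junction no factor need be constant nearby; the bound comes from the continuity of the
   speed. *)
move=> t; have [->|] := eqVneq t l; last exact: sne.
have cs := @continuous_speed _ _ _ _ _ hG _ hip _ hd l.
have cs' : speed ip d @ l^' --> speed ip d l.
  by apply: cvg_trans cs; apply: cvg_app; exact: nbhs_dnbhs.
apply: (cvgr_to_le cs').
by near=> s; apply: sne; near: s; exact: nbhs_dnbhs_neq.
Unshelve. all: by end_near. Qed.

Lemma unit_path_line (x : G) : exists2 C, 0 <= C &
  forall a, unit_path (C * (1 + `|a|)) (a *: x).
Proof.
pose nx : R := Num.sqrt (ip x x).
have nx0 : 0 <= nx by exact: sqrtr_ge0.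
exists (2 * nx + 1) => [|a]; first lra.
(* The factor 2 is the bound on [plateau'], and [1 + |a|] keeps [l] at least 1, so that time can be
   rescaled even when [a = 0]. *)
pose l : R := (2 * nx + 1) * (1 + `|a|).
have l1 : 1 <= l.
  by have a0 := normr_ge0 a; have := mulr_ge0 nx0 a0; rewrite /l; nra.
have l0 : 0 < l by lra.
split; first exact: ltW.
pose c (t : R) : G := (plateau (l^-1 * t + 0) * a) *: x.
have dc (t : R) : is_derive t 1 (fun t => plateau (l^-1 * t + 0) * a) (plateau' (l^-1 * t + 0) * l^-1 * a).
  have h : is_derive t 1 (fun t => plateau (l^-1 * t + 0)) (plateau' (l^-1 * t + 0) * l^-1).
    apply: (@is_derive1_comp _ (@plateau R) (fun t => l^-1 * t + 0)).
      exact: is_derive_plateau.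
    exact: is_derive_affine.
  apply: is_derive_eq (is_deriveM h (is_derive_cst (a : R) t (1 : R))) _.
  by rewrite /GRing.scale /= mulr0 add0r mulrC.
have cd (t : R) : is_derive t 1 c ((plateau' (l^-1 * t + 0) * l^-1 * a) *: x).
  exact: is_derive_scale.
exists c; split => [|t ht|t ht|t].
- split=> [t|]; first exact: (@ex_derive _ _ _ _ _ _ _ (cd t)).
  have -> : derive1 c = (fun t => (plateau' (l^-1 * t + 0) * l^-1 * a) *: x).
    by apply/funext => t; rewrite derive1E; apply: (@derive_val _ _ _ _ _ _ _ (cd t)).
  move=> t; apply: cvgZr_tmp; apply: cvgM; last exact: cvg_cst.
  apply: cvgM; last exact: cvg_cst.
  apply: (@continuous_comp _ _ _ (fun t => l^-1 * t + 0) (@plateau' R)).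
    exact: C1_fun_continuous (C1_fun_affine _ _) _.
  exact: continuous_plateau'.
- rewrite /c plateau_le0 ?mul0r ?scale0r // addr0.
  by rewrite pmulr_rle0 // invr_gt0.
- by rewrite /c plateau_ge1 ?mul1r // addr0 mulrC ler_pdivlMr // mul1r.
have -> : speed ip c t = `|plateau' (l^-1 * t + 0) * l^-1 * a| * nx.
  rewrite /speed; have -> : left_velocity c t = (plateau' (l^-1 * t + 0) * l^-1 * a) *: x.
    rewrite /left_velocity derive1E; apply: derive_val.
    have -> : (fun s => gmul (ginv (c t)) (c s)) =
       (fun s => (plateau (l^-1 * s + 0) * a - plateau (l^-1 * t + 0) * a) *: x).
      by apply/funext => s; rewrite (ginvE hG) /c -scaleNr (gmul_line hG) addrC.
    apply: is_derive_scale; rewrite -[X in is_derive _ _ _ X]subr0.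
    by apply: is_deriveB => //; exact: is_derive_cst.
  rewrite (ipZl hip) (ip_sym hip) (ipZl hip) mulrA -expr2.
  by rewrite sqrtrM ?sqr_ge0 // sqrtr_sqr.
move: (normr_plateau' (l^-1 * t + 0)); move: (plateau' _) => bb hb.
have hl : `|l^-1| = l^-1 by rewrite ger0_norm // invr_ge0 ltW.
rewrite !normrM hl.
have a0 := normr_ge0 a; have an0 := mulr_ge0 a0 nx0.
rewrite (_ : _ * _ = (`|bb| * (`|a| * nx)) / l); last by ring.
rewrite ler_pdivrMr // mul1r.
by have := ler_wpM2r an0 hb; rewrite /l; nra.
Qed.

Lemma curve_length_ge0 c : 0 <= curve_length ip c.
Proof. by apply: Rintegral_ge0 => t _; exact: sqrtr_ge0. Qed.

Lemma unit_path_dist l x : unit_path l x -> forall g, riemannian_dist ip g (gmul g x) <= l.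
Proof.
move=> [l0 [c [hc c0 cl sc]]] g.
pose d t := gmul g (c (l * t + 0)).
have hd : C1_curve d by apply: (C1_gmul hG); [exact: (C1_cst hG)|exact: (C1_affine hG)].
have hs t : speed ip d t <= l.
  rewrite /speed (left_velocity_gmul hG) -/(speed ip _ t) (speed_affine hG hip) //.
  by rewrite ler_piMr.
apply: (@le_trans _ _ (curve_length ip d)).
  apply: ge_inf; first by exists 0 => _ [c' [_ _ _ ->]]; exact: curve_length_ge0.
  exists d; split => //.
    by rewrite /d mulr0 addr0 c0 // (gmul0 hG).
  by rewrite /d mulr1 addr0 cl.
rewrite /curve_length.
have mI : measurable (`[0, 1]%classic : set R) by exact: measurable_itv.
have iI (f : R -> R) : continuous f -> lebesgue_measure.-integrable `[0, 1] (EFin \o f).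
  move=> cf; apply: continuous_compact_integrable; first exact: segment_compact.
  exact: continuous_subspaceT.
apply: (@le_trans _ _ (\int[lebesgue_measure]_(t in `[0, 1]) l)).
  apply: le_Rintegral => //.
  - by apply: iI; exact: (continuous_speed hG hip hd).
  - by apply: iI; exact: cst_continuous.
  by move=> t _; exact: hs.
rewrite Rintegral_cst //= lebesgue_measure_itv /= lte_fin ltr01 -EFinB subr0 /=.
by rewrite mulr1.
Qed.

End RiemannianUpper.

(** * Lower bounds for Riemannian distances *)

Lemma C1_fun_variation (R : realType) (f f' g : R -> R) (t : R) :
  continuous f' -> (forall s : R, is_derive s 1 f (f' s)) -> continuous g ->
  (forall s, 0 <= s <= 1 -> `|f' s| <= g s) -> (forall s, 0 <= g s) -> 0 <= t <= 1 ->
  `|f t - f 0| <= \int[lebesgue_measure]_(s in `[0, 1]) g s.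
Proof.
move=> cf' df cg fg g0 /andP[t0 t1].
have iI (h : R -> R) u : continuous h -> lebesgue_measure.-integrable `[0, u] (EFin \o h).
  move=> ch; apply: continuous_compact_integrable; first exact: segment_compact.
  exact: continuous_subspaceT.
have mI (u : R) : measurable (`[0, u]%classic : set R) by exact: measurable_itv.
move: t0; rewrite le_eqVlt => /predU1P[<-|t0].
  by rewrite subrr normr0; apply: Rintegral_ge0.
have cf : continuous f by apply: C1_fun_continuous; exists f'.
have -> : f t - f 0 = \int[lebesgue_measure]_(s in `[0, t]) f' s.
  rewrite /Rintegral (@continuous_FTC2 _ f' f) //.
  - exact: continuous_subspaceT.
  - split => [s _||].
    + exact: (@ex_derive _ _ _ _ _ _ _ (df s)).
    + by apply: cvg_at_right_filter; exact: cf.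
    by apply: cvg_at_left_filter; exact: cf.
  by move=> s _; rewrite derive1E; apply: derive_val.
apply: (@le_trans _ _ (\int[lebesgue_measure]_(s in `[0, t]) `|f' s|)).
  by apply: le_normr_Rintegral => //; exact: iI.
apply: (@le_trans _ _ (\int[lebesgue_measure]_(s in `[0, t]) g s)).
  apply: le_Rintegral => //; try exact: iI.
    apply: iI => s; apply: cvg_norm; exact: cf'.
  move=> s; rewrite /= in_itv /= => /andP[s0 st]; apply: fg.
  by rewrite s0 (le_trans st).
rewrite /Rintegral; apply: fine_le.
- by apply: integrable_fin_num => //; exact: iI.
- by apply: integrable_fin_num => //; exact: iI.
apply: ge0_subset_integral => //.
- by have /integrableP[] := iI g 1 cg.
- by move=> s _; rewrite lee_fin.
by apply: subset_itvl; rewrite bnd_simp.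
Qed.

Lemma continuous_bigsum (R : realType) (J : Type) (r : seq J) (F : J -> R -> R) :
  (forall j, continuous (F j)) -> continuous (fun t => \sum_(j <- r) F j t).
Proof.
move=> hF; elim: r => [|j r IH].
  rewrite (_ : (fun _ => _) = cst 0); first exact: cst_continuous.
  by apply/funext => s; rewrite big_nil.
rewrite (_ : (fun _ => _) = F j + (fun t => \sum_(j <- r) F j t)).
  by move=> t; apply: cvgD; [exact: hF|exact: IH].
by apply/funext => s; rewrite big_cons.
Qed.

(* A sufficient condition for |f x| to be O((1 + d(0, x))^m), for a Riemannian
   and for a word metric d alike. *)
Inductive growth (R : realType) (G : group_law R) (I : finType)
    (cr : I -> G -> R) : nat -> (G -> R) -> Prop :=
| growth_cst a : growth cr 0 (fun _ => a)
| growthD m f g : growth cr m f -> growth cr m g -> growth cr m (fun x => f x + g x)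
| growthM m n f g : growth cr m f -> growth cr n g ->
    growth cr (m + n) (fun x => f x * g x)
| growth_leq m n f : (m <= n)%N -> growth cr m f -> growth cr n f
| growth_step m k (A psi : 'I_k -> G -> R) f :
    (forall i, growth cr m (A i)) -> (forall i, polyf cr (psi i)) ->
    (forall i, psi i 0 = 0) ->
    (forall g h, f (gmul g h) = f g + \sum_i A i g * psi i h) ->
    growth cr m.+1 f.

Section RiemannianLower.
Variables (R : realType) (G : group_law R) (I : finType).
Variables (cr : I -> G -> R) (ba : I -> G).
Hypothesis hG : polynomial_group cr ba.
Variable ip : G -> G -> R.
Hypothesis hip : inner_product ip.

Lemma growth_ext m (f g : G -> R) : growth cr m f -> f =1 g -> growth cr m g.
Proof. by move=> hf /funext <-. Qed.

Lemma ip_comb a b u v : ip (a *: v + b *: u) (a *: v + b *: u) =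
  a ^+ 2 * ip v v + 2 * (a * b) * ip u v + b ^+ 2 * ip u u.
Proof.
have e w : ip w (a *: v + b *: u) = a * ip v w + b * ip u w.
  by rewrite (ip_sym hip) (ipDZl hip) (ipZl hip).
by rewrite (ipDZl hip) (ipZl hip) !e (ip_sym hip v u); ring.
Qed.

Lemma ip_cauchy_schwarz u v : ip u v ^+ 2 <= ip u u * ip v v.
Proof.
have [->|u0] := eqVneq u 0; first by rewrite !(ip0l hip) expr2 !mul0r.
have uu : 0 < ip u u by case: hip => _ _; apply.
have := ip_ge0 hip (ip u u *: v + (- ip u v) *: u); rewrite ip_comb.
set a := ip u u in uu *; set b := ip u v; set c := ip v v => h.
have : 0 <= a * (a * c - b ^+ 2).
  by apply: (le_trans h); rewrite le_eqVlt; apply/orP; left; apply/eqP; ring.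
by rewrite pmulr_rge0 // subr_ge0.
Qed.

(** Riesz representation: the Gram matrix of the basis is invertible because [ip] is definite. *)
Lemma ip_represents j : exists r, forall v, ip r v = cr j v.
Proof.
pose n := #|I|; pose b (i : 'I_n) := ba (enum_val i).
pose A : 'M[R]_n := \matrix_(i, k) ip (b i) (b k).
pose vec (x : 'rV[R]_n) : G := \sum_i x 0 i *: b i.
have ip_vecl (x : 'rV[R]_n) w : ip (vec x) w = \sum_i x 0 i * ip (b i) w.
  rewrite /vec; elim/big_rec2: _ => [|i y z _ <-]; first exact: ip0l.
  by rewrite (ipDZl hip).
have sumE (V : nmodType) (F : I -> V) : \sum_i F i = \sum_(i < n) F (enum_val i).
  by apply: reindex; exact/onW_bij/enum_val_bij.
have vecK (x : 'rV[R]_n) : vec x = 0 -> x = 0.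
  move=> h; apply/rowP => k; rewrite mxE.
  have <- : cr (enum_val k) (vec x) = x 0 k; last by rewrite h (cr0 hG).
  have -> : vec x = \sum_i x 0 (enum_rank i) *: ba i.
    by rewrite sumE; apply: eq_bigr => i _; rewrite enum_valK.
  by rewrite (cr_sumZ hG) enum_valK.
have ipA (x y : 'rV[R]_n) : ip (vec x) (vec y) = \sum_k (x *m A) 0 k * y 0 k.
  rewrite ip_vecl; transitivity (\sum_i \sum_k x 0 i * A i k * y 0 k).
    apply: eq_bigr => i _; rewrite (ip_sym hip) ip_vecl mulr_sumr.
    by apply: eq_bigr => k _; rewrite mxE (ip_sym hip (b k)); ring.
  rewrite exchange_big; apply: eq_bigr => k _.
  by rewrite mxE mulr_suml.
have uA : A \in unitmx.
  rewrite -row_free_unit -kermx_eq0; apply/eqP/row_matrixP => i; rewrite row0.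
  apply: vecK; apply/eqP; apply: contraT => v0.
  have : 0 < ip (vec (row i (kermx A))) (vec (row i (kermx A))).
    by case: hip => _ _; apply.
  rewrite ipA -row_mul mulmx_ker big1 ?ltxx // => k _.
  by rewrite !mxE mul0r.
exists (vec (delta_mx 0 (enum_rank j) *m invmx A)) => v.
have {1}-> : v = vec (\row_i cr (enum_val i) v).
  rewrite {1}(cr_sum hG v) sumE /vec; apply: eq_bigr => i _.
  by rewrite mxE.
rewrite ipA mulmxKV // (bigD1 (enum_rank j)) //= !mxE !eqxx mul1r enum_rankK.
by rewrite big1 ?addr0 // => k /negPf kj; rewrite !mxE kj andbF mul0r.
Qed.

Lemma cr_le_ip : exists2 B, 0 <= B & forall j v, `|cr j v| <= B * Num.sqrt (ip v v).
Proof.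
have /choice[r hr] := ip_represents.
exists (\sum_j Num.sqrt (ip (r j) (r j))) => [|j v].
  by apply: sumr_ge0 => j _; exact: sqrtr_ge0.
apply: (@le_trans _ _ (Num.sqrt (ip (r j) (r j)) * Num.sqrt (ip v v))).
  rewrite -sqrtrM ?(ip_ge0 hip) // -hr -sqrtr_sqr; apply: ler_wsqrtr.
  exact: ip_cauchy_schwarz.
apply: ler_wpM2r; first exact: sqrtr_ge0.
rewrite (bigD1 j) //= lerDl; apply: sumr_ge0 => k _; exact: sqrtr_ge0.
Qed.

Lemma curve_lengthE c : curve_length ip c = \int[lebesgue_measure]_(s in `[0, 1]) speed ip c s.
Proof. by []. Qed.

(** For [growth_step], [f (c s) = f (c t) + sum_i A_i (c t) psi_i (c(t)^-1 c(s))], so the derivative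
    of [f] along [c] at time t is a combination of the coordinates of the left velocity with
    coefficients [O(A_i (c t))]. These coordinates are at most a constant times the speed, and
    integrating gains one power of the length. Continuity along curves is part of the induction,
    since it makes the derivative integrable. *)
Lemma growth_curve m f : growth cr m f ->
  (forall c, C1_curve c -> continuous (f \o c)) /\
  exists2 C, 0 <= C & forall c, C1_curve c -> c 0 = 0 -> forall t, 0 <= t <= 1 ->
    `|f (c t)| <= C * (1 + curve_length ip c) ^+ m.
Proof.
have L0 c := curve_length_ge0 ip c.
elim=> [a|{}m {}f g _ [cf [C C0 hC]] _ [cg [D D0 hD]]|{}m n {}f g _ [cf [C C0 hC]] _ [cg [D D0 hD]]|
  {}m n {}f mn _ [cf [C C0 hC]]|{}m k A psi {}f _ hA hpsi psi0 hf].
- split=> [c _|]; first exact: cst_continuous.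
  by exists `|a| => // c _ _ t _; rewrite expr0 mulr1.
- split=> [c hc x|]; first by apply: cvgD; [exact: cf|exact: cg].
  exists (C + D) => [|c hc c0 t ht]; first exact: addr_ge0.
  by rewrite mulrDl; apply: le_trans (ler_normD _ _) _; apply: lerD; [exact: hC|exact: hD].
- split=> [c hc x|]; first by apply: cvgM; [exact: cf|exact: cg].
  exists (C * D) => [|c hc c0 t ht]; first exact: mulr_ge0.
  by rewrite normrM exprD mulrACA; apply: ler_pM => //; [exact: hC|exact: hD].
- split => //; exists C => // c hc c0 t ht; apply: (le_trans (hC c hc c0 t ht)).
  apply: ler_wpM2l => //; apply: ler_weXn2l => //.
  by rewrite lerDl.
have /choice[D DP] : forall i, exists D : I -> R, forall (w : R -> G) (t : R) (v : G),
    w t = 0 -> is_derive t 1 w v ->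
    is_derive t 1 (psi i \o w) (\sum_j D j * cr j v).
  move=> i; have [E _ hE] := is_derive_polyf (hpsi i).
  exists (fun j => E j 0) => w t v w0 dw; rewrite -w0.
  by apply: hE => j; apply: (is_derive_cr hG).
pose f' c t := \sum_i A i (c t) * \sum_j D i j * cr j (left_velocity c t).
have df c : C1_curve c -> forall t : R, is_derive t 1 (f \o c) (f' c t).
  move=> hc t; pose w s := gmul (- c t) (c s).
  have wt : w t = 0 by rewrite /w (gmulNx hG).
  have dw : is_derive t 1 w (left_velocity c t).
    have [V _ hV] := left_velocity_formula hG; have [d dP] := C1_deriv hG hc.
    have := hV c t (d ^~ t) (fun j => (dP j).2 t); rewrite (ginvE hG) -/w => h.
    have <- // : \sum_i (\sum_j V i j (- c t, c t) * d j t) *: ba i = left_velocity c t.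
    by rewrite /left_velocity derive1E (ginvE hG); apply/esym/(@derive_val _ _ _ _ _ _ _ h).
  have -> : f \o c = (fun s => f (c t) + \sum_i A i (c t) * psi i (w s)).
    by apply/funext => s; rewrite -hf /w (gmulxK hG).
  suff h2 : is_derive t 1 (fun s => \sum_i A i (c t) * psi i (w s)) (f' c t).
    by have := is_deriveD (is_derive_cst (f (c t)) t (1 : R)) h2; rewrite add0r.
  rewrite /f'; elim: (index_enum _) => [|i r IH].
    rewrite big_nil (_ : (fun _ => _) = cst 0); first exact: is_derive_cst.
    by apply/funext => s; rewrite big_nil.
  rewrite big_cons (_ : (fun _ => _) = (A i (c t) \*: (psi i \o w)) +
      (fun s => \sum_(i <- r) A i (c t) * psi i (w s))).
    by apply: is_deriveD => //; apply: is_deriveZ; exact: DP.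
  by apply/funext => s; rewrite big_cons.
have cf c : C1_curve c -> continuous (f \o c).
  move=> hc t; apply/differentiable_continuous/derivable1_diffP.
  exact: (@ex_derive _ _ _ _ _ _ _ (df c hc t)).
split=> //.
have cf' c : C1_curve c -> continuous (f' c).
  move=> hc; rewrite /f'.
  apply: continuous_bigsum => i t; apply: cvgM; first exact: (hA i).1.
  move: t; rewrite -/(continuous _).
  apply: continuous_bigsum => j t; apply: cvgM; first exact: cvg_cst.
  exact: (continuous_left_velocity hG).
have [B B0 hB] := cr_le_ip.
have /choice[C CP] : forall i, exists C, 0 <= C /\ forall c, C1_curve c -> c 0 = 0 ->
    forall t, 0 <= t <= 1 -> `|A i (c t)| <= C * (1 + curve_length ip c) ^+ m.
  by move=> i; case: (hA i) => _ [C C0 hC]; exists C.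
pose K := \sum_i C i * \sum_j `|D i j| * B.
have C0 i : 0 <= C i := (CP i).1.
have K0 : 0 <= K.
  apply: sumr_ge0 => i _; apply: mulr_ge0 => //; apply: sumr_ge0 => j _.
  exact: mulr_ge0.
exists (`|f 0| + K) => [|c hc c0 t ht]; first exact: addr_ge0.
set L := curve_length ip c; have Lge0 : 0 <= L by exact: L0.
have L1 : 1 <= 1 + L by rewrite lerDl.
have Lm0 n : 0 <= (1 + L) ^+ n by apply: exprn_ge0; lra.
have key : `|f (c t) - f (c 0)| <=
    \int[lebesgue_measure]_(s in `[0, 1]) (K * (1 + L) ^+ m * speed ip c s).
  apply: (@C1_fun_variation _ (f \o c) (f' c)) => //.
  - exact: cf'.
  - exact: df.
  - by move=> s; apply: cvgM; [exact: cvg_cst|exact: (continuous_speed hG hip hc)].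
  - move=> s hs; apply: le_trans (ler_norm_sum _ _ _) _.
    rewrite /K !mulr_suml; apply: ler_sum => i _; rewrite normrM.
    rewrite [X in _ <= X](_ : _ = (C i * (1 + L) ^+ m) * ((\sum_j `|D i j| * B) * speed ip c s)); last by ring.
    apply: ler_pM => //; first exact: (CP i).2.
    apply: le_trans (ler_norm_sum _ _ _) _.
    rewrite mulr_suml; apply: ler_sum => j _; rewrite normrM -mulrA.
    by apply: ler_wpM2l => //; exact: hB.
  by move=> s; rewrite mulr_ge0 ?speed_ge0 // mulr_ge0.
move: key; rewrite RintegralZl; last 2 first.
- exact: measurable_itv.
- apply: continuous_compact_integrable; first exact: segment_compact.
  by apply: continuous_subspaceT; exact: (continuous_speed hG hip hc).
rewrite -curve_lengthE -/L c0 => key.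
have h1 : `|f (c t)| <= `|f 0| + K * (1 + L) ^+ m * L.
  rewrite -lerBlDl; apply: le_trans key.
  by rewrite lerBlDl -{1}(subrK (f 0) (f (c t))) addrC ler_normD.
apply: (le_trans h1); rewrite mulrDl; apply: lerD.
  by rewrite ler_peMr // exprn_ege1.
rewrite exprSr mulrA; apply: ler_wpM2l; first exact: mulr_ge0.
by rewrite lerDr.
Qed.

Lemma riemannian_dist_ge0 x y : 0 <= riemannian_dist ip x y.
Proof.
rewrite /riemannian_dist; set S := [set l | _].
have [->|/set0P h] := eqVneq S set0; first by rewrite inf0.
apply: lb_le_inf => // l [c [_ _ _ ->]]; exact: curve_length_ge0.
Qed.

Lemma riemannian_dist_curve g h e : 0 < e -> exists c, [/\ C1_curve c, c 0 = 0,
  c 1 = h & curve_length ip c < riemannian_dist ip g (gmul g h) + e].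
Proof.
move=> e0; set S := [set l | exists c : R -> G,
    [/\ C1_curve c, c 0 = g, c 1 = gmul g h & l = curve_length ip c]].
have hS : has_inf S.
  split; last by exists 0 => _ [c' [_ _ _ ->]]; exact: curve_length_ge0.
  have [C C0 hC] := unit_path_line hG hip h.
  have [_ [c [hc c0 cl _]]] := hC 1; rewrite scale1r in cl.
  set l := C * _ in cl.
  exists (curve_length ip (fun t => gmul g (c (l * t + 0)))).
  exists (fun t => gmul g (c (l * t + 0))); split => //.
  - by apply: (C1_gmul hG); [exact: (C1_cst hG)|exact: (C1_affine hG)].
  - by rewrite mulr0 addr0 c0 // (gmul0 hG).
  by rewrite mulr1 addr0 cl.
have [l [c [hc c0 c1 ->]] hl] := inf_adherent e0 hS.
have e1 : curve_length ip (fun t => gmul (- g) (c t)) = curve_length ip c.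
  by rewrite /curve_length (left_velocity_gmul hG).
exists (fun t => gmul (- g) (c t)); split.
- by apply: (C1_gmul hG); [exact: (C1_cst hG)|exact: hc].
- by rewrite c0 (gmulNx hG).
- by rewrite c1 (gmulKx hG).
by rewrite e1 /riemannian_dist -/S.
Qed.

Lemma growth_riemannian m f : growth cr m f ->
  exists2 C, 0 <= C & forall g h, `|f h| <= C * (1 + riemannian_dist ip g (gmul g h)) ^+ m.
Proof.
move=> /growth_curve[_ [C C0 hC]]; exists (C * 2 ^+ m) => [|g h].
  by rewrite mulr_ge0 // exprn_ge0.
have [c [hc c0 c1 hl]] := riemannian_dist_curve g h ltr01.
rewrite -c1 -mulrA -exprMn; apply: le_trans (hC c hc c0 1 _) _; first by rewrite ler01 lexx.
apply: ler_wpM2l => //; apply: lerXn2r; rewrite ?nnegrE.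
- by rewrite addr_ge0 // curve_length_ge0.
- by rewrite mulr_ge0 // addr_ge0 // riemannian_dist_ge0.
rewrite c1; have := riemannian_dist_ge0 g (gmul g h); lra.
Qed.

End RiemannianLower.

(** * Word metrics *)

Section WordMetric.
Variables (R : realType) (G : group_law R) (I : finType).
Variables (cr : I -> G -> R) (ba : I -> G).
Hypothesis hG : polynomial_group cr ba.
Variable S : set G.
Hypotheses (cS : compact S) (gS : generating S).

Definition word_reach (n : nat) (x : G) :=
  exists s, [/\ is_word S s, word_value s = x & (size s <= n)%N].

Lemma word_value_cat (s t : seq G) :
  word_value (s ++ t) = gmul (word_value s) (word_value t).
Proof.
elim: s => [|x s IH] /=; first by rewrite (gone0 hG) (gmul0x hG).
by rewrite IH (gmulA hG).
Qed.

Lemma word_reach_gmul n m x y : word_reach n x -> word_reach m y ->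
  word_reach (n + m) (gmul x y).
Proof.
move=> [s [hs <- ns]] [t [ht <- mt]]; exists (s ++ t); split.
- by move=> z; rewrite mem_cat => /orP[]; [exact: hs|exact: ht].
- exact: word_value_cat.
by rewrite size_cat leq_add.
Qed.

Lemma word_reachN n x : word_reach n x -> word_reach n (- x).
Proof.
move=> [s [hs <- ns]]; exists (rev (map (@ginv R G) s)); split.
- move=> z; rewrite mem_rev => /mapP[y /hs[Sy|[u Su ->]] ->]; first by right; exists y.
  by left; rewrite !(ginvE hG) opprK.
- elim: s {hs ns} => [|y s IH] /=; first by rewrite (gone0 hG) oppr0.
  rewrite rev_cons -cats1 word_value_cat IH /= (gone0 hG) (gmul0 hG) (ginvE hG).
  by rewrite (oppg_gmul hG).
by rewrite size_rev size_map.
Qed.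

Lemma compact_word_reach n : compact [set x | word_reach n x].
Proof.
(* With 0 among the letters, words of length at most [n] become products of exactly [n] letters. *)
pose S1 := S `|` (-%R @` S) `|` [set (0 : G)].
have cN : continuous (-%R : G -> G) by move=> x; apply: cvgN; exact: cvg_id.
have cS1 : compact S1.
  apply: compactU; last exact: compact_set1.
  apply: compactU => //; apply: continuous_compact => //.
  exact: continuous_subspaceT.
have S1P z : S1 z <-> z = 0 \/ S z \/ exists2 y, S y & z = ginv y.
  split=> [[[Sz|[y Sy <-]]|->]|[->|[Sz|[y Sy ->]]]].
  - by right; left.
  - by right; right; exists y; rewrite ?(ginvE hG).
  - by left.
  - by right.
  - by left; left.
  by left; right; exists y; rewrite ?(ginvE hG).
elim: n => [|n IH].
  rewrite (_ : [set x | _] = [set (0 : G)]); first exact: compact_set1.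
  apply/seteqP; split=> [x [s [_ <-]]|x ->].
    by rewrite leqn0 => /nilP ->; rewrite /= (gone0 hG).
  by exists [::]; split => //=; rewrite (gone0 hG).
rewrite (_ : [set x | _] = (fun u : G * G => gmul u.1 u.2) @` (S1 `*` [set x | word_reach n x])).
  apply: continuous_compact; last exact: compact_setX.
  apply: continuous_subspaceT; apply: (continuous_crP hG) => i.
  have := @continuous_polyf _ _ _ _ _ _ id (gmul_poly hG i); apply.
  case=> j x /=; apply: (@continuous_cvg _ _ _ _ _ _ (cr j)).
  - exact: (@cr_continuous _ _ _ _ _ hG j).
  - exact: cvg_fst.
  - exact: (@cr_continuous _ _ _ _ _ hG j).
  - exact: cvg_snd.
apply/seteqP; split=> [x [s [hs <-]]|_ [[u v] [/S1P Su [t [ht <- nt]]] <-]].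
  case: s hs => [|z s] hs sn.
    exists (0, 0); last by rewrite /= (gmul0 hG) (gone0 hG).
    split; first by apply/S1P; left.
    by exists [::]; split => //=; rewrite (gone0 hG).
  exists (z, word_value s) => //; split.
    by apply/S1P; right; apply: hs; rewrite mem_head.
  by exists s; split => // y hy; apply: hs; rewrite in_cons hy orbT.
rewrite /= in Su nt *; case: Su => [->|Su].
  by rewrite (gmul0x hG); exists t; split => //; exact: leqW.
by exists (u :: t); split => // z; rewrite in_cons => /orP[/eqP ->|/ht].
Qed.

Lemma word_reach_exists x : exists n, word_reach n x.
Proof. by have [s hs <-] := gS x; exists (size s), s. Qed.

(* Some set {b | b *: x is a word of length at most n} has nonempty interior, by
   Baire; subtracting, it is a neighbourhood of 0. *)
Lemma word_reach_segment (x : G) : exists n (e : R), 0 < e /\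
  forall h, `|h| < e -> word_reach n (h *: x).
Proof.
pose A n := [set b : R | word_reach n (b *: x)].
have cA n : closed (A n).
  apply: (@closed_comp _ _ (fun b : R => b *: x) [set y | word_reach n y]).
    by move=> b _; apply: cvgZr_tmp; exact: cvg_id.
  by apply: compact_closed; [exact: norm_hausdorff|exact: compact_word_reach].
have [n hn] : exists n, ~ dense (~` A n).
  apply: contrapT => /forallNP h.
  have : dense (\bigcap_n (~` A n)).
    apply: (@Baire R R) => n; split; first exact/closed_openC/cA.
    exact: contrapT (h n).
  rewrite -setC_bigcup (_ : \bigcup_n _ = setT) ?setCT; first exact: dense0.
  apply/seteqP; split=> // b _; have [n hn] := word_reach_exists (b *: x).
  by exists n.
have [U [[b Ub] UA]] := denseNE hn.
have UA' : U `<=` A n.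
  move=> y Uy; apply: contrapT => nA; have : (U `&` ~` A n) y by [].
  by rewrite UA.
have /nbhs_ballP[e e0 be] : nbhs b U by exact: open_nbhs_nbhs.
exists (n + n)%N, e; split => // h he.
have -> : h *: x = gmul ((b + h) *: x) (- (b *: x)).
  by rewrite -scaleNr (gmul_line hG); congr (_ *: _); ring.
apply: word_reach_gmul.
  by apply/UA'/be; rewrite -ball_normE /= opprD addrA subrr sub0r normrN.
by apply/word_reachN/UA'/be; exact: ballxx.
Qed.

Lemma word_reach_line (x : G) : exists2 C, 0 <= C &
  forall a, exists2 n, n%:R <= C * (1 + `|a|) & word_reach n (a *: x).
Proof.
have [n [e [e0 he]]] := word_reach_segment x.
exists (n%:R * (1 + e^-1)) => [|a]; first by rewrite mulr_ge0 // addr_ge0 // invr_ge0 ltW.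
pose m := (Num.truncn (`|a| / e)).+1.
have ae0 : 0 <= `|a| / e by rewrite divr_ge0 // ltW.
exists (n * m)%N.
  rewrite natrM -mulrA; apply: ler_wpM2l => //.
  apply: (@le_trans _ _ (1 + `|a| / e)).
    by rewrite /m -natr1 addrC lerD2l truncn_le.
  rewrite mulrDl mul1r mulrDr mulr1 -addrA lerD2l mulrC.
  have := normr_ge0 a; have : 0 <= e^-1 by rewrite invr_ge0 ltW.
  lra.
have hm : word_reach n ((a / m%:R) *: x).
  apply: he; rewrite normrM normfV (ger0_norm (ler0n _ _)).
  rewrite ltr_pdivrMr ?ltr0n // mulrC -ltr_pdivrMr //.
  by apply: truncnS_gt.
have it k : word_reach (n * k) ((k%:R * (a / m%:R)) *: x).
  elim: k => [|k IH].
    by rewrite mul0r scale0r; exists [::]; split => //=; rewrite (gone0 hG).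
  by rewrite -natr1 mulrDl mul1r -(gmul_line hG) mulnS addnC; exact: word_reach_gmul.
by have := it m; rewrite mulrC divfK // pnatr_eq0.
Qed.

Lemma word_dist_ge0 x y : 0 <= word_dist S x y.
Proof.
rewrite /word_dist; set T := [set l | _].
have [->|/set0P h] := eqVneq T set0; first by rewrite inf0.
by apply: lb_le_inf => // l [s _ [_ ->]].
Qed.

Lemma word_reach_dist n x g : word_reach n x -> word_dist S g (gmul g x) <= n%:R.
Proof.
move=> [s [hs vs sn]]; apply: (@le_trans _ _ (size s)%:R); last by rewrite ler_nat.
apply: ge_inf; first by exists 0 => _ [t _ [_ ->]].
by exists s => //; split => //; rewrite (ginvE hG) (gmulKx hG).
Qed.

(** The discrete analogue of [growth_curve]: one more letter z changes [f] by [sum_i A_i psi_i z],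
    where the [psi_i] are bounded on the compact set of letters. *)
Lemma growth_word_value m f : growth cr m f -> exists2 C, 0 <= C &
  forall s, is_word S s -> `|f (word_value s)| <= C * (1 + (size s)%:R) ^+ m.
Proof.
have [b hb] : exists b, forall j x, S x \/ (exists2 y, S y & x = ginv y) -> `|cr j x| <= b.
  have /choice[b hb] : forall j, exists b, forall x, S x -> `|cr j x| <= b.
    move=> j; have : compact (cr j @` S).
      apply: continuous_compact => //; apply: continuous_subspaceT.
      exact: (@cr_continuous _ _ _ _ _ hG j).
    move=> /compact_bounded[M [_ hM]]; exists (M + 1) => x Sx.
    by apply: hM; [rewrite ltrDl|exists x].
  exists (\sum_j `|b j|) => j x hx.
  apply: (@le_trans _ _ (b j)).
    case: hx => [/hb //|[y Sy ->]]; rewrite (ginvE hG) (crN hG) normrN; exact: hb.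
  apply: (le_trans (ler_norm _)); rewrite (bigD1 j) //= lerDl.
  exact: sumr_ge0.
elim=> [a|{}m {}f g _ [C C0 hC] _ [D D0 hD]|{}m n {}f g _ [C C0 hC] _ [D D0 hD]|
  {}m n {}f mn _ [C C0 hC]|{}m k A psi {}f _ hA hpsi psi0 hf].
- by exists `|a| => // s _; rewrite expr0 mulr1.
- exists (C + D) => [|s hs]; first exact: addr_ge0.
  by rewrite mulrDl; apply: le_trans (ler_normD _ _) _; apply: lerD; [exact: hC|exact: hD].
- exists (C * D) => [|s hs]; first exact: mulr_ge0.
  by rewrite normrM exprD mulrACA; apply: ler_pM => //; [exact: hC|exact: hD].
- exists C => // s hs; apply: (le_trans (hC s hs)).
  by apply: ler_wpM2l => //; apply: ler_weXn2l => //; rewrite lerDl.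
have /choice[C CP] : forall i, exists C, 0 <= C /\ forall s, is_word S s ->
    `|A i (word_value s)| <= C * (1 + (size s)%:R) ^+ m.
  by move=> i; case: (hA i) => C C0 hC; exists C.
have /choice[D DP] : forall i, exists D, 0 <= D /\
    forall x, (forall j, `|cr j x| <= b) -> `|psi i x| <= D.
  by move=> i; case: (bounded_polyf b (hpsi i)) => D D0 hD; exists D.
pose K := \sum_i C i * D i.
have K0 : 0 <= K by apply: sumr_ge0 => i _; rewrite mulr_ge0 ?(CP i).1 ?(DP i).1.
exists (`|f 0| + K) => [|s hs]; first exact: addr_ge0.
have p1 (n : nat) : 1 <= 1 + n%:R :> R by rewrite lerDl.
have pm (n : nat) k' : 0 <= (1 + n%:R : R) ^+ k' by rewrite exprn_ge0 // addr_ge0.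
have key : `|f (word_value s)| <= `|f 0| + (size s)%:R * (K * (1 + (size s)%:R) ^+ m).
  elim/last_ind: s hs => [|s z IH] hs.
    by rewrite /= (gone0 hG) mul0r addr0.
  have hs' : is_word S s by move=> y hy; apply: hs; rewrite mem_rcons in_cons hy orbT.
  have hz : forall j, `|cr j z| <= b.
    by move=> j; apply: hb; apply: hs; rewrite mem_rcons mem_head.
  rewrite -cats1 word_value_cat /= (gone0 hG) (gmul0 hG) hf.
  apply: le_trans (ler_normD _ _) _; rewrite size_cat addn1 -natr1.
  set n := size s in IH *.
  have e1 : `|f (word_value s)| <= `|f 0| + n%:R * (K * (1 + (n%:R + 1)) ^+ m).
    apply: (le_trans (IH hs')); rewrite lerD2l; apply: ler_wpM2l => //.
    apply: ler_wpM2l => //; apply: lerXn2r; rewrite ?nnegrE ?addr_ge0 //.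
    by rewrite lerD2l lerDl.
  have e2 : `|\sum_i A i (word_value s) * psi i z| <= K * (1 + (n%:R + 1)) ^+ m.
    apply: le_trans (ler_norm_sum _ _ _) _; rewrite /K mulr_suml; apply: ler_sum => i _.
    rewrite normrM mulrAC; apply: ler_pM => //; last exact: (DP i).2.
    apply: (le_trans ((CP i).2 s hs')); apply: ler_wpM2l; first exact: (CP i).1.
    by apply: lerXn2r; rewrite ?nnegrE ?addr_ge0 // lerD2l lerDl.
  rewrite mulrDl mul1r addrA; exact: lerD.
apply: (le_trans key); rewrite mulrDl; apply: lerD.
  by rewrite ler_peMr // exprn_ege1.
rewrite exprS [leRHS]mulrCA; apply: ler_wpM2r; first exact: mulr_ge0.
by rewrite lerDr.
Qed.

Lemma growth_word m f : growth cr m f ->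
  exists2 C, 0 <= C & forall g h, `|f h| <= C * (1 + word_dist S g (gmul g h)) ^+ m.
Proof.
move=> /growth_word_value[C C0 hC]; exists (C * 2 ^+ m) => [|g h].
  by rewrite mulr_ge0 // exprn_ge0.
rewrite /word_dist; set T := [set l | _].
have hT : has_inf T.
  split; last by exists 0 => _ [t _ [_ ->]].
  have [s hs vs] := gS h; exists (size s)%:R; exists s => //; split => //.
  by rewrite (ginvE hG) (gmulKx hG).
have [_ [s hs [vs ->]] hl] := inf_adherent ltr01 hT.
rewrite (ginvE hG) (gmulKx hG) in vs.
rewrite -vs -mulrA -exprMn; apply: (le_trans (hC s hs)).
have i0 : 0 <= inf T by apply: lb_le_inf; [case: hT|move=> l [t _ [_ ->]]].
apply: ler_wpM2l => //; apply: lerXn2r; rewrite ?nnegrE.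
- by rewrite addr_ge0.
- by rewrite mulr_ge0 // addr_ge0.
lra.
Qed.

End WordMetric.

Section CoarseMetric.
Variables (R : realType) (G : group_law R) (I : finType).
Variables (cr : I -> G -> R) (ba : I -> G).

(* [reach l x]: some path from 0 to x has length at most l. *)
Record coarse_metric (d : G -> G -> R) : Prop := CoarseMetric {
  dist_ge0 : forall x y, 0 <= d x y;
  dist_reach : exists reach : R -> G -> Prop, [/\
    forall l l' x y, reach l x -> reach l' y -> reach (l + l') (gmul x y),
    forall x, exists2 C, 0 <= C & forall a, reach (C * (1 + `|a|)) (a *: x) &
    forall l x, reach l x -> forall g, d g (gmul g x) <= l];
  dist_growth : forall m f, growth cr m f -> exists2 C, 0 <= C &
    forall g h, `|f h| <= C * (1 + d g (gmul g h)) ^+ m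
}.

Lemma left_invariant_coarse d : polynomial_group cr ba ->
  left_invariant_metric d -> coarse_metric d.
Proof.
move=> hG [[ip hip ->]|[S [cS gS] ->]]; split.
- exact: riemannian_dist_ge0.
- exists (unit_path ip); split; first by move=> l l' x y; apply: (unit_path_gmul hG hip).
    exact: (unit_path_line hG hip).
  exact: (unit_path_dist hG hip).
- exact: (growth_riemannian hG hip).
- exact: word_dist_ge0.
- exists (fun l x => exists2 n, n%:R <= l & word_reach S n x); split.
  + move=> l l' x y [n nl hx] [m ml hy]; exists (n + m)%N.
      by rewrite natrD lerD.
    exact: (word_reach_gmul hG).
  + exact: (word_reach_line hG cS gS).
  by move=> l x [n nl hx] g; apply: le_trans nl; exact: (word_reach_dist hG).
exact: (growth_word hG cS gS).
Qed.

End CoarseMetric.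

Local Close Scope classical_set_scope.

Lemma polyf_comp (R : realType) (S T : Type) (J K : finType) (w : K -> S -> R)
    (v : J -> T -> R) (h : T -> S) f :
  polyf w f -> (forall k, polyf v (fun x => w k (h x))) -> polyf v (fun x => f (h x)).
Proof.
move=> hf hw; elim: hf => [a|k|f1 f2 _ h1 _ h2|f1 f2 _ h1 _ h2].
- exact: polyf_cst.
- exact: hw.
- exact: polyfD.
exact: polyfM.
Qed.

(** * The groups L_p x L_q and G_(p,q) up to bounded multiplicative error *)

Definition line_map (R : realType) (V : lmodType R) (x : V) (u : 'rV[R]_1) : V :=
  crd u 1 *: x.

Lemma line_map_is_linear (R : realType) (V : lmodType R) (x : V) : linear (line_map x).
Proof. by move=> a u v; rewrite /line_map crd_linear scalerDl scalerA. Qed.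
HB.instance Definition _ (R : realType) (V : lmodType R) (x : V) :=
  GRing.isLinear.Build R 'rV[R]_1 V *:%R (line_map x) (line_map_is_linear x).

(* A line is the image of the abelian algebra l_1, where the law is [hmul]. *)
Lemma dynkin_bch_line (R : realType) (V : lmodType R) (br : V -> V -> V) N a b x :
  (0 < N)%N -> (forall s t, br (s *: x) (t *: x) = 0) ->
  dynkin_bch N br (a *: x) (b *: x) = (a + b) *: x.
Proof.
move=> N0 hbr; have lE c : line_map x (c *: xb R 1 1) = c *: x.
  by rewrite /line_map crdZ crd_xb mulr1.
rewrite -!lE -(@dynkin_morph _ _ _ _ (@filiform_br R 1) br); last first.
  by move=> u v; rewrite /= /line_map hbr crd_filiform_br scale0r.
congr (line_map x _); apply: (can_inj (@hexpK R 1)).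
rewrite hexp_dynkin //; apply: crd_eqP => [|k hk]; last by exfalso; lia.
by rewrite crd_hmul1 !crd_hexp1 !crdZ -mulrDl.
Qed.

Section LieGroup.
Variables (R : realType) (g : nilpotent_lie R) (I : finType).
Variables (cr : I -> g -> R) (ba : I -> g).
Hypotheses (cr_lin : forall i a u v, cr i (a *: u + v) = a * cr i u + cr i v)
  (cr_cont : forall i, continuous (cr i))
  (cr_dual : forall i j, cr i (ba j) = (i == j)%:R)
  (cr_gen : forall x, x = \sum_i cr i x *: ba i)
  (br_poly : forall i, polyf (pair_crd cr) (fun x => cr i (lie_br x.1 x.2)))
  (bchA : associative (@bch R g)) (step_gt0 : (0 < lie_step g)%N).

Lemma lie_br_line (x : g) s t : lie_br (s *: x) (t *: x) = 0.
Proof.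
have br0l (u : g) : lie_br 0 u = 0.
  by have := lie_br_linearl (-1) u u u; rewrite scaleN1r addNr scaleN1r addNr.
have br0r (u : g) : lie_br u 0 = 0.
  by have := lie_br_linearr (-1) u u u; rewrite scaleN1r addNr scaleN1r addNr.
by rewrite -[s *: x]addr0 lie_br_linearl -[t *: x]addr0 lie_br_linearr lie_brxx
  !br0l br0r !(scaler0, addr0).
Qed.

Lemma bch_line a b (x : g) : bch (a *: x) (b *: x) = (a + b) *: x.
Proof. by rewrite bchE dynkin_bch_line // => s t; exact: lie_br_line. Qed.

Lemma polyf_nested (w : seq bool) i : polyf (pair_crd cr)
  (fun x => cr i (nested_bracket (@lie_br R g) [seq if c then x.1 else x.2 | c <- w])).
Proof.
have cr0 j : cr j 0 = 0.
  by apply: (addIr (cr j 0)); rewrite add0r -{1}[cr j 0]mul1r -cr_lin scale1r add0r.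
elim: w i => [|c [|c' w] IH] i.
- by apply: (polyf_ext (polyf_cst _ 0)) => x /=; rewrite cr0.
- by case: c; [exact: (@polyf_var _ _ _ (pair_crd cr) (inl i))|exact: (@polyf_var _ _ _ (pair_crd cr) (inr i))].
pose h (x : g * g) := (if c then x.1 else x.2,
  nested_bracket (@lie_br R g) [seq if c then x.1 else x.2 | c <- c' :: w]).
apply: (@polyf_comp _ _ _ _ _ (pair_crd cr) (pair_crd cr) h _ (br_poly i)) => -[] j /=.
  by case: c @h; [exact: (@polyf_var _ _ _ (pair_crd cr) (inl j))|exact: (@polyf_var _ _ _ (pair_crd cr) (inr j))].
exact: IH.
Qed.

Lemma polynomial_lie_group : polynomial_group (G := simply_connected_group g) cr ba.
Proof.
have bch0 (x : g) : bch x 0 = x.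
  by have := bch_line 1 0 x; rewrite scale1r scale0r addr0 scale1r.
split=> //; first exact: bch_line.
move=> i; have cr0 : cr i 0 = 0.
  by apply: (addIr (cr i 0)); rewrite add0r -{1}[cr i 0]mul1r -cr_lin scale1r add0r.
have crD u v : cr i (u + v) = cr i u + cr i v.
  by have := cr_lin i 1 u v; rewrite scale1r mul1r.
have crZ a u : cr i (a *: u) = a * cr i u.
  by have := cr_lin i a u 0; rewrite addr0 cr0 addr0.
pose F (x : g * g) : R := cr i (dynkin_bch (lie_step g) (@lie_br R g) x.1 x.2).
suff : polyf (pair_crd cr) F by move=> h; apply: (polyf_ext h) => x; rewrite /F /= bchE.
have crS (A : Type) (r : seq A) P (f : A -> g) :
    cr i (\sum_(k <- r | P k) f k) = \sum_(k <- r | P k) cr i (f k).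
  by apply: (big_morph _ crD cr0).
pose H (w : seq bool) (x : g * g) : R :=
  (size w)%:R^-1 * cr i (nested_bracket (@lie_br R g) [seq if c then x.1 else x.2 | c <- w]).
have hF : F =1 fun x => \sum_(n < lie_step g) ((-1) ^+ n / n.+1%:R) *
    block_sum (M := R^o) (lie_step g) n.+1 (fun w => H w x).
  move=> x; rewrite /F /dynkin_bch crS; apply: eq_bigr => n _; rewrite crZ; congr (_ * _).
  rewrite /block_sum crS; apply: eq_bigr => k _; rewrite crZ; congr (_ * _).
  exact: crZ.
apply: (polyf_ext _ (fsym hF)); apply: polyf_sum => n; apply: polyfZ.
rewrite /block_sum /=.
under eq_fun do rewrite big_mkcond /=.
apply: polyf_sum => k; case: [forall i1, _]; last exact: polyf_cst.
by apply: polyfZ; apply: polyfZ; exact: polyf_nested.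
Qed.

End LieGroup.

Lemma prod_polynomial_group (R : realType) (G H : group_law R) (I J : finType)
    (cG : I -> G -> R) bG (cH : J -> H -> R) bH :
  polynomial_group cG bG -> polynomial_group cH bH ->
  polynomial_group (G := prod_group G H)
    (fun k x => match k with inl i => cG i x.1 | inr j => cH j x.2 end)
    (fun k => match k with inl i => (bG i, 0) | inr j => (0, bH j) end).
Proof.
move=> hG hH; split.
- by move=> [i|j] a [u u'] [v v'] /=; [exact: (cr_linear hG)|exact: (cr_linear hH)].
- move=> [i|j] x /=; [apply: (@continuous_comp _ _ _ fst (cG i))|apply: (@continuous_comp _ _ _ snd (cH j))].
  + exact: cvg_fst.
  + exact: (@cr_continuous _ _ _ _ _ hG i).
  + exact: cvg_snd.
  + exact: (@cr_continuous _ _ _ _ _ hH j).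
- move=> [i|j] [i'|j'] /=; rewrite ?(cr_ba hG) ?(cr_ba hH) ?(cr0 hG) ?(cr0 hH) //.
- move=> [x y]; rewrite big_sumType /=.
  have e1 : \sum_i cG i x *: ((bG i, 0) : G * H) = (x, 0).
    rewrite [in RHS](cr_sum hG x).
    elim: index_enum => [|i r IH]; rewrite ?big_nil // !big_cons IH.
    by congr (_, _); rewrite /= scaler0 addr0.
  have e2 : \sum_i cH i y *: ((0, bH i) : G * H) = (0, y).
    rewrite [in RHS](cr_sum hH y).
    elim: index_enum => [|i r IH]; rewrite ?big_nil // !big_cons IH.
    by congr (_, _); rewrite /= scaler0 addr0.
  by rewrite e1 e2; congr (_, _); rewrite /= ?addr0 ?add0r.
- by move=> [a a'] [b b'] [c c']; congr (_, _); [exact: (gmulA hG)|exact: (gmulA hH)].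
- by move=> [a b]; congr (_, _); [exact: (gmul0 hG)|exact: (gmul0 hH)].
- by congr (_, _); [exact: (gone0 hG)|exact: (gone0 hH)].
- by move=> [a b]; congr (_, _); [exact: (ginvE hG)|exact: (ginvE hH)].
- by move=> a b [x y]; congr (_, _); [exact: (gmul_line hG)|exact: (gmul_line hH)].
move=> [i|j] /=.
  apply: (@polyf_comp _ _ _ _ _ (pair_crd cG) _ (fun x : (G * H) * (G * H) => (x.1.1, x.2.1))
    _ (gmul_poly hG i)) => -[] k.
  - exact: (@polyf_var _ _ _ (pair_crd _) (inl (inl k))).
  exact: (@polyf_var _ _ _ (pair_crd _) (inr (inl k))).
apply: (@polyf_comp _ _ _ _ _ (pair_crd cH) _ (fun x : (G * H) * (G * H) => (x.1.2, x.2.2))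
  _ (gmul_poly hH j)) => -[] k.
- exact: (@polyf_var _ _ _ (pair_crd _) (inl (inr k))).
exact: (@polyf_var _ _ _ (pair_crd _) (inr (inr k))).
Qed.

Section CoordinateFunctions.
Variables (R : realType) (n : nat).

Lemma continuous_crd k : continuous (fun u : 'rV[R]_n => crd u k).
Proof.
have [hk|hk] := boolP (0 < k <= n)%N; last first.
  by rewrite (_ : (fun u => crd u k) = cst 0) ?funeqE => [|u]; [exact: cst_continuous|rewrite crd_out //; lia].
case: k hk => // k hk.
rewrite (_ : (fun u => crd u k.+1) = (fun u => u ord0 (Ordinal hk))) ?funeqE => [|u].
  exact: coord_continuous.
by rewrite (crdE _ (Ordinal hk)).
Qed.

Lemma polyf_crd (T : Type) (J : finType) (v : J -> T -> R) (F : T -> 'rV[R]_n) :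
  (forall i : 'I_n, polyf v (fun x => crd (F x) i.+1)) ->
  forall k, polyf v (fun x => crd (F x) k).
Proof.
move=> h k; have [hk|hk] := boolP (0 < k <= n)%N; last first.
  by apply: (polyf_ext (polyf_cst v 0)) => x; rewrite crd_out //; lia.
by case: k hk => // k hk; exact: (h (Ordinal hk)).
Qed.

Lemma polyf_hexp (T : Type) (J : finType) (v : J -> T -> R) (F : T -> 'rV[R]_n) :
  (forall k, polyf v (fun x => crd (F x) k)) ->
  forall k, polyf v (fun x => crd (hexp (F x)) k).
Proof.
move=> h k; have [hk|hk] := boolP (2 <= k <= n)%N; last first.
  have [->|k1] := eqVneq k 1%N; first by apply: (polyf_ext (h 1%N)) => x; rewrite crd_hexp1.
  by apply: (polyf_ext (polyf_cst v 0)) => x; rewrite crd_out //; lia.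
apply: (@polyf_ext _ _ _ _ (fun x =>
  \sum_(j < k.-1) crd (F x) 1 ^+ j * (j.+1`!%:R)^-1 * crd (F x) (k - j))).
  apply: polyf_sum => j; apply: polyfM => //; apply: polyfM; first exact: polyfX.
  exact: polyf_cst.
by move=> x; rewrite crd_hexp.
Qed.

Lemma polyf_filiform_br (T : Type) (J : finType) (v : J -> T -> R) (F G : T -> 'rV[R]_n) :
  (forall k, polyf v (fun x => crd (F x) k)) -> (forall k, polyf v (fun x => crd (G x) k)) ->
  forall k, polyf v (fun x => crd (filiform_br (F x) (G x)) k).
Proof.
move=> hF hG k; apply: (@polyf_ext _ _ _ _ (fun x => if (3 <= k <= n)%N then
   crd (F x) 1 * crd (G x) k.-1 + (-1) * (crd (F x) k.-1 * crd (G x) 1) else 0)).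
  case: (2 < k <= n)%N; last exact: polyf_cst.
  apply: polyfD; first exact: polyfM.
  by apply: polyfZ; exact: polyfM.
by move=> x; rewrite crd_filiform_br mulN1r.
Qed.

End CoordinateFunctions.

Section FiliformGroup.
Variables (R : realType) (p : nat).
Hypothesis p0 : (0 < p)%N.

Lemma hlog_bch (u v : 'rV[R]_p) :
  hlog (hmul u v) = gmul (g := filiform_group R p) (hlog u) (hlog v).
Proof. by rewrite /= bchE (@hlog_hmul _ _ p). Qed.

Lemma filiform_polynomial : polynomial_group (G := filiform_group R p)
  (fun (i : 'I_p) u => crd u i.+1) (fun i => xb R p i.+1).
Proof.
apply: polynomial_lie_group => //.
- by move=> i a u v; rewrite crd_linear.
- by move=> i; exact: continuous_crd.
- move=> i j; rewrite crd_xb eqSS ltn_ord andbT eq_sym.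
  by congr (_ %:R); case: (i =P j) => [->|h]; rewrite ?eqxx //; case: eqP => // /val_inj.
- move=> x; apply: crdP => k; rewrite crd_sum.
  have [hk|hk] := boolP (0 < k <= p)%N; last by rewrite crd_out ?big1 // => [i _|]; rewrite ?crd_out //; lia.
  case: k hk => // k hk; rewrite (bigD1 (Ordinal hk)) //= big1 => [|i hi].
    by rewrite crdZ crd_xb eqxx hk mulr1 addr0.
  rewrite crdZ crd_xb eqSS; case: eqP => [e|_]; last by rewrite mulr0.
  by move: hi; rewrite -val_eqE /= e eqxx.
- move=> i; apply: polyf_filiform_br => k; apply: polyf_crd => j.
    exact: (@polyf_var _ _ _ (pair_crd _) (inl j)).
  exact: (@polyf_var _ _ _ (pair_crd _) (inr j)).
(* Associativity of [bch] is that of [hmul], transported by [hlog]. *)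
have E (u v : 'rV[R]_p) : @bch R (filiform R p) (hlog u) (hlog v) = hlog (hmul u v).
  by rewrite hlog_bch.
by move=> x y z; rewrite -(hexpK x) -(hexpK y) -(hexpK z) !E hmulA.
Qed.

End FiliformGroup.

Lemma hexpDz (R : realType) p (u : 'rV[R]_p) c : (2 <= p)%N ->
  hexp (u + hz p c) = hexp u + hz p c.
Proof.
move=> p2; apply: crd_eqP => [|k hk]; first by rewrite crdD !crd_hexp1 crdD.
rewrite crdD !crd_hexp // crdD hz_tail // addr0.
under eq_bigr do rewrite crdD mulrDr.
rewrite big_split /=; congr (_ + _); case: k hk => [|[|k]] // hk /=.
rewrite big_ord_recl big1 ?addr0 => [|j _]; last first.
  by rewrite hz_tail ?mulr0 //; have := ltn_ord j; rewrite /= /bump /=; lia.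
by rewrite subn0 expr0 mul1r (_ : ((ord0 : 'I_k.+1).+1`!%:R : R) = 1) // invr1 mul1r.
Qed.

Lemma hlogDz (R : realType) p (u : 'rV[R]_p) c : (2 <= p)%N ->
  hlog (u + hz p c) = hlog u + hz p c.
Proof. by move=> p2; rewrite -[RHS]hexpK hexpDz // hlogK. Qed.

Section CentralProductGroup.
Variables (R : realType) (p q : nat).
Hypotheses (q2 : (2 <= q)%N) (qp : (q <= p)%N).
Let p2 : (2 <= p)%N := leq_trans q2 qp.
Local Notation G := (central_product_group R p q).

Definition pmul m n (P Q : 'rV[R]_m * 'rV[R]_n) := (hmul P.1 Q.1, hmul P.2 Q.2).

Definition to_central (P : 'rV[R]_p * 'rV[R]_q) : G :=
  @central_proj R p q (hlog P.1, hlog P.2).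

Definition of_central (w : G) : 'rV[R]_p * 'rV[R]_q :=
  (hexp (@central_sec R p q w).1, hexp (@central_sec R p q w).2).

Lemma dynkin_prod N (u v : prod_lie (filiform R p) (filiform R q)) : (p <= N)%N ->
  dynkin_bch N (@prod_br R (filiform R p) (filiform R q)) u v =
  (hlog (hmul (hexp u.1) (hexp v.1)), hlog (hmul (hexp u.2) (hexp v.2))).
Proof.
move=> pN; rewrite (@hlog_hmul _ _ N) //; [|lia..]; rewrite (@hlog_hmul _ _ N) //; [|lia..].
rewrite !hexpK; apply: injective_projections => /=.
  exact: (@dynkin_morph _ _ _ _ (@prod_br R (filiform R p) (filiform R q))
    (@filiform_br R p) (fst : {linear _ -> _})).
exact: (@dynkin_morph _ _ _ _ (@prod_br R (filiform R p) (filiform R q))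
  (@filiform_br R q) (snd : {linear _ -> _})).
Qed.

Lemma central_bch (u v : prod_lie (filiform R p) (filiform R q)) :
  gmul (g := G) (central_proj u) (central_proj v) =
  central_proj (hlog (hmul (hexp u.1) (hexp v.1)), hlog (hmul (hexp u.2) (hexp v.2))).
Proof.
rewrite -(@dynkin_prod (maxn p q)) ?leq_maxl // /= bchE.
rewrite (@dynkin_morph _ _ _ _ (@prod_br R (filiform R p) (filiform R q))
  (@lie_br R (central_product R p q)) (@central_proj R p q : {linear _ -> _})) // => x y.
exact: (@central_quotient_morph R (prod_lie (filiform R p) (filiform R q)) _
  (@central_proj R p q : {linear _ -> _}) _ (@central_secK R p q) (@central_proj_ker_central R p q)).
Qed.

Lemma to_centralM P Q : to_central (pmul P Q) = gmul (to_central P) (to_central Q).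
Proof. by rewrite central_bch /= !hlogK. Qed.

Lemma of_centralK w : to_central (of_central w) = w.
Proof. by rewrite /to_central [X in (X, _)]hexpK [X in (_, X)]hexpK; exact: central_secK. Qed.

Definition central_crd (k : 'I_p + 'I_q.-1) (w : G) : R :=
  match k with inl i => crd w.1 i.+1 | inr i => crd w.2 i.+1 end.

Definition central_basis (k : 'I_p + 'I_q.-1) : G :=
  match k with inl i => (xb R p i.+1, 0) | inr i => (0, xb R q.-1 i.+1) end.

Lemma polyf_central_sec (T : Type) (J : finType) (v : J -> T -> R) (F : T -> G) :
  (forall i, polyf v (fun x => central_crd i (F x))) -> forall k,
  polyf v (fun x => crd (@central_sec R p q (F x)).1 k) /\
  polyf v (fun x => crd (@central_sec R p q (F x)).2 k).
Proof.
move=> h k; split; first by apply: polyf_crd => i; exact: (h (inl i)).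
apply: (@polyf_ext _ _ _ _ (fun x => if (0 < k <= q)%N then crd (F x).2 k else 0)).
  case: (0 < k <= q)%N; last exact: polyf_cst.
  by apply: polyf_crd => i; exact: (h (inr i)).
by move=> x; rewrite crd_row.
Qed.

Lemma central_polynomial : polynomial_group (G := G) central_crd central_basis.
Proof.
have hp := @filiform_polynomial R p (ltnW p2).
have hq : polynomial_group (G := filiform_group R q.-1) _ _ := @filiform_polynomial R q.-1 (_ : 0 < q.-1)%N.
have {}hq := hq ltac:(lia).
apply: polynomial_lie_group; last by rewrite /= leq_max (ltnW p2).
- by move=> [i|i] a [u u'] [v v']; rewrite /= crd_linear.
- move=> [i|i] x; [apply: (@continuous_comp _ _ _ fst (fun u => crd u i.+1))|
    apply: (@continuous_comp _ _ _ snd (fun u => crd u i.+1))].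
  + exact: cvg_fst.
  + exact: continuous_crd.
  + exact: cvg_snd.
  + exact: continuous_crd.
- move=> [i|i] [j|j]; rewrite /= ?crd0 //; first exact: (cr_ba hp).
  exact: (cr_ba hq).
- exact: (cr_sum (prod_polynomial_group hp hq)).
- have vl (i : 'I_p + 'I_q.-1) : polyf (pair_crd central_crd) (fun x => central_crd i x.1).
    exact: (@polyf_var _ _ _ (pair_crd central_crd) (inl i)).
  have vr (i : 'I_p + 'I_q.-1) : polyf (pair_crd central_crd) (fun x => central_crd i x.2).
    exact: (@polyf_var _ _ _ (pair_crd central_crd) (inr i)).
  have sl := polyf_central_sec vl; have sr := polyf_central_sec vr.
  have b1 := polyf_filiform_br (fun k => (sl k).1) (fun k => (sr k).1).
  have b2 := polyf_filiform_br (fun k => (sl k).2) (fun k => (sr k).2).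
  move=> [i|i] /=.
    have b := polyfD (b1 i.+1) (polyfM (b2 q) (polyf_cst _ (crd (xb R p p) i.+1))).
    by apply: (polyf_ext b) => x /=; rewrite crdD crdZ.
  by apply: (polyf_ext (b2 i.+1)) => x /=; rewrite crd_row ltn_ord.
move=> x y z; rewrite -(of_centralK x) -(of_centralK y) -(of_centralK z).
have E P Q : @bch R (central_product R p q) (to_central P) (to_central Q) = to_central (pmul P Q) by rewrite to_centralM.
by rewrite !E /pmul /= !hmulA.
Qed.

End CentralProductGroup.

Definition pball (R : realType) m n (t : R) (P : 'rV[R]_m * 'rV[R]_n) :=
  hball t P.1 /\ hball t P.2.

(** A comparison of [d] with homogeneous balls at scales at least 1. Since [j] may have a kernel,
    the lower estimate provides one preimage in the ball instead of bounding all of them. *)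
Record homogeneous_model (R : realType) m n (G : group_law R) (d : G -> G -> R)
    (j : 'rV[R]_m * 'rV[R]_n -> G) : Prop := HomogeneousModel {
  model_hom : forall P Q, j (pmul P Q) = gmul (j P) (j Q);
  model_upper : exists2 C, 0 <= C & forall t P g, 1 <= t -> pball t P ->
    d g (gmul g (j P)) <= C * t;
  model_lower : exists2 C, 1 <= C & forall t g h, 1 <= t -> d g (gmul g h) <= t ->
    exists2 P, pball (C * t) P & j P = h
}.

Section Upper.
Variables (R : realType) (G : group_law R) (I : finType).
Variables (cr : I -> G -> R) (ba : I -> G) (d : G -> G -> R).
Hypotheses (hG : polynomial_group cr ba).
Variable reach : R -> G -> Prop.
Hypothesis reachM : forall l l' x y, reach l x -> reach l' y -> reach (l + l') (gmul x y).
Hypothesis reach_line : forall x, exists2 C, 0 <= C & forall a, reach (C * (1 + `|a|)) (a *: x).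

(** The number of letters is fixed and each one, dilated by [t], costs [O(1 + t)], which is [O(t)]
    as [t >= 1]. The constant [C0] pays for the empty word. *)
Lemma reach_hball m (i : 'rV[R]_m -> G) : (2 <= m)%N ->
  (forall u v, i (hmul u v) = gmul (i u) (i v)) ->
  (forall b a, i (hor m (b, a)) = a *: i (hor m (b, 1))) ->
  exists2 C, 0 <= C & forall t u, 1 <= t -> hball t u -> exists2 l, l <= C * t & reach l (i u).
Proof.
move=> m2 iM il; have [n [A [A0 hA]]] := @horizontal_words R m m2.
have i0 : i 0 = 0.
  have := iM 0 0; rewrite hmul0x => e.
  by rewrite -[LHS](gmulKx hG (i 0)) -e (gmulNx hG).
have [C0 C00 h0] := reach_line 0.
have [C1 C10 h1] := reach_line (i (hor m (true, 1))).
have [C2 C20 h2] := reach_line (i (hor m (false, 1))).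
pose C := C1 + C2.
have hl b a : exists2 l, l <= C * (1 + `|a|) & reach l (i (hor m (b, a))).
  rewrite il; case: b.
    exists (C1 * (1 + `|a|)) => //; apply: ler_wpM2r; first exact: addr_ge0.
    by rewrite /C lerDl.
  exists (C2 * (1 + `|a|)) => //; apply: ler_wpM2r; first exact: addr_ge0.
  by rewrite /C lerDr.
have C'0 : 0 <= C by exact: addr_ge0.
exists (C0 + n%:R * (C * (1 + A))) => [|t u t1 hu].
  by rewrite addr_ge0 // mulr_ge0 // mulr_ge0 // addr_ge0.
have t0 : 0 < t by lra.
have [v /hA[s [sn sA <-]] ->] := hball_undil t0 hu.
rewrite hdil_word.
have key s' : (forall x, x \in s' -> `|x.2| <= A) ->
   exists2 l, l <= C0 + (size s')%:R * (C * (1 + A)) * t & reach l (i (hword m [seq (x.1, t * x.2) | x <- s'])).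
  elim: s' => [|[b a] s' IH] hs.
    exists (C0 * (1 + `|0 : R|)); first by rewrite normr0 addr0 mulr1 !mul0r addr0.
    by have := h0 0; rewrite scaler0 /= i0.
  have [|l hl' rl] := IH; first by move=> x hx; apply: hs; rewrite in_cons hx orbT.
  have [l1 hl1 rl1] := hl b (t * a).
  exists (l1 + l); last by rewrite /= iM; exact: reachM.
  apply: (le_trans (lerD hl1 hl')); rewrite /= -natr1.
  have ha : `|a| <= A by apply: (hs (b, a)); rewrite mem_head.
  have : C * (1 + `|t * a|) <= C * (1 + A) * t.
    rewrite -mulrA; apply: ler_wpM2l => //; rewrite normrM (ger0_norm (ltW t0)).
    have : t * `|a| <= t * A by apply: ler_wpM2l => //; exact: ltW.
    lra.
  have -> : C0 + ((size s')%:R + 1) * (C * (1 + A)) * t =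
    C * (1 + A) * t + (C0 + (size s')%:R * (C * (1 + A)) * t) by ring.
  by move=> e; rewrite lerD2r.
have [l hl' rl] := key s sA; exists l => //; apply: (le_trans hl').
rewrite [leRHS]mulrDl; apply: lerD; first by rewrite ler_peMr.
apply: ler_wpM2r; first exact: ltW.
apply: ler_wpM2r; last by rewrite ler_nat.
by rewrite mulr_ge0 // addr_ge0.
Qed.

Lemma reach_pball m n (j : 'rV[R]_m * 'rV[R]_n -> G) : (2 <= m)%N -> (2 <= n)%N ->
  (forall P Q, j (pmul P Q) = gmul (j P) (j Q)) ->
  (forall b a, j (hor m (b, a), 0) = a *: j (hor m (b, 1), 0)) ->
  (forall b a, j (0, hor n (b, a)) = a *: j (0, hor n (b, 1))) ->
  exists2 C, 0 <= C & forall t P, 1 <= t -> pball t P -> exists2 l, l <= C * t & reach l (j P).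
Proof.
move=> m2 n2 jM jl jr.
have [|C C0 hC] := reach_hball (i := fun u => j (u, 0)) m2 _ jl.
  by move=> u v; rewrite -jM /pmul /= hmul0x.
have [|D D0 hD] := reach_hball (i := fun u => j (0, u)) n2 _ jr.
  by move=> u v; rewrite -jM /pmul /= hmul0x.
exists (C + D) => [|t P t1 [h1 h2]]; first exact: addr_ge0.
have [l hl rl] := hC t P.1 t1 h1; have [l' hl' rl'] := hD t P.2 t1 h2.
exists (l + l'); first by rewrite mulrDl lerD.
have -> : P = pmul (P.1, 0) (0, P.2) by rewrite /pmul /= hmulx0 hmul0x; case: P {h1 h2 hl rl hl' rl'}.
by rewrite jM; exact: reachM.
Qed.

End Upper.

Section Lower.
Variables (R : realType) (G : group_law R) (I : finType) (cr : I -> G -> R).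

(** The formula of [hmul] for coordinate [k] is an instance of [growth_step] with [A_j = u_1^j / j!]
    and [j <= k - 2], whence the degree [k - 1]. The bound [K] admits maps that are multiplicative
    only below the centre, such as the two components of [of_central]. *)
Lemma growth_hmul m K (e : G -> 'rV[R]_m) : (K <= m)%N -> e 0 = 0 ->
  (forall k, polyf cr (fun x => crd (e x) k)) ->
  (forall g h k, (k <= K)%N -> crd (e (gmul g h)) k = crd (hmul (e g) (e h)) k) ->
  forall k, (k <= K)%N -> growth cr (hwt k) (fun x => crd (e x) k).
Proof.
move=> Km e0 ep eM.
have g1 : (1 <= K)%N -> growth cr 1 (fun x => crd (e x) 1).
  move=> K1; apply: (@growth_step _ _ _ _ _ 1 (fun _ _ => 1) (fun _ x => crd (e x) 1)) => //.
  - by move=> i; exact: growth_cst.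
  - by move=> i; rewrite e0 crd0.
  by move=> g h; rewrite eM // crd_hmul1 big_ord1 mul1r.
have gX j : (1 <= K)%N -> growth cr j (fun x => crd (e x) 1 ^+ j).
  move=> K1; elim: j => [|j IH].
    by apply: (growth_ext (growth_cst _ 1)) => x; rewrite expr0.
  by apply: (growth_ext (growthM (g1 K1) IH)) => x; rewrite exprS.
move=> k kK; have [hk|hk] := boolP (2 <= k)%N; last first.
  case: k kK hk => [|[|k]] // kK _; last exact: g1.
  apply: (@growth_leq _ _ _ _ 0) => //.
  by apply: (growth_ext (growth_cst _ 0)) => x; rewrite crd_out.
have -> : hwt k = k.-2.+1 by rewrite /hwt; lia.
apply: (@growth_step _ _ _ _ _ k.-1 (fun j x => crd (e x) 1 ^+ j * (j`!%:R)^-1)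
  (fun j x => crd (e x) (k - j))).
- move=> j; apply: (@growth_leq _ _ _ _ (j + 0)); first by have := ltn_ord j; lia.
  by apply: growthM; [apply: gX; lia|exact: growth_cst].
- by move=> j; exact: ep.
- by move=> j; rewrite e0 crd0.
by move=> g h; rewrite eM // crd_hmul //; lia.
Qed.

Variable d : G -> G -> R.
Hypothesis hd : coarse_metric cr d.

Lemma growth_dist k (f : G -> R) : (0 < k)%N -> growth cr k f -> exists2 C, 1 <= C &
  forall t g h, 1 <= t -> d g (gmul g h) <= t -> `|f h| <= (C * t) ^+ k.
Proof.
move=> k0 /(dist_growth hd)[C C0 hC]; exists (2 * (1 + C)) => [|t g h t1 ht]; first lra.
apply: (le_trans (hC g h)); apply: (@le_trans _ _ (C * (2 * t) ^+ k)).
  apply: ler_wpM2l => //; apply: lerXn2r; rewrite ?nnegrE.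
  - by rewrite addr_ge0 // (dist_ge0 hd).
  - by rewrite mulr_ge0 //; lra.
  lra.
have -> : 2 * (1 + C) * t = (1 + C) * (2 * t) by ring.
rewrite [leRHS]exprMn; apply: ler_wpM2r; first by rewrite exprn_ge0 // mulr_ge0 //; lra.
case: k k0 {hC} => // k _; rewrite exprS.
have : 1 <= (1 + C) ^+ k by rewrite exprn_ege1 // lerDl.
nra.
Qed.

Lemma growth_hball m (e : G -> 'rV[R]_m) :
  (forall k, growth cr (hwt k) (fun x => crd (e x) k)) -> exists2 C, 1 <= C &
  forall t g h, 1 <= t -> d g (gmul g h) <= t -> hball (C * t) (e h).
Proof.
move=> he; have /choice[C CP] : forall k, exists C, 1 <= C /\
    forall t g h, 1 <= t -> d g (gmul g h) <= t -> `|crd (e h) k| <= (C * t) ^+ hwt k.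
  by move=> k; have [|C C1 hC] := growth_dist _ (he k); [rewrite /hwt; lia|exists C].
pose D := \sum_(k < m.+1) C k.
have C0 k : 0 <= C k by have := (CP k).1; lra.
have DC (k : 'I_m.+1) : C k <= D by rewrite /D (bigD1 k) //= lerDl sumr_ge0.
have D1 : 1 <= D := le_trans (CP 0%N).1 (DC ord0).
exists D => // t g h t1 ht k.
have [hk|hk] := leqP k m; last first.
  by rewrite crd_out ?hk ?orbT // normr0 exprn_ge0 // mulr_ge0 //; lra.
apply: (le_trans ((CP k).2 t g h t1 ht)); apply: lerXn2r; rewrite ?nnegrE.
- by rewrite mulr_ge0 //; lra.
- by rewrite mulr_ge0 //; lra.
apply: ler_wpM2r; first lra.
have hk' : (k < m.+1)%N by [].
exact: (DC (Ordinal hk')).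
Qed.

End Lower.

Lemma hlog_hor (R : realType) p b a :
  hlog (hor p (b, a)) = a *: hlog (hor p (b, 1 : R)) :> 'rV[R]_p.
Proof. by rewrite /hor !hlog_basis ?scale1r //; case: b. Qed.

Lemma coarse_upper (R : realType) (G : group_law R) (I : finType)
    (cr : I -> G -> R) (ba : I -> G) (d : G -> G -> R) m n
    (j : 'rV[R]_m * 'rV[R]_n -> G) :
  polynomial_group cr ba -> coarse_metric cr d -> (2 <= m)%N -> (2 <= n)%N ->
  (forall P Q, j (pmul P Q) = gmul (j P) (j Q)) ->
  (forall b a, j (hor m (b, a), 0) = a *: j (hor m (b, 1), 0)) ->
  (forall b a, j (0, hor n (b, a)) = a *: j (0, hor n (b, 1))) ->
  exists2 C, 0 <= C & forall t P g, 1 <= t -> pball t P -> d g (gmul g (j P)) <= C * t.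
Proof.
move=> hG hd m2 n2 jM jl jr; have [reach [rM rl rd]] := dist_reach hd.
have [C C0 hC] := reach_pball hG rM rl m2 n2 jM jl jr.
exists C => // t P g t1 /(hC t P t1)[l lC rP].
by apply: le_trans lC; exact: rd.
Qed.

Section ProductModel.
Variables (R : realType) (p q : nat).
Hypotheses (p2 : (2 <= p)%N) (q2 : (2 <= q)%N).
Local Notation G := (prod_group (filiform_group R p) (filiform_group R q)).

Definition to_product (P : 'rV[R]_p * 'rV[R]_q) : G := (hlog P.1, hlog P.2).

Lemma to_productM P Q : to_product (pmul P Q) = gmul (to_product P) (to_product Q).
Proof.
rewrite /to_product /pmul; congr (_, _); first exact: (hlog_bch (ltnW p2)).
exact: (hlog_bch (ltnW q2)).
Qed.

Lemma product_model (d : G -> G -> R) : left_invariant_metric d ->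
  homogeneous_model d to_product.
Proof.
have hG := prod_polynomial_group (filiform_polynomial R (ltnW p2)) (filiform_polynomial R (ltnW q2)).
move=> /(left_invariant_coarse hG) hd.
have inM g h : hexp (gmul g h : G).1 = hmul (hexp g.1) (hexp h.1) /\
    hexp (gmul g h : G).2 = hmul (hexp g.2) (hexp h.2).
  have e := to_productM (hexp g.1, hexp g.2) (hexp h.1, hexp h.2).
  move: e; rewrite {2 3}/to_product !hexpK -!surjective_pairing => <-.
  by rewrite /to_product !hlogK.
split; first exact: to_productM.
  apply: (coarse_upper hG hd) => //; first exact: to_productM.
    move=> b a; rewrite /to_product hlog_hor hlog0.
    by congr (_, _); rewrite scaler0.
  move=> b a; rewrite /to_product hlog_hor hlog0.
  by congr (_, _); rewrite scaler0.
set cr := fun _ => _ in hG hd.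
have pv1 k : polyf cr (fun x : G => crd x.1 k).
  by apply: polyf_crd => i; exact: (@polyf_var _ _ _ cr (inl i)).
have pv2 k : polyf cr (fun x : G => crd x.2 k).
  by apply: polyf_crd => i; exact: (@polyf_var _ _ _ cr (inr i)).
have out n (e : G -> 'rV[R]_n) : (forall k, (k <= n)%N -> growth cr (hwt k) (fun x => crd (e x) k)) ->
    forall k, growth cr (hwt k) (fun x => crd (e x) k).
  move=> h k; have [hk|hk] := leqP k n; first exact: h.
  apply: (@growth_leq _ _ _ _ 0) => //; apply: (growth_ext (growth_cst _ 0)) => x.
  by rewrite crd_out // hk orbT.
have [|C C1 hC] := growth_hball hd (e := fun x => hexp x.1).
  apply: out; apply: growth_hmul => //; [exact: hexp0|exact: polyf_hexp|].
  by move=> g h k _; rewrite (inM g h).1.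
have [|D D1 hD] := growth_hball hd (e := fun x => hexp x.2).
  apply: out; apply: growth_hmul => //; [exact: hexp0|exact: polyf_hexp|].
  by move=> g h k _; rewrite (inM g h).2.
exists (C + D) => [|t g h t1 ht]; first by lra.
exists (hexp h.1, hexp h.2); last by rewrite /to_product !hexpK -surjective_pairing.
split; [apply: hball_leq (hC t g h t1 ht) _|apply: hball_leq (hD t g h t1 ht) _];
  by rewrite ler_wpM2r //; lra.
Qed.

End ProductModel.

Section CentralModel.
Variables (R : realType) (p q : nat).
Hypotheses (q2 : (2 <= q)%N) (qp : (q <= p)%N).
Let p2 : (2 <= p)%N := leq_trans q2 qp.
Local Notation G := (central_product_group R p q).
Local Notation to_central := (@to_central R p q).
Local Notation of_central := (@of_central R p q).

Lemma to_central_z P c : to_central (P.1 + hz p c, P.2 + hz q (- c)) = to_central P.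
Proof.
rewrite /to_central /= !hlogDz //.
have -> : (hlog P.1 + hz p c, hlog P.2 + hz q (- c)) =
    (hlog P.1, hlog P.2) + (hz p c, hz q (- c)) :> prod_lie (filiform R p) (filiform R q) by [].
rewrite raddfD /= (_ : central_proj (hz p c, hz q (- c)) = 0) ?addr0 //.
apply/(central_proj_eq0 (ltnW q2)); exists c.
by rewrite /hz scaleNr -scalerN.
Qed.

Lemma to_central_eq0 P : to_central P = 0 -> exists c, P = (hz p c, hz q (- c)).
Proof.
rewrite /to_central => /(central_proj_eq0 (ltnW q2))[c [h1 h2]]; exists c.
rewrite [P]surjective_pairing -(hlogK P.1) -(hlogK P.2) h1 h2; congr (_, _).
  by rewrite -[c *: _]add0r hexpDz // hexp0 add0r.
rewrite -[c *: _]add0r scalerN -scaleNr hexpDz // hexp0 add0r //.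
Qed.

Lemma of_centralM g h : exists c, of_central (gmul g h) =
  (hmul (of_central g).1 (of_central h).1 + hz p c, hmul (of_central g).2 (of_central h).2 + hz q (- c)).
Proof.
set P := of_central g; set Q := of_central h.
have e : to_central (of_central (gmul g h)) = to_central (pmul P Q).
  by rewrite to_centralM // !of_centralK.
set W := of_central _ in e *.
have /to_central_eq0[c] : to_central (pmul (hinv (hmul P.1 Q.1), hinv (hmul P.2 Q.2)) W) = 0.
  rewrite to_centralM // e -to_centralM // /pmul /= !hmulVx.
  by rewrite /to_central /= !hlog0; exact: raddf0.
case=> h1 h2; exists c; rewrite [W]surjective_pairing.
by congr (_, _); rewrite -hmul_z // -?h1 -?h2 hmulVKx.
Qed.

(* The representative whose L_q-component has top coordinate 0. *)
Definition central_rep (w : G) : 'rV[R]_p * 'rV[R]_q :=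
  ((of_central w).1 + hz p (crd (of_central w).2 q),
   (of_central w).2 + hz q (- crd (of_central w).2 q)).

Lemma to_central_rep w : to_central (central_rep w) = w.
Proof. by rewrite to_central_z of_centralK. Qed.

Lemma central_model (d : G -> G -> R) : left_invariant_metric d ->
  homogeneous_model d to_central.
Proof.
have hG := central_polynomial R q2 qp.
move=> /(left_invariant_coarse hG) hd.
split; first exact: to_centralM.
  apply: (coarse_upper hG hd) => //; first exact: to_centralM.
    move=> b a; rewrite /to_central hlog_hor hlog0 -linearZ; congr central_proj.
    by congr (_, _); rewrite scaler0.
  move=> b a; rewrite /to_central hlog_hor hlog0 -linearZ; congr central_proj.
  by congr (_, _); rewrite scaler0.
set cr := @central_crd R p q in hG hd *.
have ps k := @polyf_central_sec R p q _ _ cr id (@polyf_var _ _ _ cr) k.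
have pe1 : forall k, polyf cr (fun x : G => crd (of_central x).1 k).
  by apply: polyf_hexp => k; exact: (ps k).1.
have pe2 : forall k, polyf cr (fun x : G => crd (of_central x).2 k).
  by apply: polyf_hexp => k; exact: (ps k).2.
have of0 : of_central 0 = 0.
  rewrite /of_central (_ : @central_sec R p q 0 = 0); last exact: raddf0.
  by congr (_, _); exact: hexp0.
have g1 k : (k <= p.-1)%N -> growth cr (hwt k) (fun x => crd (of_central x).1 k).
  apply: growth_hmul => //; [exact: leq_pred|by rewrite of0|].
  move=> g h {}k hk; have [c ->] := of_centralM g h.
  by rewrite crdD hz_tail ?addr0 //; lia.
have g2 k : (k <= q.-1)%N -> growth cr (hwt k) (fun x => crd (of_central x).2 k).
  apply: growth_hmul => //; [exact: leq_pred|by rewrite of0|].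
  move=> g h {}k hk; have [c ->] := of_centralM g h.
  by rewrite crdD hz_tail ?addr0 //; lia.
have gX j : growth cr j (fun x => crd (of_central x).1 1 ^+ j) /\
    growth cr j (fun x => crd (of_central x).2 1 ^+ j).
  elim: j => [|j [I1 I2]].
    by split; apply: (growth_ext (growth_cst _ 1)) => x; rewrite expr0.
  split; [apply: (growth_ext (growthM (g1 1%N _) I1)) => [|x]|
    apply: (growth_ext (growthM (g2 1%N _) I2)) => [|x]]; rewrite ?exprS //; lia.
(* By [of_centralM] each of the two top coordinates is multiplicative only up to an unknown [c],
   which disappears in their sum. This sum has degree [p.-1] because [q <= p]. *)
have gtop : growth cr (hwt p) (fun x => crd (of_central x).1 p + crd (of_central x).2 q).
  pose F (k : nat) (u v : 'rV[R]_k) := \sum_(j < k.-2) crd u 1 ^+ j.+1 / j.+1`!%:R * crd v (k - j.+1).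
  have topE k (u v : 'rV[R]_k) : (2 <= k)%N -> crd (hmul u v) k = crd u k + crd v k + F k u v.
    case: k u v => [|[|k]] // u v _; rewrite crd_hmul /= ?leqnn // big_ord_recl subn0 expr0 fact0 divr1 mul1r.
    by rewrite addrA.
  have -> : hwt p = p.-2.+1 by rewrite /hwt; lia.
  pose K := (1 + (p.-2 + q.-2))%N.
  pose A (i : 'I_K) (x : G) : R := match fintype.split i with inl _ => 1 | inr i => match fintype.split i with
    | inl j => crd (of_central x).1 1 ^+ j.+1 * (j.+1`!%:R)^-1
    | inr j => crd (of_central x).2 1 ^+ j.+1 * (j.+1`!%:R)^-1 end end.
  pose psi (i : 'I_K) (x : G) : R := match fintype.split i with
    inl _ => crd (of_central x).1 p + crd (of_central x).2 q | inr i => match fintype.split i with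
    | inl j => crd (of_central x).1 (p - j.+1)
    | inr j => crd (of_central x).2 (q - j.+1) end end.
  apply: (@growth_step _ _ _ _ p.-2 K A psi).
  - move=> i; rewrite /A; case: (fintype.split i) => [_|{}i].
      by apply: (@growth_leq _ _ _ _ 0) => //; exact: growth_cst.
    case: (fintype.split i) => j; apply: (@growth_leq _ _ _ _ (j.+1 + 0)); rewrite ?addn0; first exact: ltn_ord.
    + by rewrite -[X in growth _ X]addn0; apply: growthM (growth_cst _ _); exact: (gX _).1.
    + by apply: leq_trans (ltn_ord j) _; lia.
    by rewrite -[X in growth _ X]addn0; apply: growthM (growth_cst _ _); exact: (gX _).2.
  - move=> i; rewrite /psi; case: (fintype.split i) => [_|{}i]; first exact: polyfD.
    by case: (fintype.split i) => j.
  - move=> i; rewrite /psi of0; case: (fintype.split i) => [_|{}i]; first by rewrite !crd0 addr0.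
    by case: (fintype.split i) => j; rewrite crd0.
  move=> g h; have [c ->] := of_centralM g h.
  rewrite !crdD !hz_top // !topE // /K big_split_ord big_ord1 big_split_ord /A /psi /=.
  under eq_bigr do rewrite (unsplitK (inr _)) (unsplitK (inl _)).
  under [X in _ + (_ + (_ + X))]eq_bigr do rewrite (unsplitK (inr _)) (unsplitK (inr _)).
  rewrite (unsplitK (inl _)) mul1r -/(F p _ _) -/(F q _ _); ring.
have [|C C1 hC] := growth_hball hd (e := fun x => (central_rep x).1).
  move=> k; have [hk|hk] := ltnP k p.
    apply: (growth_ext (g1 k _)) => [|x]; first by lia.
    by rewrite crdD hz_tail // addr0.
  move: hk; rewrite leq_eqVlt => /orP[/eqP <-|hk].
    by apply: (growth_ext gtop) => x; rewrite crdD hz_top.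
  apply: (@growth_leq _ _ _ _ 0) => //; apply: (growth_ext (growth_cst _ 0)) => x.
  by rewrite crd_out // hk orbT.
have [|D D1 hD] := growth_hball hd (e := fun x => (central_rep x).2).
  move=> k; have [hk|hk] := ltnP k q.
    apply: (growth_ext (g2 k _)) => [|x]; first by lia.
    by rewrite crdD hz_tail // addr0.
  apply: (@growth_leq _ _ _ _ 0) => //; apply: (growth_ext (growth_cst _ 0)) => x.
  move: hk; rewrite leq_eqVlt => /orP[/eqP <-|hk]; last by rewrite crd_out // hk orbT.
  by rewrite crdD hz_top // subrr.
exists (C + D) => [|t g h t1 ht]; first by lra.
exists (central_rep h); last exact: to_central_rep.
split; [apply: hball_leq (hC t g h t1 ht) _|apply: hball_leq (hD t g h t1 ht) _];
  by rewrite ler_wpM2r //; lra.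
Qed.

End CentralModel.

Lemma hwtE k : (2 <= k)%N -> hwt k = k.-1.
Proof. by rewrite /hwt; lia. Qed.

Lemma hwt_leq k n : (2 <= n)%N -> (k <= n)%N -> (hwt k <= n.-1)%N.
Proof. by rewrite /hwt; lia. Qed.

Lemma hball_hwt (R : realType) k (u : 'rV[R]_k) (c : R) : 1 <= c -> (forall i, `|crd u i| <= c) -> hball c u.
Proof.
move=> c1 h i; apply: (le_trans (h i)); rewrite /hwt.
by rewrite (_ : maxn 1 i.-1 = (maxn 1 i.-1).-1.+1) ?exprS ?ler_peMr ?exprn_ege1 //; [lra|lia].
Qed.

(** * Filling paths by triangles *)

Section PathSums.
Variables (R : realType) (T : Type).
Implicit Types (lam : T -> T -> R) (c : nat -> T).

Definition psum lam c n := \sum_(i < n) lam (c i) (c i.+1).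

Lemma psumS lam c n : psum lam c n.+1 = psum lam c n + lam (c n) (c n.+1).
Proof. by rewrite /psum big_ord_recr. Qed.

Lemma psum0 lam c : psum lam c 0 = 0. Proof. by rewrite /psum big_ord0. Qed.

(** Each square between the two paths is cut along the diagonal from [c i] to [c' i.+1]; the inner
    rungs cancel. *)
Lemma ladder lam K c c' n :
  (forall i, (i < n)%N ->
     `|lam (c i) (c i.+1) + lam (c i.+1) (c' i.+1) - lam (c i) (c' i.+1)| <= K) ->
  (forall i, (i < n)%N ->
     `|lam (c i) (c' i) + lam (c' i) (c' i.+1) - lam (c i) (c' i.+1)| <= K) ->
  `|psum lam c n - psum lam c' n - lam (c 0%N) (c' 0%N) + lam (c n) (c' n)| <= 2 * K * n%:R.
Proof.
elim: n => [|n IH] h1 h2; first by rewrite !psum0 subrr sub0r addNr normr0 mulr0.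
have {}IH := IH (fun i hi => h1 i (ltnW hi)) (fun i hi => h2 i (ltnW hi)).
have {h1} := h1 n (ltnSn n); have {h2} := h2 n (ltnSn n); rewrite !psumS -natr1.
move: IH; rewrite !ler_norml; move: (psum _ _ _) (psum _ _ _) => x y; lra.
Qed.

End PathSums.

Section Product.
Variables (R : realType) (m n : nat).
Implicit Types P Q S : 'rV[R]_m * 'rV[R]_n.

Definition pairinv P : 'rV[R]_m * 'rV[R]_n := (hinv P.1, hinv P.2).

Lemma pmulA : associative (@pmul R m n).
Proof. by move=> P Q S; rewrite /pmul /= !hmulA. Qed.

Lemma pmulVKx P Q : pmul P (pmul (pairinv P) Q) = Q.
Proof. by case: Q => a b; rewrite /pmul /= !hmulVKx. Qed.

Lemma pmulKx P Q : pmul (pairinv P) (pmul P Q) = Q.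
Proof. by case: Q => a b; rewrite /pmul /= !hmulKx. Qed.

Lemma pballM t t' P Q : pball t P -> pball t' Q -> pball (t + t') (pmul P Q).
Proof. by move=> [h1 h2] [h3 h4]; split; exact: hballM. Qed.

Lemma pballV t P : pball t P -> pball (2 * t) (pairinv P).
Proof. by move=> [h1 h2]; split; exact: hballV. Qed.

Lemma pball_leq t t' P : pball t P -> t <= t' -> pball t' P.
Proof. by move=> [h1 h2] h; split; [exact: hball_leq h1 h|exact: hball_leq h2 h]. Qed.

Lemma pball_path (c : nat -> 'rV[R]_m * 'rV[R]_n) l : pball 0 (c 0%N) ->
  (forall i, (i < l)%N -> pball 1 (pmul (pairinv (c i)) (c i.+1))) ->
  forall i, (i <= l)%N -> pball i%:R (c i).
Proof.
move=> c0 h; elim=> [|i IH] // hi; rewrite -(pmulVKx (c i) (c i.+1)) -natr1.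
by apply: pballM; [exact/IH/ltnW|exact: h].
Qed.

End Product.

Section Fill.
Variables (R : realType) (p : nat) (s : R).
Hypothesis p4 : (4 <= p)%N.
Let q := p.-1.
Let p2 : (2 <= p)%N. Proof. by lia. Qed.
Let q2 : (2 <= q)%N. Proof. by rewrite /q; lia. Qed.
Local Notation T := ('rV[R]_p * 'rV[R]_q)%type.
Implicit Types (P Q : T) (lam : T -> T -> R) (K c rho t : R).

Definition ztr t P : T := (P.1 + hz p t, P.2).
(* The kernel of the rescaled map onto the central product. *)
Definition kappa t P : T := (P.1 + hz p t, P.2 + hz q (- (s * t))).

(** A cochain that descends modulo the kernel, with small coboundary at bounded scale. The smallness
    on central segments is not a coboundary condition: it is a normalisation, obtained by
    [tame_gauge]. *)
Record tame lam K c rho : Prop := Tame {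
  tame_kappa : forall t P Q, lam (kappa t P) Q = lam P Q /\ lam P (kappa t Q) = lam P Q;
  tame_cocycle : forall P h h', pball rho P -> pball c h -> pball c h' ->
    `|lam P (pmul P h) + lam (pmul P h) (pmul P (pmul h h')) - lam P (pmul P (pmul h h'))| <= K;
  tame_line : forall P t, pball rho P -> `|t| <= c -> `|lam P (ztr t P)| <= K
}.

Lemma tame_triangle lam K c rho P Q S : tame lam K c rho -> pball rho P ->
  pball c (pmul (pairinv P) Q) -> pball c (pmul (pairinv Q) S) ->
  `|lam P Q + lam Q S - lam P S| <= K.
Proof.
move=> hl hP h1 h2; have := tame_cocycle hl hP h1 h2.
by rewrite !pmulA -!(pmulA P) !pmulVKx -!pmulA !pmulVKx.
Qed.

Lemma tame_ladder lam K c rho (d d' : nat -> T) n : tame lam K c rho ->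
  (forall i, (i < n)%N -> pball rho (d i)) ->
  (forall i, (i <= n)%N -> pball c (pmul (pairinv (d i)) (d' i))) ->
  (forall i, (i < n)%N -> pball c (pmul (pairinv (d i)) (d i.+1))) ->
  (forall i, (i < n)%N -> pball c (pmul (pairinv (d' i)) (d' i.+1))) ->
  `|psum lam d n - psum lam d' n - lam (d 0%N) (d' 0%N) + lam (d n) (d' n)| <= 2 * K * n%:R.
Proof.
move=> hl hd hr he he'; apply: ladder => i hi.
  by apply: (tame_triangle hl (hd i hi) (he i hi)); exact: hr.
by apply: (tame_triangle hl (hd i hi) (hr i (ltnW hi))); exact: he'.
Qed.

(** The two factors commute, so the path can be replaced by its first component followed by its
    second one over the end of the first. Each step in the first factor is moved across the previous
    steps in the second by one ladder, hence the [O(n^2)] triangles. *)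
Lemma separation lam K c rho (P : nat -> T) n : tame lam K c rho -> 1 <= c -> n%:R <= rho ->
  P 0%N = (0, 0) -> (forall i, (i < n)%N -> pball 1 (pmul (pairinv (P i)) (P i.+1))) ->
  `|psum lam P n - psum lam (fun i => ((P i).1, 0)) n - psum lam (fun i => ((P n).1, (P i).2)) n|
    <= K * (1 + 2 * n%:R) * n%:R.
Proof.
move=> hl c1 nr P0 hP.
have B0 k : hball c (0 : 'rV[R]_k) by apply: hball0; lra.
have hB i : (i <= n)%N -> pball rho (P i).
  move=> hi; apply: pball_leq (pball_path _ hP hi) _; first by rewrite P0; split; exact: hball0.
  by apply: le_trans nr; rewrite ler_nat.
have hP' i : (i < n)%N -> pball c (pmul (pairinv (P i)) (P i.+1)).
  by move=> hi; apply: pball_leq (hP i hi) c1.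
have K0 : (0 < n)%N -> 0 <= K.
  move=> n0; have := tame_triangle hl (hB 0%N isT) (hP' 0%N n0) (_ : pball c (pmul (pairinv (P 1%N)) (P 1%N))).
  move=> h; apply: (le_trans _ (h _)) => //.
  by rewrite /pmul /= !hmulVx; split; exact: B0.
suff key i : (i <= n)%N ->
   `|psum lam P i - psum lam (fun i => ((P i).1, 0)) i - psum lam (fun j => ((P i).1, (P j).2)) i|
    <= K * (1 + 2 * n%:R) * i%:R by exact: key.
elim: i => [|i IH] hi; first by rewrite !psum0 !subr0 normr0 mulr0.
have {}IH := IH (ltnW hi).
have Kn : 0 <= K by apply: K0; lia.
have e1 : `|lam (P i) ((P i.+1).1, (P i).2) + lam ((P i.+1).1, (P i).2) (P i.+1) - lam (P i) (P i.+1)| <= K.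
  apply: (tame_triangle hl); first exact/hB/ltnW.
    by rewrite /pmul /= hmulVx; split; [exact: (hP' i hi).1|exact: B0].
  by rewrite /pmul /= hmulVx; split; [exact: B0|exact: (hP' i hi).2].
have e2 := @tame_ladder lam K c rho (fun j => ((P i).1, (P j).2)) (fun j => ((P i.+1).1, (P j).2)) i hl.
have {e2} := e2 (fun j hj => conj (hB i (ltnW hi)).1 (hB j (ltnW (ltn_trans hj hi))).2).
rewrite P0 /= => e2.
have {e2} e2 : `|psum lam (fun j => ((P i).1, (P j).2)) i - psum lam (fun j => ((P i.+1).1, (P j).2)) i
   - lam ((P i).1, 0) ((P i.+1).1, 0) + lam ((P i).1, (P i).2) ((P i.+1).1, (P i).2)| <= 2 * K * i%:R.
  apply: e2 => j hj; rewrite /pmul /= ?hmulVx; split => //=.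
  - exact: (hP' i hi).1.
  - by apply: (hP' j _).2; lia.
  by apply: (hP' j _).2; lia.
rewrite !psumS -surjective_pairing in e2 *.
have iK : 2 * K * i%:R <= 2 * K * n%:R.
  by apply: ler_wpM2l; [lra|rewrite ler_nat ltnW].
rewrite -natr1; move: e1 e2 IH; rewrite -!surjective_pairing !ler_norml; lra.
Qed.

(* Cone of a path of L_(p-1): there are as many levels as the top weight requires,
   and the last column runs along the centre. *)
Lemma ycone lam K c rho (g : 'rV[R]_p) (h : nat -> 'rV[R]_q) A N n t :
  tame lam K c rho -> 1 <= s -> 1 <= A -> (0 < N)%N -> n%:R <= A * N%:R ->
  (q ^ 2)%:R * A ^+ q.-1 <= c -> 1 <= c -> hball (rho - n%:R) g ->
  h 0%N = 0 -> (forall i, (i < n)%N -> hball 1 (hmul (hinv (h i)) (h i.+1))) -> h n = hz q t ->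
  `|psum lam (fun i => (g, h i)) n| <= K * ((N ^ q.-1)%:R * (2 * n%:R + 2) + n%:R).
Proof.
move=> hl s1 A1 N0 nN hc c1 hg h0 hh hn.
have nrho : n%:R <= rho by have := hball_ge0 hg; lra.
have rho0 : 0 <= rho by apply: le_trans nrho.
pose M := (N ^ q.-1)%N.
have M0 : 0 < (M%:R : R) by rewrite ltr0n expn_gt0 N0.
pose a (k : nat) : R := k%:R / M%:R.
have a0 k : 0 <= a k by rewrite divr_ge0.
have a1 k : (k <= M)%N -> a k <= 1 by move=> hk; rewrite ler_pdivrMr // mul1r ler_nat.
pose H k i := hdil (a k) (h i).
have hB i : (i <= n)%N -> hball n%:R (h i).
  move=> hi; have h00 : pball 0 ((0, h 0%N) : T) by rewrite h0; split; exact: hball0.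
  have := pball_path (c := fun i => (0, h i)) h00 _ hi => hp.
  have [|_ hb] := hp.
    by move=> j hj; rewrite /pmul /= hmulVx; split; [exact: hball0|exact: hh].
  by apply: hball_leq hb _; rewrite ler_nat.
have HB k i : (k <= M)%N -> (i <= n)%N -> hball n%:R (H k i).
  by move=> hk hi; apply: hball_dil1; [rewrite a0 a1|exact: hB].
have B0 k r : 0 <= r -> hball r (0 : 'rV[R]_k) by exact: hball0.
have gB : hball rho g by apply: hball_leq hg _; rewrite gerBl.
have AN1 : 1 <= A * N%:R.
  by have : (1 : R) <= N%:R; [rewrite ler1n|nra].
have rung k i : (k < M)%N -> (i <= n)%N ->
    forall j, `|crd (hmul (hinv (H k i)) (H k.+1 i)) j| <= c.
  move=> hk hi j; have [hj|hj] := leqP j q; last by rewrite crd_out ?hj ?orbT // normr0; lra.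
  have ak : 0 <= a k <= a k.+1 by rewrite a0 ler_pM2r ?invr_gt0 // ler_nat leqnSn.
  apply: (le_trans (hdil_increment j (hB i hi) ak (a1 _ hk))).
  apply: le_trans hc; rewrite -mulrA; apply: ler_wpM2l => //.
  rewrite (_ : a k.+1 - a k = M%:R^-1); last by rewrite /a -natr1 mulrDl mul1r addrC addKr.
  rewrite mulrC ler_pdivrMr // /M natrX -exprMn.
  apply: (@le_trans _ _ ((A * N%:R) ^+ hwt j)); first by apply: lerXn2r; rewrite ?nnegrE //; lra.
  by apply: ler_weXn2l => //; exact: hwt_leq.
have K0 : 0 <= K.
  apply: (le_trans _ (tame_line hl (P := (0, 0)) (t := 0) _ _)) => //; last by rewrite normr0; lra.
  by split; exact: B0.
pose lev k := psum lam (fun i => (g, H k i)) n.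
have l0 P : pball rho P -> `|lam P P| <= K.
  move=> hP; have := tame_line hl hP (t := 0); rewrite normr0 /ztr hz0 addr0 -surjective_pairing.
  by apply; lra.
have lev0 : `|lev 0%N| <= K * n%:R.
  rewrite /lev /psum; apply: le_trans (ler_norm_sum _ _ _) _.
  rewrite -[X in _ <= _ * X%:R]card_ord mulr_natr -sumr_const; apply: ler_sum => i _.
  rewrite /H /a mul0r !hdil0; apply: l0; split => //=; exact: B0.
have levS k : (k < M)%N -> `|lev k - lev k.+1| <= 2 * K * n%:R + 2 * K.
  move=> hk; have e := @tame_ladder lam K c rho (fun i => (g, H k i)) (fun i => (g, H k.+1 i)) n hl.
  have {e}e : `|lev k - lev k.+1 - lam (g, H k 0%N) (g, H k.+1 0%N) + lam (g, H k n) (g, H k.+1 n)|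
      <= 2 * K * n%:R.
    apply: e => i hi.
    - split => //; apply: hball_leq nrho; apply: HB; exact: ltnW.
    - rewrite /pmul /= hmulVx; split; first by apply: B0; lra.
      by apply: hball_hwt => // j; exact: rung.
    - rewrite /pmul /= hmulVx; split; first by apply: B0; lra.
      rewrite -hdilV -hdilM; apply: hball_leq c1; apply: hball_dil1; last exact: hh.
      by rewrite a0 a1 // ltnW.
    rewrite /pmul /= hmulVx; split; first by apply: B0; lra.
    rewrite -hdilV -hdilM; apply: hball_leq c1; apply: hball_dil1; last exact: hh.
    by rewrite a0 a1.
  have e0 : `|lam (g, H k 0%N) (g, H k.+1 0%N)| <= K.
    by rewrite /H h0 !hdilx0; apply: l0; split => //=; exact: B0.
  have en : `|lam (g, H k n) (g, H k.+1 n)| <= K.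
    have HE k' : H k' n = hz q (a k' ^+ q.-1 * t) by rewrite /H hn hdil_z.
    (* Modulo the kernel, a central point of L_(p-1) is a central point of L_p. The ends of two
       successive levels therefore differ by a short segment in the centre of L_p, which [tame_line]
       handles. *)
    have xs x : (g, hz q x) = kappa (- (x / s)) (ztr (x / s) (g, 0)).
      rewrite /kappa /ztr /= -addrA hzD subrr hz0 addr0 add0r; congr (_, hz q _).
      by field; lra.
    rewrite !HE; set x := _ * t; set y := _ * t; rewrite !xs.
    rewrite (tame_kappa hl _ _ _).1 (tame_kappa hl _ _ _).2.
    have -> : ztr (y / s) (g, 0) = ztr ((y - x) / s) (ztr (x / s) (g, 0)).
      by rewrite /ztr /= -addrA hzD; congr (_ + hz p _, _); ring.
    have tn : `|t| <= n%:R ^+ q.-1.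
      have := hB n (leqnn n) q; rewrite hn hz_top //.
      by rewrite hwtE.
    have sV : `|s^-1| <= 1 by rewrite ger0_norm ?invr_ge0 ?invf_le1 //; lra.
    apply: (tame_line hl); first split => /=.
    - rewrite -hmul_z //; have -> : rho = rho - n%:R + n%:R by ring.
      apply: hballM => //; apply: hball_z => //.
      rewrite /x normrM normrM.
      apply: (@le_trans _ _ (n%:R ^+ q.-1)).
        rewrite -[leRHS]mulr1; apply: ler_pM => //; rewrite -[leRHS]mul1r; apply: ler_pM => //.
        by rewrite ger0_norm ?exprn_ge0 // exprn_ile1 // a1 // ltnW.
      have [->|n0] := posnP n; first by rewrite !expr0n /q; case: (p) p4 => [|[|[|]]].
      by apply: ler_weXn2l; [rewrite ler1n|exact: leq_pred].
    - exact: B0.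
    have := rung k n hk (leqnn n) q; rewrite !HE hinv_z // hmul_z // hzD hz_top // -/x -/y addrC => hxy.
    rewrite normrM -[leRHS]mulr1; exact: ler_pM.
  move: e e0 en; rewrite !ler_norml; lra.
have levk k : (k <= M)%N -> `|lev k| <= K * (k%:R * (2 * n%:R + 2) + n%:R).
  elim: k => [|k IH] hk; first by rewrite mul0r add0r.
  have := IH (ltnW hk); have := levS k hk; rewrite -natr1 !ler_norml; lra.
have := levk M (leqnn M); rewrite /lev /H /a mulfV ?gt_eqF //.
by rewrite (_ : psum lam (fun i => (g, hdil 1 (h i))) n = psum lam (fun i => (g, h i)) n) //
  /psum; apply: eq_bigr => i _; rewrite !hdil1.
Qed.

End Fill.

(** * Averages over central translates *)

Section Average.
Variables (R : realType) (p : nat) (s : R).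
Hypothesis p4 : (4 <= p)%N.
Let q := p.-1.
Let p2 : (2 <= p)%N. Proof. by lia. Qed.
Let q2 : (2 <= q)%N. Proof. by rewrite /q; lia. Qed.
Local Notation T := ('rV[R]_p * 'rV[R]_q)%type.
Implicit Types (P Q : T) (lam : T -> T -> R) (K c rho t : R).

Lemma ztrD a b P : ztr a (ztr b P) = ztr (b + a) P.
Proof. by rewrite /ztr /= -addrA hzD. Qed.

Lemma ztr0 P : ztr 0 P = P.
Proof. by rewrite /ztr hz0 addr0 -surjective_pairing. Qed.

Lemma pmul_ztr t P Q : pmul (ztr t P) Q = ztr t (pmul P Q).
Proof. by rewrite /pmul /ztr /= hDzmul. Qed.

Lemma ztr_kappa t t' P : ztr t (kappa s t' P) = kappa s t' (ztr t P).
Proof. by rewrite /ztr /kappa /= addrAC. Qed.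

Lemma pairinv_ztr t P Q : pmul (pairinv (ztr t P)) (ztr t Q) = pmul (pairinv P) Q.
Proof. by rewrite /pmul /= hinvDz // hDzmul // hmulDz // -addrA hzD subrr hz0 addr0. Qed.

Lemma pairinv_zstep t P : pmul (pairinv P) (ztr t P) = (hz p t, 0).
Proof. by rewrite /pmul /= hmulDz // !hmulVx add0r. Qed.

Lemma pball_zstep a t : 1 <= a -> `|t| <= a -> pball a ((hz p t, 0) : T).
Proof.
move=> a1 ta; have a0 : 0 <= a by lra.
split; last exact: hball0.
apply: hball_z => //; apply: (le_trans ta).
have -> : p.-1 = p.-2.+1 by lia.
by rewrite exprS ler_peMr // exprn_ege1.
Qed.

Lemma pball_ztr a b t P : pball a P -> 0 <= b -> `|t| <= b ^+ p.-1 -> pball (a + b) (ztr t P).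
Proof.
move=> [h1 h2] b0 hb; split; last by apply: hball_leq h2 _; rewrite lerDl.
by rewrite /= -hmul_z //; apply: hballM => //; apply: hball_z.
Qed.

Lemma kappa_z t (g : 'rV[R]_p) : s != 0 -> (g, hz q (s * t)) = kappa s (- t) (ztr t (g, 0)).
Proof.
move=> s0; rewrite /kappa /ztr /= -addrA hzD subrr hz0 addr0 add0r; congr (_, hz q _).
by rewrite mulrN opprK.
Qed.

(* The translation by z^J is, modulo the kernel, a translation in L_(p-1), which is
   the endpoint of a short word w commuting with u. *)
Lemma strip lam K c rho (u : nat -> 'rV[R]_p) (w : nat -> 'rV[R]_q) A l n nw J :
  tame s lam K c rho -> 1 <= s -> 1 <= A -> (0 < l)%N -> nw%:R <= A * l%:R ->
  (q ^ 2)%:R * A ^+ q.-1 <= c -> 1 <= c ->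
  (forall i, (i <= n)%N -> hball (rho - nw%:R) (u i)) ->
  (forall i, (i < n)%N -> hball c (hmul (hinv (u i)) (u i.+1))) ->
  w 0%N = 0 -> (forall i, (i < nw)%N -> hball 1 (hmul (hinv (w i)) (w i.+1))) ->
  w nw = hz q (s * J) ->
  `|psum lam (fun i => (u i, 0)) n - psum lam (fun i => ztr J (u i, 0)) n| <=
    K * (2 * n%:R * nw%:R + 2 * ((l ^ q.-1)%:R * (2 * nw%:R + 2) + nw%:R)).
Proof.
move=> hl s1 A1 l0 hnw hc c1 hu he w0 hw wJ.
(* The two sides of the strip are copies of [w] over the ends of [u]; cones bound their sums. *)
have cap i : (i <= n)%N -> `|psum lam (fun k => (u i, w k)) nw| <=
    K * ((l ^ q.-1)%:R * (2 * nw%:R + 2) + nw%:R).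
  by move=> hi; apply: (ycone p4 hl s1 A1 l0 hnw hc c1 (hu i hi) w0 hw wJ).
have nrho : nw%:R <= rho by have := hball_ge0 (hu 0%N isT); lra.
have B0 k r : 0 <= r -> hball r (0 : 'rV[R]_k) by exact: hball0.
have wB k : (k <= nw)%N -> hball rho (w k).
  move=> hk; have w00 : pball 0 ((0, w 0%N) : T) by rewrite w0; split; exact: B0.
  have := pball_path (c := fun i => (0, w i)) w00 _ hk => hp.
  have [|_ hb] := hp.
    by move=> j hj; rewrite /pmul /= hmulVx; split; [exact: B0|exact: hw].
  by apply: hball_leq hb _; apply: le_trans nrho; rewrite ler_nat.
have uB i : (i <= n)%N -> hball rho (u i).
  by move=> hi; apply: hball_leq (hu i hi) _; rewrite gerBl.
pose col k := psum lam (fun i => (u i, w k)) n.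
have colS k : (k < nw)%N ->
  `|col k - col k.+1 - lam (u 0%N, w k) (u 0%N, w k.+1) + lam (u n, w k) (u n, w k.+1)| <= 2 * K * n%:R.
  move=> hk; apply: (tame_ladder (d := fun i => (u i, w k)) (d' := fun i => (u i, w k.+1)) hl) => i hi.
  - by split; [exact/uB/ltnW|exact/wB/ltnW].
  - rewrite /pmul /= hmulVx; split; first by apply: B0; lra.
    by apply: hball_leq c1; exact: hw.
  - by rewrite /pmul /= hmulVx; split; [exact: he|apply: B0; lra].
  by rewrite /pmul /= hmulVx; split; [exact: he|apply: B0; lra].
have colk k : (k <= nw)%N -> `|col 0%N - col k - psum lam (fun k => (u 0%N, w k)) k
    + psum lam (fun k => (u n, w k)) k| <= 2 * K * n%:R * k%:R.
  elim: k => [|k IH] hk; first by rewrite !psum0 subrr subr0 addr0 normr0 mulr0.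
  have := IH (ltnW hk); have := colS k hk; rewrite !psumS -natr1 !ler_norml; lra.
have := colk nw (leqnn nw); have := cap 0%N isT; have := cap n (leqnn n).
have -> : col 0%N = psum lam (fun i => (u i, 0)) n by rewrite /col w0.
have -> : col nw = psum lam (fun i => ztr J (u i, 0)) n.
  rewrite /col /psum; apply: eq_bigr => i _; rewrite wJ !kappa_z ?gt_eqF //; [|lra..].
  by rewrite (tame_kappa hl _ _ _).1 (tame_kappa hl _ _ _).2.
rewrite !ler_norml; lra.
Qed.

Definition average lam J P Q : R := J%:R^-1 * \sum_(j < J) lam (ztr j%:R P) (ztr j%:R Q).

Lemma average_le J (F : 'I_J -> R) K : (0 < J)%N -> (forall j, `|F j| <= K) ->
  `|J%:R^-1 * \sum_(j < J) F j| <= K.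
Proof.
move=> J0 h; rewrite normrM ger0_norm ?invr_ge0 // mulrC ler_pdivrMr ?ltr0n //.
apply: le_trans (ler_norm_sum _ _ _) _.
by rewrite -[X in _ <= _ * X%:R]card_ord mulr_natr -sumr_const; apply: ler_sum.
Qed.

(** The averages involve points up to [J] central units away, which amounts to a radius [r] with
    [J <= r ^+ p.-1]. *)
Lemma average_tame lam K c rho rho' r J : tame s lam K c rho -> (0 < J)%N -> 0 <= r ->
  J%:R <= r ^+ p.-1 -> rho' + r <= rho -> tame s (average lam J) K c rho'.
Proof.
move=> hl J0 r0 Jr hr.
have zB (j : 'I_J) P : pball rho' P -> pball rho (ztr j%:R P).
  move=> hP; apply: pball_leq hr; apply: pball_ztr => //.
  by rewrite ger0_norm //; apply: le_trans Jr; rewrite ler_nat ltnW.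
split=> [t P Q|P h h' hP hh hh'|P t hP ht].
- by split; congr (_ * _); apply: eq_bigr => j _; rewrite !ztr_kappa; [exact: (tame_kappa hl _ _ _).1|exact: (tame_kappa hl _ _ _).2].
- rewrite /average -!mulrDr -mulrBr -!big_split /= -sumrB; apply: average_le => // j.
  by rewrite -!pmul_ztr; apply: (tame_cocycle hl) => //; exact: zB.
apply: average_le => // j; rewrite ztrD addrC -ztrD.
by apply: (tame_line hl) => //; exact: zB.
Qed.

Lemma psum_average lam J d n :
  psum (average lam J) d n = J%:R^-1 * \sum_(j < J) psum lam (fun i => ztr j%:R (d i)) n.
Proof. by rewrite /psum exchange_big mulr_sumr /=; apply: eq_bigr. Qed.

(** All translates but the two extreme ones cancel: a shift of the average by one unit is a shift of
    [lam] by [J] units divided by [J], and [strip] bounds the latter. *)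
Lemma average_shift lam J d n : psum (average lam J) d n - psum (average lam J) (fun i => ztr 1 (d i)) n =
  J%:R^-1 * (psum lam d n - psum lam (fun i => ztr J%:R (d i)) n).
Proof.
rewrite !psum_average -mulrBr; congr (_ * _).
pose F j := psum lam (fun i => ztr j%:R (d i)) n.
have -> : psum lam d n = F 0%N by apply: eq_bigr => i _; rewrite !ztr0.
have E j : psum lam (fun i => ztr j%:R (ztr 1 (d i))) n = F j.+1.
  by apply: eq_bigr => i _; rewrite !ztrD -natr1 addrC.
under [X in _ - X]eq_bigr do rewrite E.
rewrite -/(F J) -[RHS]opprB -[LHS]opprB; congr (- _).
by rewrite -(telescope_sumr F (leq0n J)) big_mkord -sumrB.
Qed.

(** Moving the path one unit at a time takes [J] ladders. This is affordable because it is done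
    once, not at each level of a cone. *)
Lemma average_close lam K c rho (d : nat -> T) J n r : tame s lam K c rho -> (0 < J)%N -> 0 <= r ->
  J%:R <= r ^+ p.-1 -> 1 <= c -> 0 <= K ->
  (forall i, (i <= n)%N -> pball (rho - r) (d i)) ->
  (forall i, (i < n)%N -> pball c (pmul (pairinv (d i)) (d i.+1))) ->
  `|psum lam d n - psum (average lam J) d n| <= K * J%:R * (2 * n%:R + 2).
Proof.
move=> hl J0 r0 Jr c1 K0 hd he.
pose F j := psum lam (fun i => ztr j%:R (d i)) n.
have dB j i : (j < J)%N -> (i <= n)%N -> pball rho (ztr j%:R (d i)).
  move=> hj hi; have -> : rho = rho - r + r by ring.
  apply: pball_ztr => //; first exact: hd.
  by rewrite ger0_norm //; apply: le_trans Jr; rewrite ler_nat ltnW.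
have FS j : (j < J)%N -> `|F j - F j.+1| <= K * (2 * n%:R + 2).
  move=> hj; have rung i : ztr j.+1%:R (d i) = ztr 1 (ztr j%:R (d i)) by rewrite ztrD -natr1.
  have e : `|F j - F j.+1 - lam (ztr j%:R (d 0%N)) (ztr j.+1%:R (d 0%N)) +
      lam (ztr j%:R (d n)) (ztr j.+1%:R (d n))| <= 2 * K * n%:R.
    apply: (tame_ladder (d := fun i => ztr j%:R (d i)) (d' := fun i => ztr j.+1%:R (d i)) hl) => i hi.
    - by apply: dB => //; exact: ltnW.
    - by rewrite rung pairinv_zstep; apply: pball_zstep; rewrite ?normr1.
    - by rewrite pairinv_ztr; exact: he.
    by rewrite pairinv_ztr; exact: he.
  have line i : (i <= n)%N -> `|lam (ztr j%:R (d i)) (ztr j.+1%:R (d i))| <= K.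
    by move=> hi; rewrite rung; apply: (tame_line hl); [exact: dB|rewrite normr1].
  have := line 0%N isT; have := line n (leqnn n); move: e; rewrite !ler_norml; lra.
have Fj j : (j <= J)%N -> `|F 0%N - F j| <= K * (2 * n%:R + 2) * j%:R.
  elim: j => [|j IH] hj; first by rewrite subrr normr0 mulr0.
  have := IH (ltnW hj); have := FS j hj; rewrite -natr1 !ler_norml; lra.
have -> : psum lam d n = J%:R^-1 * \sum_(j < J) F 0%N.
  rewrite (_ : \sum_(j < J) F 0%N = J%:R * F 0%N); last by rewrite sumr_const card_ord mulr_natl.
  rewrite mulrA mulVf ?mul1r ?pnatr_eq0 -?lt0n //.
  by apply: eq_bigr => i _; rewrite !ztr0.
rewrite psum_average -mulrBr -sumrB; apply: average_le => // j.
apply: (le_trans (Fj j _)); first exact: ltnW.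
rewrite -mulrA [_ * j%:R]mulrC mulrA; apply: ler_wpM2r; first by rewrite addr_ge0 // mulr_ge0.
by apply: ler_wpM2l => //; rewrite ler_nat ltnW.
Qed.

End Average.

(** * Cones in L_p by summation by parts *)

Section Abel.
Variable R : realType.

Lemma ler_norm_ends (x y a b K C : R) : `|x - y - a + b| <= C -> `|a| <= K -> `|b| <= K ->
  `|x - y| <= C + 2 * K.
Proof. by rewrite !ler_norml; lra. Qed.

Lemma ler_dist4 (x y z u v A B C D : R) : `|x - y| <= A -> `|z - u| <= B -> `|y - u| <= C ->
  `|z - v| <= D -> `|x - v| <= A + B + C + D.
Proof. by rewrite !ler_norml; lra. Qed.

Lemma ler_norm_edge (a b c K : R) : `|a + b - c| <= K -> `|b| <= K -> `|a - c| <= 2 * K.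
Proof. by rewrite !ler_norml; lra. Qed.

Lemma ler_norm_step (x y A B : R) (k : R) : `|x| <= k * A + B -> `|x - y| <= A ->
  `|y| <= (k + 1) * A + B.
Proof. by rewrite !ler_norml; lra. Qed.

Lemma sum_ord_dist (f : nat -> R) Q a b : (forall j, (j < maxn a b)%N -> `|f j| <= Q) ->
  `|\sum_(j < a) f j - \sum_(j < b) f j| <= Q * `|a%:R - b%:R|.
Proof.
wlog ab : a b / (a <= b)%N.
  move=> h hf; have [ab|/ltnW ba] := leqP a b; first exact: h.
  by rewrite distrC (distrC a%:R); apply: h; rewrite // maxnC.
rewrite distrC (distrC a%:R) (maxn_idPr ab) => hf; rewrite -(subnKC ab) in hf *.
move: (b - a)%N hf => d hf; rewrite natrD addrAC subrr add0r (ger0_norm (ler0n _ _)) {ab}.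
elim: d hf => [|d IH] hf; first by rewrite addn0 subrr normr0 mulr0.
rewrite addnS big_ord_recr /= addrAC -natr1 mulrDr mulr1.
apply: (le_trans (ler_normD _ _)); apply: lerD; last by apply: hf; rewrite addnS.
by apply: IH => j hj; apply: hf; rewrite addnS ltnW.
Qed.

(** Summation by parts in [i]: since the partial sums of [D] in [i] are bounded by [Q], the row
    lengths [m i] enter through their total variation and last value. In [lev_step] this gives
    [O(Q N)], where the individual terms number [O(N^2)]. *)
Lemma abel_bound (D : nat -> nat -> R) (m : nat -> nat) Q n L :
  (forall l j, (l <= n)%N -> (j < L)%N -> `|\sum_(i < l) D i j| <= Q) ->
  (forall i, (i <= n)%N -> (m i <= L)%N) ->
  `|\sum_(i < n) \sum_(j < m i) D i j| <=
    Q * (\sum_(i < n) `|(m i)%:R - (m i.+1)%:R| + (m n)%:R).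
Proof.
move=> hD hm; pose S l j := \sum_(i < l) D i j.
have key l : (l <= n)%N -> `|\sum_(i < l) \sum_(j < m i) D i j - \sum_(j < m l) S l j| <=
    Q * \sum_(i < l) `|(m i)%:R - (m i.+1)%:R|.
  elim: l => [|l IH] hl.
    by rewrite !big_ord0 sub0r big1 ?oppr0 ?normr0 ?mulr0 // => j _; rewrite /S big_ord0.
  have {}IH := IH (ltnW hl).
  have e : `|\sum_(j < m l) S l.+1 j - \sum_(j < m l.+1) S l.+1 j| <= Q * `|(m l)%:R - (m l.+1)%:R|.
    apply: sum_ord_dist => j; rewrite leq_max => hj; apply: hD => //.
    by case/orP: hj => hj; apply: leq_trans hj _; apply: hm => //; exact: ltnW.
  have e' : \sum_(j < m l) S l.+1 j = \sum_(j < m l) S l j + \sum_(j < m l) D l j.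
    by rewrite -big_split; apply: eq_bigr => j _; rewrite /S big_ord_recr.
  rewrite [X in `|X - _|]big_ord_recr [X in _ <= _ * X]big_ord_recr /= mulrDr.
  move: IH e; rewrite e' !ler_norml; lra.
have e : `|\sum_(j < m n) S n j| <= Q * (m n)%:R.
  apply: le_trans (ler_norm_sum _ _ _) _.
  rewrite -[X in _ <= _ * X%:R]card_ord mulr_natr -sumr_const; apply: ler_sum => j _.
  by apply: hD => //; apply: leq_trans (ltn_ord j) _; exact: hm.
have := key n (leqnn n); move: e; rewrite mulrDr !ler_norml; lra.
Qed.

End Abel.

Section XCone.
Variables (R : realType) (p : nat) (s : R).
Hypothesis p4 : (4 <= p)%N.
Let q := p.-1.
Let p2 : (2 <= p)%N. Proof. by lia. Qed.
Let p0 : (0 < p)%N. Proof. by lia. Qed.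
Let pE : p.-1 = p.-2.+1. Proof. by lia. Qed.
Let p12 : (2 <= p.-1)%N. Proof. by lia. Qed.
Local Notation T := ('rV[R]_p * 'rV[R]_q)%type.
Variables (mu : T -> T -> R) (K c rho Q A : R) (N n T0 : nat) (r : R) (w : nat -> 'rV[R]_p) (x : R).
(** [a3] bounds the increments between levels apart from their top coordinate, which is at most
    [a3 N < T0]; [c3] bounds the steps of the intermediate paths [P'], and [c4] the variation of the
    integral parts [m] along a step. *)
Let a3 : R := (p ^ 2)%:R * A ^+ p.-1.
Let c3 : R := 3 * a3 + 1.
Let c4 : R := 1 + c3 ^+ p.-1.
Hypotheses (hmu : tame s mu K c rho) (A1 : 1 <= A) (N0 : (0 < N)%N) (nN : n%:R <= A * N%:R).
Hypotheses (c4c : c4 <= c) (T0N : a3 * N%:R + 1 <= T0%:R) (r0 : 0 <= r) (T0r : T0%:R <= r ^+ p.-1).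
Hypothesis rhoE : n%:R + a3 + r <= rho.
Hypothesis hQ : forall (u : nat -> 'rV[R]_p) l, (l <= n)%N ->
  (forall i, (i <= l)%N -> hball (n%:R + a3 + r) (u i)) ->
  (forall i, (i < l)%N -> hball c3 (hmul (hinv (u i)) (u i.+1))) ->
  `|psum mu (fun i => (u i, 0)) l - psum mu (fun i => ztr 1 (u i, 0)) l| <= Q.
Hypotheses (w0 : w 0%N = 0) (wn : w n = hz p x)
  (we : forall i, (i < n)%N -> hball 1 (hmul (hinv (w i)) (w i.+1))).

(** The top weight [p.-1] would require [N ^ p.-1] levels. With one power of [N] less, only the top
    coordinate of an increment is unbounded, of size [O(N)]; it is treated apart. *)
Let M := (N ^ p.-2)%N.
Let a (k : nat) : R := k%:R / M%:R.
Let W k i := hdil (a k) (w i).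
Let lev k := psum mu (fun i => (W k i, 0)) n.

Let a31 : 1 <= a3.
Proof.
rewrite /a3 -[leLHS]mulr1; apply: ler_pM => //; last exact: exprn_ege1.
by rewrite ler1n expn_gt0 (ltnW p2).
Qed.

Let c31 : 1 <= c3. Proof. by have := a31; rewrite /c3; lra. Qed.

Let c3c4 : c3 <= c4.
Proof.
rewrite /c4 pE.
have e := c31; have : c3 <= c3 ^+ p.-2.+1 by rewrite exprS ler_peMr ?exprn_ege1 //; lra.
lra.
Qed.

Let M0 : 0 < (M%:R : R). Proof. by rewrite ltr0n expn_gt0 N0. Qed.

Let a0 k : 0 <= a k. Proof. by rewrite divr_ge0. Qed.

Let a1 k : (k <= M)%N -> a k <= 1.
Proof. by move=> hk; rewrite ler_pdivrMr // mul1r ler_nat. Qed.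

Let B0 k t : 0 <= t -> hball t (0 : 'rV[R]_k). Proof. exact: hball0. Qed.

Let wB i : (i <= n)%N -> hball n%:R (w i).
Proof.
move=> hi; have w00 : pball 0 ((w 0%N, 0) : T) by rewrite w0; split; exact: B0.
have := pball_path (c := fun i => (w i, 0)) w00 _ hi => hp.
have [|hb _] := hp.
  by move=> j hj; rewrite /pmul /= hmulVx; split; [exact: we|exact: B0].
by apply: hball_leq hb _; rewrite ler_nat.
Qed.

Let WB k i : (k <= M)%N -> (i <= n)%N -> hball n%:R (W k i).
Proof. by move=> hk hi; apply: hball_dil1; [rewrite a0 a1|exact: wB]. Qed.

Let We k i : (k <= M)%N -> (i < n)%N -> hball 1 (hmul (hinv (W k i)) (W k i.+1)).
Proof.
by move=> hk hi; rewrite -hdilV -hdilM; apply: hball_dil1; [rewrite a0 a1|exact: we].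
Qed.

Let b k i := hmul (hinv (W k i)) (W k.+1 i).

Let bB k i j : (k < M)%N -> (i <= n)%N ->
  `|crd (b k i) j| <= a3 * (if j == p then N%:R else 1).
Proof.
move=> hk hi; have e3 := a31; have eA := A1; have N1 : (1 : R) <= N%:R by rewrite ler1n.
have [hj|hj] := leqP j p; last first.
  by rewrite crd_out ?hj ?orbT // normr0 mulr_ge0 //; [lra|case: ifP].
have ak : 0 <= a k <= a k.+1 by rewrite a0 ler_pM2r ?invr_gt0 // ler_nat leqnSn.
apply: (le_trans (hdil_increment j (wB hi) ak (a1 hk))).
rewrite (_ : a k.+1 - a k = M%:R^-1); last by rewrite /a -natr1 mulrDl mul1r addrC addKr.
rewrite -mulrA /a3 -mulrA; apply: ler_wpM2l => //.
rewrite mulrC ler_pdivrMr // /M natrX.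
have AN : n%:R ^+ hwt j <= (A * N%:R) ^+ hwt j.
  apply: lerXn2r nN; rewrite nnegrE //.
  by apply: mulr_ge0 => //; exact: le_trans A1.
apply: (le_trans AN); rewrite exprMn -mulrA; apply: ler_pM.
- by rewrite exprn_ge0 //; lra.
- by rewrite exprn_ge0.
- by apply: ler_weXn2l => //; exact: hwt_leq.
case: eqP => [->|/eqP jp].
  by rewrite hwtE // pE exprS.
rewrite mul1r; apply: ler_weXn2l => //.
by apply: hwt_leq => //; rewrite -ltnS (prednK p0) ltn_neqAle jp.
Qed.

(* Integral part of the top coordinate of the increment, shifted by T0 to remain
   nonnegative. *)
Let m k i := Num.truncn (crd (b k i) p + T0%:R).

Let topB k i : (k < M)%N -> (i <= n)%N -> 0 <= crd (b k i) p + T0%:R <= 2 * T0%:R.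
Proof. by move=> hk hi; have := bB p hk hi; rewrite eqxx ler_norml; move: T0N; lra. Qed.

Let mT k i : (k < M)%N -> (i <= n)%N -> (m k i <= 2 * T0)%N.
Proof.
move=> hk hi; have /andP[h0 h1] := topB hk hi.
by rewrite -(ler_nat R) natrM; apply: le_trans h1; rewrite /m truncn_le.
Qed.

(** The increment with its top coordinate reduced to a fractional part, which makes it bounded. *)
Let b' k i := b k i + hz p (T0%:R - (m k i)%:R).

Let b'B k i : (k < M)%N -> (i <= n)%N -> hball a3 (b' k i).
Proof.
move=> hk hi; apply: (hball_hwt a31) => j.
rewrite /b' crdD crd_hz; have [->|jp] := eqVneq j p; last first.
  by rewrite addr0; have := bB j hk hi; rewrite (negPf jp) mulr1.
rewrite p0 /=.
have /andP[h0 h1] := topB hk hi.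
have := truncn_itv h0; rewrite -/(m k i) -natr1 => /andP[h2 h3].
by have := a31; rewrite ler_norml; lra.
Qed.

Let P' k i := hmul (W k i) (b' k i).

Let P'E k i : P' k i = W k.+1 i + hz p (T0%:R - (m k i)%:R).
Proof. by rewrite /P' /b' /b hmulDz // hmulVKx. Qed.

Let P'e k i : (k < M)%N -> (i < n)%N -> hball c3 (hmul (hinv (P' k i)) (P' k i.+1)).
Proof.
move=> hk hi; have -> : hmul (hinv (P' k i)) (P' k i.+1) =
    hmul (hinv (b' k i)) (hmul (hmul (hinv (W k i)) (W k i.+1)) (b' k i.+1)).
  by rewrite /P' hinvM !hmulA.
rewrite (_ : c3 = 2 * a3 + (1 + a3)); last by rewrite /c3; ring.
apply: hballM; first by apply: hballV; apply: b'B => //; exact: ltnW.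
by apply: hballM; [apply: We => //; exact: ltnW|exact: b'B].
Qed.

Let P'B k i t : (k < M)%N -> (i <= n)%N -> `|t| <= T0%:R ->
  hball (n%:R + a3 + r) (P' k i + hz p t).
Proof.
move=> hk hi ht; rewrite -hmul_z //; apply: hballM; last first.
  by apply: hball_z => //; exact: le_trans T0r.
by apply: hballM; [apply: WB => //; exact: ltnW|exact: b'B].
Qed.

(** The steps of [P'] and of the next level are both bounded, and they differ by the central element
    [m k i - m k i.+1]. *)
Let dm k i : (k < M)%N -> (i < n)%N -> `|(m k i)%:R - (m k i.+1)%:R| <= c4.
Proof.
move=> hk hi; have e1 := We hk hi; have e2 := P'e hk hi.
have hdiff : hmul (hinv (P' k i)) (P' k i.+1) =
    hmul (hinv (W k.+1 i)) (W k.+1 i.+1) + hz p ((m k i)%:R - (m k i.+1)%:R).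
  rewrite !P'E hinvDz // hDzmul // hmulDz // -addrA hzD; congr (_ + hz p _); ring.
have := e2 p; rewrite hdiff crdD hz_top // hwtE //.
by have := e1 p; rewrite expr1n /c4 !ler_norml; lra.
Qed.

Let K0 : 0 <= K.
Proof.
have h0 := hball_ge0 (wB (leq0n n)); have e3 := a31.
apply: (le_trans _ (tame_line hmu (P := (0, 0)) (t := 0) _ _)) => //.
  by split; apply: B0; have := r0; have := rhoE; lra.
by rewrite normr0; have := c31; have := c3c4; have := c4c; lra.
Qed.

(** The path [P'] is one ladder away from level [k], and level [k.+1] differs from [P'] by central
    shifts that depend on [i]. Both are compared with [U 0], the common translate of [P'] by [- T0]:
    vertex [i] of [P'] is [U T0 i] and that of level [k.+1] is [U (m k i) i]. The partial sums
    needed by [abel_bound] are the shifts by one unit controlled by [hQ]. *)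
Let lev_step k : (k < M)%N ->
  `|lev k - lev k.+1| <= 4 * K * n%:R + 2 * K + Q * (c4 * n%:R + 3 * T0%:R).
Proof.
move=> hk; have e3 := a31; have e31 := c31; have e34 := c3c4; have ec := c4c; have er := rhoE.
have k0 := K0; have eR : (0 : R) <= n%:R by [].
pose U j i : T := (P' k i + hz p (j%:R - T0%:R), 0).
have UW i : (W k.+1 i, 0) = U (m k i) i.
  by rewrite /U P'E -addrA hzD addrA subrK subrr hz0 addr0.
have UP i : (P' k i, 0) = U T0 i by rewrite /U subrr hz0 addr0.
have UB j i : (j <= 2 * T0)%N -> (i <= n)%N -> hball (n%:R + a3 + r) (U j i).1.
  move=> hj hi; apply: P'B => //.
  have : (j%:R : R) <= 2 * T0%:R by rewrite -natrM ler_nat.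
  by have : (0 : R) <= j%:R by []; rewrite ler_norml; lra.
have Ue j i : (i < n)%N -> hmul (hinv (U j i).1) (U j i.+1).1 = hmul (hinv (P' k i)) (P' k i.+1).
  by move=> hi; rewrite /U /= hinvDz // hDzmul // hmulDz // -addrA hzD subrr hz0 addr0.
have stepA : `|lev k - psum mu (U T0) n| <= 2 * K * n%:R + 2 * K.
  have e : `|lev k - psum mu (U T0) n - mu (W k 0%N, 0) (U T0 0%N) + mu (W k n, 0) (U T0 n)|
      <= 2 * K * n%:R.
    apply: (tame_ladder (d := fun i => (W k i, 0)) hmu) => i hi; rewrite -?UP.
    - split; last by apply: B0; have := r0; lra.
      by apply: (@hball_leq _ _ n%:R); [apply: WB; exact: ltnW|have := r0; lra].
    - rewrite /pmul /= hmulVx; split; last by apply: B0; lra.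
      by rewrite /P' hmulKx; apply: hball_leq (b'B hk hi) _; rewrite /c3 in e34; lra.
    - rewrite /pmul /= hmulVx; split; last by apply: B0; lra.
      by apply: (@hball_leq _ _ 1); [apply: We => //; exact: ltnW|lra].
    rewrite /pmul /= hmulVx; split; last by apply: B0; lra.
    by apply: hball_leq (P'e hk hi) _; lra.
  (* The end vertices lie in the centre, so the end rungs of the ladder are central segments, short
     by the choice of [b']. *)
  have central i y : (i <= n)%N -> w i = hz p y -> `|mu (W k i, 0) (U T0 i)| <= K.
    move=> hi wy; rewrite -UP.
    have bz : b' k i = hz p (crd (b' k i) p).
      rewrite /b' /b /W wy !hdil_z // hinv_z // hmul_z // !hzD !hz_top //.
    have -> : (P' k i, 0) = ztr (crd (b' k i) p) (W k i, 0) :> T.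
      by rewrite /P' {1}bz hmul_z.
    apply: (tame_line hmu).
      split; last by apply: B0; have := r0; lra.
      by apply: (@hball_leq _ _ n%:R); [apply: WB => //; exact: ltnW|have := r0; lra].
    have /andP[h0 h1] := topB hk hi.
    have := truncn_itv h0; rewrite -/(m k i) -natr1 => /andP[h2 h3].
    by rewrite /b' crdD hz_top // ler_norml; lra.
  have e0 := central 0%N 0 isT (etrans w0 (esym (hz0 R p))).
  have en := central n x (leqnn n) wn.
  exact: ler_norm_ends e e0 en.
pose D i j := mu (U j.+1 i) (U j.+1 i.+1) - mu (U j i) (U j i.+1).
have partial l j : (l <= n)%N -> (j < 2 * T0)%N ->
    `|\sum_(i < l) D i j| <= Q.
  move=> hl hj; have := hQ (u := fun i => (U j i).1) hl.
  rewrite distrC /psum -sumrB => h; apply: le_trans (h _ _).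
  - rewrite le_eqVlt; apply/orP; left; apply/eqP; congr `|_|; apply: eq_bigr => i _.
    have US i' : U j.+1 i' = ztr 1 ((U j i').1, 0).
      by rewrite /U /ztr /= -addrA hzD -natr1; congr (_ + hz p _, _); ring.
    by rewrite /D !US.
  - by move=> i hi; apply: UB; [exact: ltnW|exact: leq_trans hl].
  move=> i hi; rewrite Ue; last exact: leq_trans hl.
  by apply: P'e => //; exact: leq_trans hl.
have tel i L : \sum_(j < L) D i j =
    mu (U L i) (U L i.+1) - mu (U 0%N i) (U 0%N i.+1).
  by rewrite -(telescope_sumr (fun j => mu (U j i) (U j i.+1)) (leq0n L)) big_mkord.
have stepB1 : `|\sum_(i < n) mu (U (m k i) i) (U (m k i) i.+1) - psum mu (U 0%N) n| <=
    Q * (c4 * n%:R + 2 * T0%:R).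
  have := abel_bound (D := D) (m := m k) partial (fun i hi => mT hk hi).
  under eq_bigr do rewrite tel.
  rewrite sumrB => h; apply: (le_trans h).
  have T00 : (0 < 2 * T0)%N.
    rewrite muln_gt0 /= -(ltr_nat R); apply: lt_le_trans T0N; rewrite ltr_wpDl // mulr_ge0 //.
    exact: le_trans e3.
  have Q0 : 0 <= Q := le_trans (normr_ge0 _) (partial 0%N 0%N isT T00).
  apply: ler_wpM2l => //; apply: lerD.
    by rewrite -[X in _ <= _ * X%:R]card_ord mulr_natr -sumr_const; apply: ler_sum => i _; exact: dm.
  by rewrite -natrM ler_nat; exact: mT.
have stepB2 : `|psum mu (U T0) n - psum mu (U 0%N) n| <= Q * T0%:R.
  have T02 : (T0 <= 2 * T0)%N by rewrite leq_pmull.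
  have := abel_bound (D := D) (m := fun=> T0) partial (fun i hi => T02).
  under eq_bigr do rewrite tel.
  rewrite sumrB [X in _ <= _ * (X + _)]big1 ?add0r // => i _.
  by rewrite subrr normr0.
(* The previous sums use the shift [m k i] at both ends of step [i], whereas level [k.+1] has
   [m k i.+1] at the second; [dm] makes the correction a short central segment. *)
have stepC : `|\sum_(i < n) mu (U (m k i) i) (U (m k i) i.+1) - lev k.+1| <= 2 * K * n%:R.
  rewrite /lev /psum -sumrB; apply: le_trans (ler_norm_sum _ _ _) _.
  rewrite -[X in _ <= _ * X%:R]card_ord mulr_natr -sumr_const; apply: ler_sum => i _.
  have hi := ltn_ord i.
  rewrite !UW; set t : R := (m k i.+1)%:R - (m k i)%:R.
  have tc : `|t| <= c by rewrite /t distrC; apply: (le_trans (dm hk hi)).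
  have Ut : U (m k i.+1) i.+1 = ztr t (U (m k i) i.+1).
    by rewrite /U /ztr /= -addrA hzD /t; congr (_ + hz p _, _); ring.
  have UBm j' : (j' <= n)%N -> pball rho (U (m k i) j').
    move=> hj'; split; last by apply: B0; have := r0; lra.
    by apply: hball_leq er; apply: UB => //; apply: mT => //; exact: ltnW.
  have tri : `|mu (U (m k i) i) (U (m k i) i.+1) + mu (U (m k i) i.+1) (U (m k i.+1) i.+1)
      - mu (U (m k i) i) (U (m k i.+1) i.+1)| <= K.
    apply: (tame_triangle hmu); first by apply: UBm; exact: ltnW.
      rewrite /pmul Ue // /= hmulVx; split; last by apply: B0; lra.
      by apply: hball_leq (P'e hk hi) _; lra.
    by rewrite Ut pairinv_zstep //; apply: pball_zstep => //; lra.
  have line : `|mu (U (m k i) i.+1) (U (m k i.+1) i.+1)| <= K.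
    by rewrite Ut; apply: (tame_line hmu) => //; exact: UBm.
  exact: le_trans (ler_norm_edge tri line) _.
apply: (le_trans (ler_dist4 stepA stepB1 stepB2 stepC)).
rewrite le_eqVlt; apply/orP; left; apply/eqP; ring.
Qed.

Lemma xcone : `|psum mu (fun i => (w i, 0)) n| <=
  (N ^ p.-2)%:R * (4 * K * n%:R + 2 * K + Q * (c4 * n%:R + 3 * T0%:R)) + K * n%:R.
Proof.
have k0 := K0; have e31 := c31; have e34 := c3c4; have ec := c4c; have e3 := a31; have er := rhoE.
have rr := r0; have n0 : (0 : R) <= n%:R by [].
have lev0 : `|lev 0%N| <= K * n%:R.
  rewrite /lev /psum; apply: le_trans (ler_norm_sum _ _ _) _.
  rewrite -[X in _ <= _ * X%:R]card_ord mulr_natr -sumr_const; apply: ler_sum => i _.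
  rewrite /W /a mul0r !hdil0 -{2}(ztr0 ((0, 0) : T)); apply: (tame_line hmu).
    by split; apply: B0; lra.
  by rewrite normr0; lra.
have levk k : (k <= M)%N -> `|lev k| <=
    k%:R * (4 * K * n%:R + 2 * K + Q * (c4 * n%:R + 3 * T0%:R)) + K * n%:R.
  elim: k => [|k IH] hk; first by rewrite mul0r add0r.
  by rewrite -natr1; apply: ler_norm_step (IH (ltnW hk)) (lev_step hk).
have := levk M (leqnn M); rewrite /lev /W /a mulfV ?gt_eqF //.
by rewrite (_ : psum mu (fun i => (hdil 1 (w i), 0)) n = psum mu (fun i => (w i, 0)) n) //
  /psum; apply: eq_bigr => i _; rewrite !hdil1.
Qed.

End XCone.

Section UnitWords.
Variables (R : realType) (m : nat).
Hypothesis m2 : (2 <= m)%N.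

Lemma hor_add b (x y : R) : hmul (hor m (b, x)) (hor m (b, y)) = hor m (b, x + y).
Proof.
apply: (can_inj (@hlogK R m)); rewrite (hlog_bch (ltnW m2)) /hor /=.
have E (t : R) : hlog (t *: xb R m (if b then 1 else 2)%N) = t *: xb R m (if b then 1 else 2)%N.
  by rewrite hlog_basis //; case: b.
by rewrite !E; exact: (gmul_line (filiform_polynomial R (ltnW m2)) x y).
Qed.

Lemma hword_nseq k b (x : R) : hword m (nseq k (b, x)) = hor m (b, k%:R * x).
Proof.
elim: k => [|k IH] /=; first by rewrite /hor mul0r scale0r.
by rewrite IH hor_add -natr1 mulrDl mul1r addrC.
Qed.

(** The word for [u] has boundedly many bounded letters; dilated by [l], each is cut into [k l]
    equal letters of size at most 1. *)
Lemma unit_words : exists A : nat, forall (u : 'rV[R]_m) (l : nat), hball 1 u -> (0 < l)%N ->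
  exists t, [/\ (size t <= A * l)%N, forall x, x \in t -> `|x.2| <= 1 & hword m t = hdil l%:R u].
Proof.
have [n [C [C0 hC]]] := @horizontal_words R m m2.
pose k := (Num.truncn C).+1; have Ck : C <= k%:R by apply/ltW; exact: truncnS_gt.
exists (n * k)%N => u l /hC[s [sn sC <-]] l0.
have kl0 : 0 < (k * l)%:R :> R by rewrite ltr0n muln_gt0.
exists (flatten [seq nseq (k * l) (x.1, l%:R * x.2 / (k * l)%:R) | x <- s]); split.
- have -> : size (flatten [seq nseq (k * l) (x.1, l%:R * x.2 / (k * l)%:R) | x <- s]) = (size s * (k * l))%N.
    by elim: s {sn sC} => // x s IH; rewrite /= size_cat size_nseq IH mulSn.
  by rewrite -mulnA leq_mul2r sn orbT.
- move=> x /flatten_mapP[y ys] /nseqP[-> _] /=.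
  rewrite normrM normfV normrM !(ger0_norm (ler0n _ _)) ler_pdivrMr // mul1r natrM mulrC.
  by apply: ler_wpM2r => //; exact: le_trans (sC y ys) Ck.
rewrite hdil_word; elim: s {sn sC} => // -[b a] s IH; rewrite /= hword_cat IH hword_nseq.
by congr (hmul (hor m (b, _)) _); rewrite /= mulrC divfK // gt_eqF.
Qed.

Lemma hword_path (t : seq (bool * R)) : (forall x, x \in t -> `|x.2| <= 1) ->
  forall i, (i < size t)%N ->
  hmul (hinv (hword m (take i t))) (hword m (take i.+1 t)) = hor m (nth (true, 0) t i) /\
  hball 1 (hor m (nth (true, 0) t i)).
Proof.
move=> ht i hi; split.
  by rewrite (take_nth (true, 0) hi) -cats1 hword_cat hmulKx /= hmulx0.
have := ht _ (mem_nth (true, 0) hi); case: (nth _ _ _) => b a /= ha.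
apply: hball_hwt => // k; rewrite crdZ crd_xb normrM /= -[leRHS]mulr1; apply: ler_pM => //.
by case: (_ && _); rewrite ?normr1 ?normr0.
Qed.

End UnitWords.

(** * Normalisation along the centre *)

Section Gauge.
Variables (R : realType) (p : nat) (s : R).
Hypothesis p4 : (4 <= p)%N.
Let q := p.-1.
Let p2 : (2 <= p)%N. Proof. by lia. Qed.
Let q2 : (2 <= q)%N. Proof. by rewrite /q; lia. Qed.
Let pE : p.-1 = p.-2.+1. Proof. by lia. Qed.
Local Notation T := ('rV[R]_p * 'rV[R]_q)%type.
Implicit Types P Q : T.
Variables (lam : T -> T -> R) (K c rho rho' cc : R).
Hypothesis lamk : forall t P Q, lam (kappa s t P) Q = lam P Q /\ lam P (kappa s t Q) = lam P Q.
Hypothesis lamc : forall P h h', pball rho P -> pball c h -> pball c h' ->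
  `|lam P (pmul P h) + lam (pmul P h) (pmul P (pmul h h')) - lam P (pmul P (pmul h h'))| <= K.
Hypotheses (s1 : 1 <= s) (cc1 : 1 <= cc) (ccc : cc + 2 <= c) (rho1 : 1 <= rho')
  (rhoE : (6 + 3 * cc) * rho' <= rho).

(** The central height of [P], which is invariant under the kernel. Adding [H] makes it at least
    [cc] on the ball of radius [rho'], so that heights remain nonnegative after a shift by at most
    [cc]. *)
Let tau P := crd P.1 p + crd P.2 q / s.
Let H := 2 * rho' ^+ p.-1 + cc.
Let base P := ztr (- (tau P + H)) P.
Let L P (x y : R) := lam (ztr x (base P)) (ztr y (base P)).
Let level P := Num.truncn (tau P + H).
Let column P n := \sum_(i < n) L P i%:R i.+1%:R.

(* The sum of lam along the central segment that ends at P and whose starting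
   point depends only on the central coset of P. *)
Definition potential P := column P (level P) + L P (level P)%:R (tau P + H).

Let tau_ztr t P : tau (ztr t P) = tau P + t.
Proof. by rewrite /tau /= crdD hz_top // addrAC. Qed.

Let tau_kappa t P : tau (kappa s t P) = tau P.
Proof.
rewrite /tau /= !crdD !hz_top //; have : s != 0 by rewrite gt_eqF //; have := s1; lra.
by move=> s0; field.
Qed.

Let potential_kappa t P : potential (kappa s t P) = potential P.
Proof.
have LE x y : L (kappa s t P) x y = L P x y.
  by rewrite /L /base tau_kappa !ztr_kappa (lamk _ _ _).1 (lamk _ _ _).2.
rewrite /potential /level /column tau_kappa LE; congr (_ + _).
by apply: eq_bigr => i _; exact: LE.
Qed.

Let rpow : 1 <= rho' ^+ p.-1. Proof. exact: exprn_ege1. Qed.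

Let tau_bound P : pball rho' P -> cc <= tau P + H <= 4 * rho' ^+ p.-1 + cc.
Proof.
move=> [h1 h2]; have e1 : `|crd P.1 p| <= rho' ^+ p.-1 by have := h1 p; rewrite hwtE.
have e2 : `|crd P.2 q / s| <= rho' ^+ p.-1.
  have e3 : `|crd P.2 q| <= rho' ^+ q.-1 by have := h2 q; rewrite hwtE.
  apply: (@le_trans _ _ (rho' ^+ q.-1)).
    rewrite normrM -[leRHS]mulr1; apply: ler_pM => //.
    by have e := s1; rewrite ger0_norm ?invr_ge0 ?invf_le1 //; lra.
  by apply: ler_weXn2l => //; rewrite /q; exact: leq_pred.
by move: e1 e2; rewrite /tau /H !ler_norml; lra.
Qed.

Let zball P x y : pball rho' P -> 0 <= y <= tau P + H + cc + 1 -> x = y ->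
  pball rho (ztr x (base P)).
Proof.
move=> hP hy ->; rewrite /base ztrD; have e := tau_bound hP.
have er := rpow; have e1 := rho1; have ec := cc1.
apply: (@pball_leq _ _ _ (rho' + (5 + 3 * cc) * rho')); last by have := rhoE; lra.
apply: pball_ztr => //; first by rewrite mulr_ge0 //; lra.
have c5 : 5 + 3 * cc <= (5 + 3 * cc) ^+ p.-1.
  by rewrite pE exprS ler_peMr ?exprn_ege1 //; lra.
rewrite exprMn; have : (5 + 3 * cc) * rho' ^+ p.-1 <= (5 + 3 * cc) ^+ p.-1 * rho' ^+ p.-1.
  by apply: ler_wpM2r => //; lra.
apply: le_trans; have : cc <= cc * rho' ^+ p.-1 by rewrite ler_peMr //; lra.
by rewrite ler_norml; lra.
Qed.

Let triangle P x y z : pball rho' P -> 0 <= x <= tau P + H + cc + 1 ->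
  `|y - x| <= c -> `|z - y| <= c -> `|L P x y + L P y z - L P x z| <= K.
Proof.
move=> hP hx hy hz'; have ec : 1 <= c by have := cc1; have := ccc; lra.
have step a b : pmul (ztr a (base P)) (hz p (b - a), 0) = ztr b (base P).
  rewrite /pmul /= hmul_z // hmulx0 -addrA hzD /ztr; congr (_ + hz p _, _).
  by rewrite addrC subrK.
have := @lamc (ztr x (base P)) (hz p (y - x), 0) (hz p (z - y), 0) (zball hP hx erefl).
rewrite pmulA !step; apply; exact: pball_zstep.
Qed.

Let Ldiag P x : pball rho' P -> 0 <= x <= tau P + H + cc + 1 -> `|L P x x| <= K.
Proof.
move=> hP hx; have ec : 0 <= c by have := cc1; have := ccc; lra.
by have := @triangle P x x x hP hx; rewrite subrr normr0 addrK; apply.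
Qed.

(** A chord of the central segment is compared with its unit steps by one triangle per step. The
    chord may be as long as [cc + 2], whence the margin between [cc] and [c]. *)
Let column_close P n d : pball rho' P -> (n + d)%:R <= tau P + H + cc + 1 -> d%:R <= cc + 2 ->
  `|L P n%:R (n + d)%:R - (column P (n + d) - column P n)| <= K * (d%:R + 1).
Proof.
move=> hP; have ec := ccc; have ec1 := cc1.
elim: d => [|d IH] h1 h2.
  by rewrite addn0 subrr subr0 add0r mulr1; apply: Ldiag; rewrite // ler0n /= -[n]addn0.
have h1' : (n + d)%:R <= tau P + H + cc + 1 by move: h1; rewrite addnS -natr1; lra.
have h2' : d%:R <= cc + 2 by apply: le_trans h2; rewrite ler_nat.
have {}IH := IH h1' h2'; rewrite -[d.+1%:R]natr1.
have n0 : 0 <= (n%:R : R) <= tau P + H + cc + 1.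
  by rewrite ler0n /=; apply: le_trans h1'; rewrite ler_nat leq_addr.
have t := @triangle P n%:R (n + d)%:R (n + d).+1%:R hP n0.
have {}t : `|L P n%:R (n + d)%:R + L P (n + d)%:R (n + d).+1%:R - L P n%:R (n + d).+1%:R| <= K.
  apply: t; first by rewrite natrD addrAC subrr add0r ger0_norm //; lra.
  by rewrite -natr1 addrAC subrr add0r normr1; lra.
have cS : column P (n + d).+1 = column P (n + d) + L P (n + d)%:R (n + d).+1%:R.
  by rewrite /column big_ord_recr.
rewrite addnS cS; move: IH t.
rewrite mulrDr mulr1 !ler_norml; lra.
Qed.

(** Adding the coboundary of a function preserves the sums over triangles. Here [P] and [ztr t P]
    have the same [base], so their potentials differ by the sum of [lam] over the central segment
    between them, up to boundedly many triangles; this cancels [lam P (ztr t P)]. *)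
Lemma tame_gauge : (forall t P, potential (kappa s t P) = potential P) /\
  tame s (fun P Q => lam P Q + potential P - potential Q) ((cc + 9) * K) cc rho'.
Proof.
have er := rpow; have e1 := rho1; have ec := cc1; have ecc := ccc; have erE := rhoE.
have K0 P : pball rho' P -> 0 <= K.
  move=> hP; have t := tau_bound hP; apply: le_trans (Ldiag (x := 0) hP _) => //.
  by rewrite lexx /=; lra.
split; first exact: potential_kappa.
split=> [t P Q|P h h' hP hh hh'|P t hP ht].
- by rewrite !potential_kappa (lamk _ _ _).1 (lamk _ _ _).2.
- have k0 := K0 P hP.
  have := lamc (pball_leq hP (_ : rho' <= rho)) (pball_leq hh (_ : cc <= c)) (pball_leq hh' (_ : cc <= c)).
  have rr : rho' <= rho by apply: le_trans erE; rewrite ler_peMl; lra.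
  have cr : cc <= c by lra.
  move=> /(_ rr cr cr); have : K <= (cc + 9) * K by rewrite ler_peMl //; lra.
  move: (potential _) (potential _) (potential _) => a b d; rewrite !ler_norml; lra.
have k0 := K0 P hP; have tb := tau_bound hP.
set x := tau P + H; pose y := x + t; pose n := level P; pose m := Num.truncn y.
have base_t : base (ztr t P) = base P.
  by rewrite /base tau_ztr ztrD; congr (ztr _ _); ring.
have LE a b : L (ztr t P) a b = L P a b by rewrite /L base_t.
have poE : potential P = column P n + L P n%:R x by [].
have qE : potential (ztr t P) = column P m + L P m%:R y.
  rewrite /potential LE /level tau_ztr addrAC -/x -/y -/m; congr (_ + _).
  by apply: eq_bigr => i _; exact: LE.
have lE : lam P (ztr t P) = L P x y.
  by rewrite /L /base !ztrD /x /y /x addNr ztr0; congr (lam _ (ztr _ _)); ring.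
have x0 : 0 <= x by rewrite /x; lra.
have y0 : 0 <= y by move: ht; rewrite /y /x ler_norml; lra.
have := truncn_itv x0; rewrite -/(level P) -/n -natr1 => /andP[nx xn].
have := truncn_itv y0; rewrite -/m -natr1 => /andP[my ym].
have tt : - cc <= t <= cc by rewrite -ler_norml.
have n0 : (0 : R) <= n%:R by []; have m0 : (0 : R) <= m%:R by [].
have nr : 0 <= (n%:R : R) <= x + cc + 1 by rewrite n0 /=; lra.
have mr : 0 <= (m%:R : R) <= x + cc + 1 by rewrite m0 /=; move: my; rewrite /y; lra.
have t1 : `|L P n%:R x + L P x y - L P n%:R y| <= K.
  by apply: (triangle hP nr); rewrite /y ler_norml; lra.
have t2 : `|L P n%:R m%:R + L P m%:R y - L P n%:R y| <= K.
  by apply: (triangle hP nr); rewrite ler_norml; move: my ym; rewrite /y; lra.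
have t3 : `|L P n%:R m%:R - (column P m - column P n)| <= (cc + 5) * K.
  have Kd (d : nat) : (d%:R : R) <= cc + 1 -> K * (d%:R + 1) <= (cc + 2) * K.
    by move=> hd; rewrite mulrC; apply: ler_wpM2r => //; lra.
  have [nm|/ltnW mn] := leqP n m.
    have dE : (m - n)%:R <= cc + 1 :> R by rewrite natrB //; move: my; rewrite /y; lra.
    have := @column_close P n (m - n) hP; rewrite subnKC // => h.
    have {}h := h (andP mr).2 (le_trans dE _); have := Kd _ dE.
    by move=> e; have {}h : `|L P n%:R m%:R - (column P m - column P n)| <= K * ((m - n)%:R + 1);
      [apply: h; lra|move: h; rewrite !ler_norml; lra].
  have dE : (n - m)%:R <= cc + 1 :> R by rewrite natrB //; move: ym; rewrite /y; lra.
  have := @column_close P m (n - m) hP; rewrite subnKC // => h.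
  have {}h := h (andP nr).2 (le_trans dE _); have e := Kd _ dE.
  have {}h : `|L P m%:R n%:R - (column P n - column P m)| <= K * ((n - m)%:R + 1) by apply: h; lra.
  have d1 := Ldiag hP nr.
  have d2 : `|L P n%:R m%:R + L P m%:R n%:R - L P n%:R n%:R| <= K.
    by apply: (triangle hP nr); rewrite ?(distrC n%:R) ler_norml; move: dE; rewrite natrB //; move: my ym; rewrite /y; lra.
  by move: h d1 d2; rewrite !ler_norml; lra.
rewrite lE poE qE; move: t1 t2 t3; rewrite !ler_norml; lra.
Qed.

End Gauge.

Lemma fill_arith (R : realType) (A CQ c4 a n N M J S : R) :
  1 <= A -> 0 <= CQ -> 0 <= c4 -> 0 <= a -> 0 <= n -> n <= A * N -> 1 <= N -> N <= M ->
  0 <= J -> J <= N -> 1 <= S ->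
  (1 + 2 * n) * n + (M * (2 * n + 2) + n) + J * (2 * n + 2)
    + (M * (4 * n + 2 + CQ * S * (c4 * n + 3 * (a * N))) + n) <=
  (3 * A ^+ 2 + 10 * A + 6 + CQ * (c4 * A + 3 * a)) * (M * N * S).
Proof.
move=> A1 CQ0 c40 a0 n0 nAN N1 NM J0 JN S1.
have M0 : 0 <= M by lra.
have N0 : 0 <= N by lra.
have S0 : 0 <= S by lra.
have A0 : 0 <= A by lra.
have NN : N * N <= M * N by exact: ler_wpM2r.
have MN0 : 0 <= M * N by exact: mulr_ge0.
have MNS : M * N <= M * N * S by rewrite ler_peMr.
have N_NN : N <= N * N by rewrite ler_peMr.
have M_MN : M <= M * N by rewrite ler_peMr.
have nn : n * n <= A ^+ 2 * (M * N).
  apply: (@le_trans _ _ (A * N * (A * N))); first exact: ler_pM.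
  have -> : A * N * (A * N) = A ^+ 2 * (N * N) by ring.
  by apply: ler_wpM2l => //; exact: exprn_ge0.
have AA : A <= A ^+ 2 by rewrite expr2 ler_peMr.
have n_MN : n <= A * (M * N).
  by apply: (le_trans nAN); apply: ler_wpM2l => //; lra.
have Mn : M * n <= A * (M * N).
  by rewrite mulrCA; apply: ler_wpM2l.
have Jn : J * n <= A * (M * N).
  apply: (@le_trans _ _ (N * (A * N))); first exact: ler_pM.
  by rewrite mulrCA; apply: ler_wpM2l.
have J_MN : J <= M * N by lra.
have last : M * (CQ * S * (c4 * n + 3 * (a * N))) <= CQ * (c4 * A + 3 * a) * (M * N * S).
  have -> : M * (CQ * S * (c4 * n + 3 * (a * N))) = CQ * S * (c4 * (M * n) + 3 * a * (M * N)) by ring.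
  have -> : CQ * (c4 * A + 3 * a) * (M * N * S) = CQ * S * (c4 * (A * (M * N)) + 3 * a * (M * N)) by ring.
  apply: ler_wpM2l; first exact: mulr_ge0.
  by rewrite lerD2r; apply: ler_wpM2l.
have X1 : (3 * A ^+ 2 + 10 * A + 6) * (M * N) <= (3 * A ^+ 2 + 10 * A + 6) * (M * N * S).
  by apply: ler_wpM2l => //; have := exprn_ge0 2 A0; lra.
have nA : n <= A ^+ 2 * (M * N) by apply: (le_trans n_MN); exact: ler_wpM2r.
rewrite [leRHS]mulrDl; apply: le_trans (lerD X1 last).
have -> : (1 + 2 * n) * n + (M * (2 * n + 2) + n) + J * (2 * n + 2)
    + (M * (4 * n + 2 + CQ * S * (c4 * n + 3 * (a * N))) + n) =
  2 * (n * n) + n + 2 * n + 6 * (M * n) + 4 * M + 2 * (J * n) + 2 * J +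
    M * (CQ * S * (c4 * n + 3 * (a * N))) by ring.
rewrite lerD2r.
have -> : (3 * A ^+ 2 + 10 * A + 6) * (M * N) = 3 * (A ^+ 2 * (M * N)) + 10 * (A * (M * N)) + 6 * (M * N) by ring.
lra.
Qed.

Lemma strip_arith (R : realType) (A W l n N nw : R) :
  1 <= A -> 1 <= W -> 0 <= n -> n <= A * N -> 1 <= N -> 1 <= l -> 0 <= nw -> nw <= W * l ->
  2 * n * nw + 2 * (N * (2 * nw + 2) + nw) <= (2 * A * W + 6 * W + 4) * (N * l).
Proof.
move=> A1 W1 n0 nAN N1 l1 nw0 nwl.
have e1 : n * nw <= A * W * (N * l).
  have -> : A * W * (N * l) = A * N * (W * l) by ring.
  exact: ler_pM.
have e2 : N * nw <= W * (N * l) by rewrite mulrCA; apply: ler_wpM2l => //; lra.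
have e3 : nw <= N * nw by rewrite ler_peMl.
have e4 : N <= N * l by rewrite ler_peMr //; lra.
have -> : 2 * n * nw + 2 * (N * (2 * nw + 2) + nw) = 2 * (n * nw) + 4 * (N * nw) + 4 * N + 2 * nw by ring.
have -> : (2 * A * W + 6 * W + 4) * (N * l) = 2 * (A * W * (N * l)) + 6 * (W * (N * l)) + 4 * (N * l) by ring.
lra.
Qed.

Lemma fill_combine (R : realType) (X1 X2 X3 X4 Y1 Y2 Y3 Y4 : R) : `|X1 - X2 - X3| <= Y1 ->
  `|X3| <= Y2 -> `|X2 - X4| <= Y3 -> `|X4| <= Y4 -> `|X1| <= Y1 + Y2 + Y3 + Y4.
Proof. by rewrite !ler_norml; lra. Qed.

(** * The filling inequality *)

Section Filling.
Variables (R : realType) (p : nat) (A : R).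
Hypotheses (p4 : (4 <= p)%N) (A1 : 1 <= A).
Let q := p.-1.
Let p2 : (2 <= p)%N. Proof. by lia. Qed.
Let q2 : (2 <= q)%N. Proof. by rewrite /q; lia. Qed.
Let pE : p.-1 = p.-2.+1. Proof. by lia. Qed.
Let e4 : (2 * p - 4 = (2 * p - 5).+1)%N. Proof. by lia. Qed.
Let eq : (2 * q.-1 = 2 * p - 4)%N. Proof. by rewrite /q; lia. Qed.
Let q1 : (0 < q.-1)%N. Proof. by rewrite /q; lia. Qed.
Local Notation T := ('rV[R]_p * 'rV[R]_q)%type.

(* The word of [strip] has O(s^2) letters and its cone s^(2 (p-2)) = s J levels. *)
Lemma filling : exists C c B : R, [/\ 0 <= C, 1 <= c, 0 <= B &
  forall (s : nat) (lam : T -> T -> R) (K : R) (P : nat -> T) (n : nat) (m : R), (0 < s)%N ->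
  (forall t P Q, lam (kappa s%:R t P) Q = lam P Q /\ lam P (kappa s%:R t Q) = lam P Q) ->
  (forall P h h', pball (B * (s ^ (2 * p - 4))%:R) P -> pball c h -> pball c h' ->
    `|lam P (pmul P h) + lam (pmul P h) (pmul P (pmul h h')) - lam P (pmul P (pmul h h'))| <= K) ->
  n%:R <= A * (s ^ (2 * p - 4))%:R -> P 0%N = (0, 0) ->
  (forall i, (i < n)%N -> pball 1 (pmul (pairinv (P i)) (P i.+1))) ->
  P n = kappa s%:R m (0, 0) ->
  `|psum lam P n| <= C * K * ((s ^ (2 * p - 4)) ^ p.-1 * s ^ 3)%:R].
Proof.
have [W0 hW] := @unit_words R q q2.
pose W := W0.+1; have W1 : (1 : R) <= W%:R by rewrite ler1n.
pose a3 : R := (p ^ 2)%:R * A ^+ p.-1.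
have A0 : 0 <= A by exact: le_trans A1.
have a30 : 0 <= a3 by rewrite mulr_ge0 // exprn_ge0.
pose c3 := 3 * a3 + 1; have c30 : 0 <= c3 by rewrite /c3; lra.
pose c4 := 1 + c3 ^+ p.-1; have c40 : 0 <= c4 by rewrite addr_ge0 // exprn_ge0.
pose a := (Num.truncn a3).+2.
have aa3 : a3 + 1 <= a%:R by rewrite /a -natr1 lerD2r; apply/ltW; exact: truncnS_gt.
pose dA : R := (q ^ 2)%:R * A ^+ q.-1; have dA0 : 0 <= dA by rewrite mulr_ge0 // exprn_ge0.
pose dW : R := (q ^ 2)%:R * W%:R ^+ q.-1; have dW0 : 0 <= dW by rewrite mulr_ge0 // exprn_ge0.
pose cc := c4 + c3 + dA + dW + 1; have cc1 : 1 <= cc by rewrite /cc; lra.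
pose B1 : R := 2 * A + a3 + a%:R + W%:R + 2.
have B11 : 1 <= B1 by rewrite /B1; lra.
pose CQ : R := 2 * A * W%:R + 6 * W%:R + 4.
have CQ0 : 0 <= CQ by rewrite /CQ; have := mulr_ge0 A0 (ler0n R W); lra.
pose C0 := 3 * A ^+ 2 + 10 * A + 6 + CQ * (c4 * A + 3 * a%:R).
have C00 : 0 <= C0.
  have e1 := exprn_ge0 2 A0; have e2 := mulr_ge0 c40 A0.
  have e3 : 0 <= CQ * (c4 * A + 3 * a%:R) by apply: mulr_ge0 => //; have : (0 : R) <= a%:R by []; lra.
  by rewrite /C0; lra.
exists ((cc + 9) * C0), (cc + 2), ((6 + 3 * cc) * B1); split.
- by rewrite mulr_ge0 //; lra.
- lra.
- by rewrite mulr_ge0 //; lra.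
move=> s lam K P n m s0 lamk lamc hn P0 hP Pn.
set N := (s ^ (2 * p - 4))%N in lamc hn *.
pose l := (s ^ 2)%N; pose J := (s ^ (2 * p - 5))%N.
have NE : N = (s * J)%N by rewrite /N /J -expnS -e4.
have lq : (l ^ q.-1)%N = N by rewrite /l /N -expnM eq.
have Nl : (N * l)%N = (J * s ^ 3)%N by rewrite NE /l; ring.
have N0 : (0 < N)%N by rewrite expn_gt0 s0.
have J0 : (0 < J)%N by rewrite expn_gt0 s0.
have l0 : (0 < l)%N by rewrite expn_gt0 s0.
have lN : (l <= N)%N by rewrite -lq -[leqLHS]expn1; exact: leq_pexp2l.
have JN : (J <= N)%N by rewrite NE leq_pmull.
have s1 : (1 : R) <= s%:R by rewrite ler1n.
have N1 : (1 : R) <= N%:R by rewrite ler1n.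
have l1 : (1 : R) <= l%:R by rewrite ler1n.
have n0 : (0 : R) <= n%:R by [].
pose rho := B1 * N%:R.
have rhoA (x : R) : x <= B1 -> x * N%:R <= rho by move=> hx; apply: ler_wpM2r.
have rho1 : 1 <= rho by rewrite -[leLHS]mulr1; apply: ler_pM.
rewrite -mulrA -/rho in lamc.
have [phik hL0] := tame_gauge p4 lamk lamc s1 cc1 (lexx _) rho1 (lexx _).
pose phi := @potential R p s%:R lam rho cc.
pose L P Q := lam P Q + phi P - phi Q; pose K' := (cc + 9) * K.
have {hL0} hL : tame s%:R L K' cc rho := hL0.
have K0 : 0 <= K'.
  apply: (le_trans _ (tame_line hL (P := (0, 0)) (t := 0) _ _)) => //; last by rewrite normr0; lra.
  by split; apply: hball0; lra.
(* [P n] and [P 0] differ by the kernel, under which the potential is invariant, so the potentials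
   telescope to 0. *)
have -> : psum lam P n = psum L P n.
  have phi0 : phi (P n) = phi (P 0%N) by rewrite Pn P0; exact: phik.
  rewrite /psum /L; under [RHS]eq_bigr do rewrite -addrA.
  rewrite big_split /= -[LHS]addr0; congr (_ + _).
  have := telescope_sumr (fun i => phi (P i)) (leq0n n); rewrite big_mkord phi0 subrr => e.
  apply/esym; rewrite -[LHS]opprK -sumrN; under eq_bigr do rewrite opprB.
  by rewrite e oppr0.
have nrho : n%:R <= rho by apply: (le_trans hn); apply: rhoA; rewrite /B1; lra.
pose g i := (P i).1.
have g0 : g 0%N = 0 by rewrite /g P0.
have ge i : (i < n)%N -> hball 1 (hmul (hinv (g i)) (g i.+1)) by move=> /hP[].
have gn : g n = hz p m by rewrite /g Pn /= add0r.
have B0 k (t : R) : 0 <= t -> hball t (0 : 'rV[R]_k) by exact: hball0.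
have PB i : (i <= n)%N -> pball n%:R (P i).
  move=> hi; apply: pball_leq (pball_path _ hP hi) _; last by rewrite ler_nat.
  by rewrite P0; split; exact: B0.
have sep := separation p4 hL cc1 nrho P0 hP.
have ycon : `|psum L (fun i => ((P n).1, (P i).2)) n| <= K' * ((N ^ q.-1)%:R * (2 * n%:R + 2) + n%:R).
  have := @ycone R p s%:R p4 L K' cc rho (P n).1 (fun i => (P i).2) A N n (- (s%:R * m)) hL s1 A1 N0 hn.
  apply.
  - by rewrite -/dA /cc; lra.
  - exact: cc1.
  - apply: hball_leq (PB n (leqnn n)).1 _; rewrite lerBrDr.
    have := rhoA (2 * A); rewrite /B1 => h; have {}h := h (_ : _ <= _); lra.
  - by rewrite P0.
  - by move=> i /hP[].
  by rewrite Pn /= add0r.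
have rN : (J%:R : R) <= N%:R ^+ p.-1.
  apply: (@le_trans _ _ N%:R); first by rewrite ler_nat.
  by rewrite pE exprS ler_peMr ?exprn_ege1.
have N0' : (0 : R) <= N%:R by [].
have avg := @average_close R p s%:R p4 L K' cc rho (fun i => (g i, 0)) J n N%:R hL J0 N0' rN cc1 K0.
have {}avg : `|psum L (fun i => (g i, 0)) n - psum (average L J) (fun i => (g i, 0)) n| <= K' * J%:R * (2 * n%:R + 2).
  apply: avg => i hi.
    split; last by apply: B0; have := rhoA 1 B11; lra.
    apply: hball_leq (PB i hi).1 _; rewrite lerBrDr.
    have := rhoA (A + 1); rewrite /B1 => h; have {}h := h (_ : _ <= _); lra.
  rewrite /pmul /= hmulVx; split; last by apply: B0; lra.
  by apply: hball_leq cc1; exact: ge.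
pose r := a%:R * N%:R : R.
have r0 : 0 <= r by exact: mulr_ge0.
have mu_tame := @average_tame R p s%:R p4 L K' cc rho (rho - N%:R) N%:R J hL J0 N0' rN.
have {}mu_tame := mu_tame ltac:(lra).
have aN : a3 * N%:R + 1 <= (a * N)%:R.
  by rewrite natrM; have := ler_wpM2r N0' aa3; lra.
have aNr : (a * N)%:R <= r ^+ p.-1.
  rewrite natrM -/r pE exprS ler_peMr // exprn_ege1 // /r.
  by rewrite -[leLHS]mulr1; apply: ler_pM => //; rewrite ler1n.
have rE : n%:R + a3 + r <= rho - N%:R.
  rewrite lerBrDr; have e := rhoA (A + a3 + a%:R + 1).
  have {}e := e ltac:(rewrite /B1; lra).
  have : a3 <= a3 * N%:R by rewrite ler_peMr.
  by rewrite /r; lra.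
have c4cc : c4 <= cc by rewrite /cc; lra.
pose S3 : R := (s ^ 3)%:R.
have S31 : 1 <= S3 by rewrite ler1n expn_gt0 s0.
have hQ u k : (k <= n)%N -> (forall i, (i <= k)%N -> hball (n%:R + a3 + r) (u i)) ->
    (forall i, (i < k)%N -> hball c3 (hmul (hinv (u i)) (u i.+1))) ->
    `|psum (average L J) (fun i => (u i, 0)) k - psum (average L J) (fun i => ztr 1 (u i, 0)) k|
    <= K' * (CQ * S3).
  move=> hk hu he; rewrite average_shift normrM ger0_norm ?invr_ge0 // mulrC ler_pdivrMr ?ltr0n //.
  (* Dilation by [l] multiplies the centre of L_(p-1) by [l ^ q.-1 = s J], which the kernel
     identifies with [J] units of the centre of L_p. *)
  have z1 : hball 1 (hz q 1 : 'rV[R]_q) by apply: hball_z => //; rewrite normr1 expr1n.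
  have [t [tsz tu tE]] := hW (hz q 1) l z1 l0.
  have wlen : (size t)%:R <= W%:R * l%:R :> R.
    by rewrite -natrM ler_nat; apply: leq_trans tsz _; rewrite leq_mul2r leqnSn orbT.
  have st := @strip R p s%:R p4 L K' cc rho u (fun i => hword q (take i t)) W%:R l k (size t) J%:R
    hL s1 W1 l0 wlen.
  have {}st := st ltac:(rewrite -/dW /cc; lra) cc1.
  apply: (le_trans (st _ _ _ _ _)).
  - move=> i hi; apply: hball_leq (hu i hi) _; rewrite lerBrDr.
    have e := rhoA (A + a3 + a%:R + W%:R); have {}e := e ltac:(rewrite /B1; lra).
    have : a3 <= a3 * N%:R by rewrite ler_peMr.
    have : W%:R * l%:R <= W%:R * N%:R :> R by apply: ler_wpM2l => //; rewrite ler_nat.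
    by rewrite /r; lra.
  - by move=> i hi; apply: hball_leq (he i hi) _; rewrite /cc; lra.
  - by rewrite take0.
  - by move=> i hi; have [-> h] := hword_path q tu hi.
  - by rewrite take_size tE hdil_z // mulr1 -natrX lq NE natrM.
  rewrite lq -[leRHS]mulrA; apply: ler_wpM2l => //.
  have -> : CQ * S3 * J%:R = CQ * (N%:R * l%:R) by rewrite -natrM Nl natrM /S3; ring.
  apply: strip_arith => //; apply: le_trans hn; by rewrite ler_nat.
have xc := @xcone R p s%:R p4 (average L J) K' cc (rho - N%:R) (K' * (CQ * S3)) A N n (a * N) r g m
  mu_tame A1 N0 hn c4cc aN r0 aNr rE hQ g0 gn ge.
have M1 : (N%:R : R) <= (N ^ p.-2)%:R.
  by rewrite ler_nat -[leqLHS]expn1; exact: leq_pexp2l.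
have JN' : (J%:R : R) <= N%:R by rewrite ler_nat.
have := fill_arith A1 CQ0 c40 (ler0n R a) n0 hn N1 M1 (ler0n R J) JN' S31.
rewrite -/C0 => ar; have {ar} ar := ler_wpM2l K0 ar.
have -> : (cc + 9) * C0 * K * (N ^ p.-1 * s ^ 3)%:R = K' * (C0 * ((N ^ p.-2)%:R * N%:R * S3)).
  by rewrite natrM pE expnS natrM /K' /S3; ring.
apply: le_trans ar; apply: (le_trans (fill_combine sep ycon avg xc)).
rewrite natrM le_eqVlt; apply/orP; left; apply/eqP.
by rewrite -/a3 -/c3 -/c4 (_ : q.-1 = p.-2) //; ring.
Qed.

End Filling.

(** * The obstruction and the contradiction *)

Section Extension.
Variables (R : realType) (p : nat).
Hypothesis p2 : (2 <= p)%N.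
Implicit Types (u v g h : 'rV[R]_p) (w : 'rV[R]_p.+1).

Definition hlift u : 'rV[R]_p.+1 := \row_(i < p.+1) crd u i.+1.
Definition hproj w : 'rV[R]_p := \row_(i < p) crd w i.+1.

Lemma crd_hlift u k : crd (hlift u) k = crd u k.
Proof.
rewrite crd_row; case: ifP => // hk; rewrite crd_out //.
by case: k hk => // k; rewrite ltnS => /negbT; rewrite -ltnNge => /ltnW ->; rewrite orbT.
Qed.

Lemma crd_hproj w k : crd (hproj w) k = if (k <= p)%N then crd w k else 0.
Proof.
rewrite crd_row; case: k => [|k] //=; first by rewrite crd_out.
Qed.

Lemma hliftK u : hproj (hlift u) = u.
Proof.
apply: crdP => k; rewrite crd_hproj crd_hlift; case: ifP => // /negbT; rewrite -ltnNge => hk.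
by rewrite crd_out // hk orbT.
Qed.

Lemma hprojM w w' : hproj (hmul w w') = hmul (hproj w) (hproj w').
Proof.
apply: crd_eqP => [|k hk].
  by rewrite crd_hmul1 !crd_hproj (ltnW p2) crd_hmul1.
have /andP[k2 kp] := hk.
rewrite crd_hproj kp crd_hmul ?k2 ?(leqW kp) // crd_hmul // !crd_hproj kp (ltnW p2).
congr (_ + _); apply: eq_bigr => j _; rewrite crd_hproj ifT //.
exact: leq_trans (leq_subr _ _) kp.
Qed.

Lemma hproj0 : hproj 0 = 0.
Proof. by apply: crdP => k; rewrite crd_hproj !crd0 if_same. Qed.

Lemma hprojV w : hproj (hinv w) = hinv (hproj w).
Proof. by apply: hinv_uniq; rewrite -hprojM hmulxV hproj0. Qed.

Lemma hproj_z c : hproj (hz p.+1 c) = 0.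
Proof.
apply: crdP => k; rewrite crd_hproj crd0; case: ifP => // hk.
by rewrite crd_hz (ltn_eqF (hk : (k < p.+1)%N)).
Qed.

Lemma hlift_proj w : w = hlift (hproj w) + hz p.+1 (crd w p.+1).
Proof.
apply: crdP => k; rewrite crdD crd_hlift crd_hproj crd_hz.
have [kp|kp] := leqP k p; first by rewrite (ltn_eqF (kp : (k < p.+1)%N)) addr0.
have [->|hk] := eqVneq k p.+1; first by rewrite add0r.
by rewrite addr0 crd_out // [X in _ || X](_ : _ = true) ?orbT // ltn_neqAle eq_sym hk.
Qed.

Lemma hproj_hor x : hproj (hor p.+1 x) = hor p x :> 'rV[R]_p.
Proof.
apply: crdP => k; rewrite crd_hproj !crdZ !crd_xb.
case: (boolP (k <= p)%N) => hk; first by rewrite (leqW hk).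
by rewrite !andbF mulr0.
Qed.

Lemma hproj_word l : hproj (hword p.+1 l) = hword p l.
Proof. by elim: l => [|x l IH] /=; rewrite ?hproj0 // hprojM IH hproj_hor. Qed.

Lemma hball_lift t u : hball t u -> hball t (hlift u).
Proof. by move=> h k; rewrite crd_hlift. Qed.

(* The primitive of the area-type cocycle of the central extension
   H_(p+1) -> H_p given by the section hlift. *)
Definition lamL (g h : 'rV[R]_p) : R := crd (hmul (hinv (hlift g)) (hlift h)) p.+1.

Lemma lamLE g h : hmul (hinv (hlift g)) (hlift h) = hlift (hmul (hinv g) h) + hz p.+1 (lamL g h).
Proof. by rewrite [LHS]hlift_proj hprojM hprojV !hliftK. Qed.

(** The coboundary does not depend on [g]: up to sign it is the cocycle of the extension, of weight
    [p]. *)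
Lemma lamL_cocycle g h h' : lamL g (hmul g h) + lamL (hmul g h) (hmul g (hmul h h'))
    - lamL g (hmul g (hmul h h')) = - crd (hmul (hlift h) (hlift h')) p.+1.
Proof.
have p3 : (2 <= p.+1)%N by exact: ltnW.
set g1 := hmul g h; set g2 := hmul g _.
have e : hmul (hinv (hlift g)) (hlift g2) =
    hmul (hmul (hinv (hlift g)) (hlift g1)) (hmul (hinv (hlift g1)) (hlift g2)).
  by rewrite -hmulA hmulVKx.
have h2 : hmul (hinv g1) g2 = h' by rewrite /g1 /g2 (hmulA g h h') hmulKx.
have := congr1 (fun w => crd w p.+1) e; rewrite !lamLE hDzmul // hmulDz // h2 /g2 /g1 !hmulKx.
rewrite !crdD !hz_top // crd_hlift crd_out ?ltnSn ?orbT // add0r => ->; ring.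
Qed.

Lemma lamL_bound D g h h' : hball D h -> hball D h' ->
  `|lamL g (hmul g h) + lamL (hmul g h) (hmul g (hmul h h')) - lamL g (hmul g (hmul h h'))|
    <= (2 * D) ^+ p.
Proof.
move=> hh hh'; rewrite lamL_cocycle normrN.
have := hballM (hball_lift hh) (hball_lift hh') p.+1.
by rewrite hwtE 1?ltnW // (_ : D + D = 2 * D) //; ring.
Qed.

Lemma lamL_triangle D g0 g1 g2 : hball D (hmul (hinv g0) g1) -> hball D (hmul (hinv g1) g2) ->
  `|lamL g0 g1 + lamL g1 g2 - lamL g0 g2| <= (2 * D) ^+ p.
Proof.
by move=> h1 h2; have := lamL_bound g0 h1 h2; rewrite !hmulA -!(hmulA g0) !hmulVKx -!hmulA !hmulVKx.
Qed.

(** If the steps of a lift [w] have no top coordinate, then [lamL] of a step of its projection is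
    the decrease of the top coordinate of [w], and the sum telescopes. *)
Lemma psum_lamL (w : nat -> 'rV[R]_p.+1) n :
  (forall i, (i < n)%N -> crd (hmul (hinv (w i)) (w i.+1)) p.+1 = 0) ->
  psum lamL (fun i => hproj (w i)) n = crd (w 0%N) p.+1 - crd (w n) p.+1.
Proof.
have p3 : (2 <= p.+1)%N by exact: ltnW.
elim: n => [|n IH] h; first by rewrite psum0 subrr.
rewrite psumS IH => [|i hi]; last by apply: h; exact: ltnW.
suff -> : lamL (hproj (w n)) (hproj (w n.+1)) = crd (w n) p.+1 - crd (w n.+1) p.+1 by ring.
have := h n (ltnSn n); rewrite {1}[w n]hlift_proj {1}[w n.+1]hlift_proj.
rewrite hinvDz // hDzmul // hmulDz // !crdD !hz_top // => e; rewrite /lamL; move: e.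
move: (crd (hmul _ _) _) => x; lra.
Qed.

End Extension.

(** A horizontal word for a central element of L_(p+1) projects to a loop of L_p. Dilating the unit
    of that centre, which has weight [p], by [s0 N] yields the value [(s0 N)^p]. *)
Lemma horizontal_loop (R : realType) p : (2 <= p)%N -> exists A : nat,
  forall (N : nat) (s0 : R), (0 < N)%N -> 1 <= s0 -> exists n (ga : nat -> 'rV[R]_p),
  [/\ (n <= A * N)%N, ga 0%N = 0, ga n = 0,
    forall i, (i < n)%N -> hball s0 (hmul (hinv (ga i)) (ga i.+1)) &
    forall y, psum (@lamL R p) (fun i => hmul y (ga i)) n = - (s0 * N%:R) ^+ p].
Proof.
move=> p2; have p3 : (2 <= p.+1)%N by exact: ltnW.
have [A hA] := @unit_words R p.+1 p3; exists A => N s0 N0 s01.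
have z1 : hball 1 (hz p.+1 1 : 'rV[R]_p.+1) by apply: hball_z; rewrite ?normr1 ?expr1n.
have [t [tA t1 tE]] := hA _ N z1 N0.
have s00 : 0 <= s0 by lra.
exists (size t), (fun i => hdil s0 (hword p (take i t))); split => //.
- by rewrite take0 hdilx0.
- by rewrite take_size -hproj_word // tE hdil_z // hproj_z // hdilx0.
- move=> i hi; have [e hb] := hword_path p t1 hi.
  by have := hball_dil s00 hb; rewrite mulr1 -hdilV -hdilM e.
move=> y; pose w i := hmul (hlift y) (hdil s0 (hword p.+1 (take i t))).
have hproj_dil u : hproj (hdil s0 u) = hdil s0 (hproj u) :> 'rV[R]_p.
  by apply: crdP => k; rewrite crd_hproj !crd_hdil crd_hproj; case: ifP; rewrite ?mulr0.
have wE i : hmul y (hdil s0 (hword p (take i t))) = hproj (w i).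
  by rewrite hprojM // hliftK hproj_dil hproj_word.
rewrite /psum; under eq_bigr do rewrite !wE.
have := @psum_lamL R p p2 w (size t); rewrite /psum => ->.
  rewrite /w take0 take_size tE /= hdilx0 hmulx0 hdil_dil hdil_z // hmul_z // crdD hz_top //.
  by rewrite crd_hlift crd_out ?ltnSn ?orbT // sub0r add0r mulr1.
move=> i hi; have [e _] := hword_path p.+1 t1 hi.
have -> : hmul (hinv (w i)) (w i.+1) = hdil s0 (hor p.+1 (nth (true, 0) t i)).
  by rewrite /w hinvM -hmulA (hmulA (hinv (hlift y))) hmulVx hmul0x -hdilV -hdilM e.
rewrite hdil_hor crdZ crd_xb.
by rewrite (_ : _ == _ = false) ?mulr0 //; case: (nth _ _ _).1; apply/eqP; lia.
Qed.

Section Model.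
Variables (R : realType) (m n : nat) (G : group_law R) (I : finType).
Variables (cr : I -> G -> R) (ba : I -> G) (d : G -> G -> R).
Variable j : 'rV[R]_m * 'rV[R]_n -> G.
Hypotheses (hG : polynomial_group cr ba) (hj : homogeneous_model d j).

Lemma model_one : j (0, 0) = 0.
Proof.
have := model_hom hj (0, 0) (0, 0); rewrite /pmul /= !hmul0x => e.
by rewrite -[LHS](gmulKx hG (j (0, 0))) -e (gmulNx hG).
Qed.

Lemma model_step : exists2 C, 1 <= C & forall t x y, 1 <= t -> d x y <= t ->
  exists2 P, pball (C * t) P & y = gmul x (j P).
Proof.
have [C C1 hC] := model_lower hj; exists C => // t x y t1 hxy.
have [|P hP jP] := hC t x (gmul (- x) y) t1; first by rewrite (gmulxK hG).
by exists P => //; rewrite jP (gmulxK hG).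
Qed.

(** Symmetry and the triangle inequality up to a constant, read off the group through [j], hence in
    the same way for both kinds of metric. *)
Lemma model_quasi : exists2 C, 1 <= C & forall x y t, 1 <= t -> d x y <= t ->
  d y x <= C * t /\ forall z t', 1 <= t' -> d y z <= t' -> d x z <= C * (t + t').
Proof.
have [C C1 hC] := model_step; have [D D0 hD] := model_upper hj.
exists (2 * D * C + 1) => [|x y t t1 hxy].
  by have := mulr_ge0 D0 (le_trans ler01 C1); lra.
have [P hP yP] := hC t x y t1 hxy.
have Ct : 1 <= C * t by rewrite -[leLHS]mulr1; apply: ler_pM.
have D2 z : 0 <= z -> D * (C * z) <= (2 * D * C + 1) * z.
  by move=> z0; have := mulr_ge0 (mulr_ge0 D0 (le_trans ler01 C1)) z0; lra.
split=> [|z t' t'1 hyz].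
  have -> : x = gmul y (j (pairinv P)).
    rewrite yP -(gmulA hG) -(model_hom hj) (_ : pmul P _ = (0, 0)) ?model_one ?(gmul0 hG) //.
    by rewrite /pmul /= !hmulxV.
  apply: (le_trans (hD (2 * (C * t)) (pairinv P) y _ (pballV hP))); first lra.
  by have := D2 t (le_trans ler01 t1); have := mulr_ge0 D0 (le_trans ler01 Ct); lra.
have [Q hQ zQ] := hC t' y z t'1 hyz.
have Ct' : 1 <= C * t' by rewrite -[leLHS]mulr1; apply: ler_pM.
rewrite zQ yP -(gmulA hG) -(model_hom hj).
apply: (le_trans (hD (C * t + C * t') (pmul P Q) x _ (pballM hP hQ))); first lra.
by rewrite -mulrDr; apply: D2; lra.
Qed.

End Model.

Lemma sublinear_affine (R : realType) (v : R -> R) : sublinear_gauge v ->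
  forall ep, 0 < ep -> exists2 C, 0 <= C & forall t, 0 <= t -> v t <= ep * t + C.
Proof.
move=> [v0 vm /cvgrPdist_le vl] ep ep0; have [T [Tr hT]] := vl ep ep0.
pose T1 := Num.max 0 T + 1; have T10 : 0 <= T1 by rewrite addr_ge0 // le_max lexx.
have TT1 : T < T1 by rewrite ltr_pwDr // le_max lexx orbT.
exists (v T1) => [|t t0]; first exact: v0.
have [h|h] := leP t T1; first by have := vm t T1 t0 h; have := mulr_ge0 (ltW ep0) t0; lra.
have t0' : 0 < t by lra.
have := hT t (lt_trans TT1 h); rewrite /= sub0r normrN ger0_norm ?divr_ge0 ?v0 // ler_pdivrMr // => e.
by have := v0 T1 T10; lra.
Qed.

(** Here [v t = O(t^(1/(2p)))]. After raising to the power [k = 2p], the claim follows from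
    [|C|^k B s^(2p-3) <= ep^k s^(2p)], for which [D <= s] suffices. *)
Lemma gauge_small (R : realType) (v : R -> R) (e : R) (p : nat) : (2 <= p)%N ->
  sublinear_gauge v -> big_O_power v e -> e <= 1 / (2 * p%:R) ->
  forall B ep, 1 <= B -> 0 < ep -> exists s0 : nat, forall s : nat, (s0 <= s)%N ->
    v (B * (s ^ (2 * p - 3))%:R) <= ep * s%:R.
Proof.
move=> p2 [v0 vm _] [C [T [Tr hT]]] he B ep B1 ep0.
pose k := (2 * p)%N; have k0 : (0 < k)%N by rewrite /k; lia.
have k3 : ((2 * p - 3).+1 <= k)%N by rewrite /k; clear -p2; lia.
pose D := `|C| ^+ k * B / ep ^+ k.
exists (maxn (Num.truncn `|T|).+1 (Num.truncn `|D|).+1) => s; rewrite geq_max => /andP[sT sD].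
have s1 : (1 : R) <= s%:R by rewrite ler1n; apply: leq_trans sT.
have hk : (0 < 2 * p - 3)%N by lia.
set t := B * _.
have ss : s%:R <= t.
  rewrite /t natrX -[leLHS]mul1r; apply: ler_pM => //.
  by rewrite -(prednK hk) exprS ler_peMr ?exprn_ege1.
have Ts : T < s%:R.
  apply: le_lt_trans (ler_norm _) _; apply: lt_le_trans (truncnS_gt _) _.
  by rewrite ler_nat.
have Ds : D <= s%:R.
  apply: le_trans (ler_norm _) _; apply: le_trans (ltW (truncnS_gt _)) _.
  by rewrite ler_nat.
have t1 : 1 <= t by lra.
have := hT t (lt_le_trans Ts ss) => /=; rewrite ger0_norm; last by apply: v0; lra.
rewrite ger0_norm ?powR_ge0 // => h; apply: (le_trans h).
pose x := t `^ (k%:R^-1).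
have x0 : 0 <= x by exact: powR_ge0.
have xk : x ^+ k = t by rewrite /x -powR_mulrn // -powRrM mulVf ?pnatr_eq0 -?lt0n // powRr1 //; lra.
have ex : t `^ e <= x.
  by apply: ler_powR => //; apply: le_trans he _; rewrite /k natrM div1r.
apply: (@le_trans _ _ (`|C| * x)).
  apply: (le_trans (ler_wpM2r (powR_ge0 t e) (ler_norm C))).
  exact: ler_wpM2l.
rewrite -(@ler_pXn2r _ k) ?nnegrE ?mulr_ge0 //; last by rewrite ltW.
rewrite !exprMn xk /t mulrA -ler_pdivrMl ?exprn_gt0 // mulrA [_^-1 * _]mulrC.
rewrite -/D natrX; apply: (@le_trans _ _ (s%:R * s%:R ^+ (2 * p - 3))).
  by apply: ler_wpM2r => //; rewrite exprn_ge0.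
by rewrite -exprS; exact: ler_weXn2l.
Qed.

(** Division by [s^p N^(p-1) s^3] leaves [N / s^3], which is at least [s], against a constant. The
    error of the ladder, of order [s^p n], is absorbed because [N <= N^(p-1) s^3]. *)
Lemma assembly_arith (R : realType) (p : nat) (A C C0 D s N n : R) : (2 <= p)%N ->
  0 <= A -> 1 <= C0 -> 0 <= D -> 1 <= s -> s ^+ 4 <= N -> n <= A * N ->
  (s / C0 * N) ^+ p <= C * (2 * (D * s)) ^+ p * (N ^+ p.-1 * s ^+ 3) + 2 * (2 * (D * s)) ^+ p * n ->
  s <= (C + 2 * A) * (2 * D * C0) ^+ p.
Proof.
move=> p2; have pE : p.-1 = p.-2.+1 by lia.
move=> A0 C01 D0 s1 sN nA h.
have s0 : 0 < s by lra.
have C0p : 0 < C0 by lra.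
have s41 : 1 <= s ^+ 4 by exact: exprn_ege1.
have N1 : 1 <= N by lra.
have N0 : 0 < N by lra.
set K := (2 * (D * s)) ^+ p in h.
have K0 : 0 <= K by rewrite exprn_ge0 // mulr_ge0 // mulr_ge0 // ltW.
pose X := N ^+ p.-1 * s ^+ 3.
have NX : N <= X.
  rewrite /X pE exprS -mulrA; apply: ler_peMr; first exact: ltW.
  by rewrite -[leLHS]mulr1; apply: ler_pM => //; exact: exprn_ege1.
have e1 : (s / C0 * N) ^+ p <= (C + 2 * A) * K * X.
  apply: (le_trans h); rewrite -/X.
  have -> : (C + 2 * A) * K * X = C * K * X + 2 * K * (A * X) by ring.
  rewrite lerD2l; apply: ler_wpM2l; first by rewrite mulr_ge0.
  by apply: (le_trans nA); exact: ler_wpM2l.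
have Y0 : 0 < s ^+ p * X by rewrite !mulr_gt0 // exprn_gt0.
have Cp0 : 0 < C0 ^+ p by exact: exprn_gt0.
rewrite -(ler_pM2r Y0).
apply: (@le_trans _ _ ((s / C0 * N) ^+ p * C0 ^+ p)).
  have -> : (s / C0 * N) ^+ p * C0 ^+ p = s ^+ p * (N ^+ p.-1 * N).
    rewrite -exprSr (prednK (ltnW p2)) -!exprMn (_ : s / C0 * N * C0 = s * N) //.
    by field; rewrite gt_eqF.
  have -> : s * (s ^+ p * X) = s ^+ p * (N ^+ p.-1 * s ^+ 4) by rewrite /X; ring.
  apply: ler_wpM2l; first by rewrite exprn_ge0 // ltW.
  by apply: ler_wpM2l => //; rewrite exprn_ge0 // ltW.
apply: (le_trans (ler_wpM2r (ltW Cp0) e1)).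
rewrite le_eqVlt; apply/orP; left; apply/eqP; rewrite /K !exprMn; ring.
Qed.

Definition pdil (R : realType) m n t (P : 'rV[R]_m * 'rV[R]_n) : 'rV[R]_m * 'rV[R]_n :=
  (hdil t P.1, hdil t P.2).

Lemma pdilM (R : realType) m n t (P Q : 'rV[R]_m * 'rV[R]_n) :
  pdil t (pmul P Q) = pmul (pdil t P) (pdil t Q).
Proof. by rewrite /pdil /pmul /= !hdilM. Qed.

Lemma pball_dil (R : realType) m n s t (P : 'rV[R]_m * 'rV[R]_n) : 0 <= s -> pball t P ->
  pball (s * t) (pdil s P).
Proof. by move=> s0 [h1 h2]; split; exact: hball_dil. Qed.

(** * Lifting the loop through the equivalence *)

Section Assembly.
Variables (R : realType) (p k : nat).
Hypothesis p4 : (4 <= p)%N.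
Let q := p.-1.
Let p2 : (2 <= p)%N. Proof. by lia. Qed.
Let q2 : (2 <= q)%N. Proof. by rewrite /q; lia. Qed.
Local Notation T := ('rV[R]_p * 'rV[R]_q)%type.
Variables (G L : group_law R) (I J : finType).
Variables (crG : I -> G -> R) (baG : I -> G) (crL : J -> L -> R) (baL : J -> L).
Hypotheses (hG : polynomial_group crG baG) (hL : polynomial_group crL baL).
Variables (dG : G -> G -> R) (dL : L -> L -> R).
Variables (jG : T -> G) (jL : 'rV[R]_p * 'rV[R]_k -> L) (eL : L -> 'rV[R]_p).
Hypotheses (mG : homogeneous_model dG jG) (mL : homogeneous_model dL jL).
Hypothesis dG0 : forall x y, 0 <= dG x y.
Hypothesis jker : forall P t, jG (P.1 + hz p t, P.2 + hz q (- t)) = jG P.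
Hypothesis jker0 : forall P, jG P = 0 -> exists t, P = (hz p t, hz q (- t)).
Hypothesis eLM : forall x Q, eL (gmul x (jL Q)) = hmul (eL x) Q.1.
Variables (v : R -> R) (F : G -> L) (x0 : G) (y0 : L) (M : R).
Hypothesis M1 : 1 <= M.
Hypothesis hF : forall r, 0 <= r ->
  (forall x x', dG x0 x <= r -> dG x0 x' <= r ->
     M^-1 * dG x x' - v r <= dL (F x) (F x') /\ dL (F x) (F x') <= M * dG x x' + v r) /\
  (forall y, dL y0 y <= r -> exists x, dL (F x) y <= v r).

Variables (CG CL a b uG uL Cv : R).
Hypotheses (CG1 : 1 <= CG) (CL1 : 1 <= CL) (a1 : 1 <= a) (b1 : 1 <= b) (uG0 : 0 <= uG) (uL0 : 0 <= uL)
  (Cv0 : 0 <= Cv).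
Hypothesis quasiG : forall x y t, 1 <= t -> dG x y <= t ->
  dG y x <= CG * t /\ forall z t', 1 <= t' -> dG y z <= t' -> dG x z <= CG * (t + t').
Hypothesis quasiL : forall x y t, 1 <= t -> dL x y <= t ->
  dL y x <= CL * t /\ forall z t', 1 <= t' -> dL y z <= t' -> dL x z <= CL * (t + t').
Hypothesis stepG : forall t x y, 1 <= t -> dG x y <= t ->
  exists2 P, pball (a * t) P & y = gmul x (jG P).
Hypothesis stepL : forall t x y, 1 <= t -> dL x y <= t ->
  exists2 P, pball (b * t) P & y = gmul x (jL P).
Hypothesis upG : forall t P g, 1 <= t -> pball t P -> dG g (gmul g (jG P)) <= uG * t.
Hypothesis upL : forall t P g, 1 <= t -> pball t P -> dL g (gmul g (jL P)) <= uL * t.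
Hypothesis vaff : forall t, 0 <= t -> v t <= (2 * M)^-1 * t + Cv.

Lemma upG1 t P g : 1 <= t -> pball t P -> dG g (gmul g (jG P)) <= (uG + 1) * t.
Proof. by move=> t1 hP; apply: (le_trans (upG g t1 hP)); rewrite ler_wpM2r ?lerDl //; lra. Qed.

Lemma upL1 t P g : 1 <= t -> pball t P -> dL g (gmul g (jL P)) <= (uL + 1) * t.
Proof. by move=> t1 hP; apply: (le_trans (upL g t1 hP)); rewrite ler_wpM2r ?lerDl //; lra. Qed.

Lemma quasiL2 x y z t t' : 1 <= t -> 1 <= t' -> dL x y <= t -> dL y z <= t' -> dL x z <= CL * (t + t').
Proof. by move=> t1 t'1 h h'; exact: (quasiL t1 h).2. Qed.

Lemma quasiL_sym x y t : 1 <= t -> dL x y <= t -> dL y x <= CL * t.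
Proof. by move=> t1 h; exact: (quasiL t1 h).1. Qed.

Let mulC1 t : 1 <= t -> 1 <= CL * t.
Proof. by move=> t1; rewrite -[leLHS]mulr1; apply: ler_pM. Qed.

Let l0 : R := Num.max 1 (dL (F x0) y0).
Let m0 : R := Num.max 1 (dG x0 x0).

(** The inequalities for [F] hold on balls around [x0], so they say nothing about a preimage [x]
    before its distance to [x0] is bounded. With the radius [dG x0 x + m0] itself, the affine bound
    [vaff] absorbs half of the unknown distance. *)
Let far_preimage x y r t : 1 <= r -> 1 <= t -> dL y0 y <= r -> dL (F x) y <= t ->
  dG x0 x <= 2 * M * (CL * (CL * (l0 + r) + CL * t)) + m0 + 2 * M * Cv.
Proof.
move=> r1 t1 hy hx; have l01 : 1 <= l0 by rewrite le_max lexx.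
have M0 : 0 < M by apply: lt_le_trans M1.
have e1 : dL (F x0) y <= CL * (l0 + r) by apply: quasiL2 hy; rewrite // le_max lexx orbT.
have e2 : dL y (F x) <= CL * t by exact: quasiL_sym.
have e3 : dL (F x0) (F x) <= CL * (CL * (l0 + r) + CL * t).
  by apply: quasiL2 e1 e2; apply: mulC1 => //; lra.
set E := CL * _ in e3 *.
set rho := dG x0 x; have rho0 : 0 <= rho by exact: dG0.
have m01 : 1 <= m0 by rewrite le_max lexx.
have rm : 0 <= rho + m0 by lra.
have [h _] := hF rm.
have h0 : dG x0 x0 <= rho + m0 by rewrite ler_wpDl // le_max lexx orbT.
have hx0 : dG x0 x <= rho + m0 by rewrite -/rho; lra.
have [h1 _] := h _ _ h0 hx0.
have va := vaff rm.
have e4 : M^-1 * rho <= E + ((2 * M)^-1 * (rho + m0) + Cv).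
  by move: h1 e3 va; rewrite -/rho; lra.
have e5 := ler_wpM2l (ltW (mulr_gt0 (ltr0n R 2) M0)) e4.
have M20 : M != 0 by rewrite gt_eqF.
have e6 : 2 * M * (M^-1 * rho) = 2 * rho by field.
have e7 : 2 * M * (E + ((2 * M)^-1 * (rho + m0) + Cv)) = 2 * M * E + (rho + m0) + 2 * M * Cv by field.
by move: e5; rewrite e6 e7; lra.
Qed.

Variables (s n : nat) (A Bw c C : R).
Hypotheses (s0 : (0 < s)%N) (A1 : 1 <= A) (c1 : 1 <= c).
Let N := (s ^ (2 * p - 4))%N.
Let Z : R := s%:R * N%:R.
(** In units of [Z = s N]: [Bq] bounds the loop seen from [y0], [Br1] the preimages of its vertices
    seen from [x0], and [Br2] all points of G that occur in the filling. In units of [sg], [k1] and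
    [k2] bound the steps of the images [F (X i)] and of the lifted path [X]. *)
Let Bq := (uL + 1) * (A + 1).
Let Br1 := 2 * M * (CL * (CL * (l0 + Bq) + CL)) + m0 + 2 * M * Cv.
Let k1 := CL * (CL * (uL + 2) + CL).
Let k2 := M * (k1 + 1).
Let C0 := a * k2.
(** The step of the loop is [s] divided by a constant such that the steps of its lift fit in the
    ball of radius exactly [s], hence of radius 1 after rescaling. *)
Let sg : R := s%:R / C0.
Let Br2 := CG * (Br1 + (uG + 1) * Bw).
Let D := b * (M * ((uG + 1) * c) + 1) + 2 * b.
Hypothesis C0s : C0 <= s%:R.
Hypothesis vs : forall t, t <= (Bq + Br1 + Br2) * Z -> 0 <= t -> v t <= sg.
Hypothesis Bw1 : A + 1 + 2 * c <= Bw.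

Let s1 : 1 <= s%:R :> R. Proof. by rewrite ler1n. Qed.
Let N1 : 1 <= N%:R :> R. Proof. by rewrite ler1n expn_gt0 s0. Qed.
Let Z1 : 1 <= Z. Proof. by rewrite -[leLHS]mulr1; apply: ler_pM. Qed.
Let sZ : s%:R <= Z. Proof. by rewrite ler_peMr. Qed.
Let l01 : 1 <= l0. Proof. by rewrite le_max lexx. Qed.
Let m01 : 1 <= m0. Proof. by rewrite le_max lexx. Qed.
Let M0 : 0 <= M. Proof. exact: le_trans M1. Qed.
Let CL0 : 0 <= CL. Proof. exact: le_trans CL1. Qed.
Let k11 : 1 <= k1.
Proof.
have e := uL0; apply: mulC1; rewrite ler_wpDl ?CL1 // mulr_ge0 //; lra.
Qed.
Let k21 : 1 <= k2.
Proof. by rewrite -[leLHS]mulr1; apply: ler_pM => //; have := k11; lra. Qed.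
Let C01 : 1 <= C0. Proof. by rewrite -[leLHS]mulr1; apply: ler_pM. Qed.
Let C0p : 0 < C0. Proof. exact: lt_le_trans C01. Qed.
Let sg1 : 1 <= sg. Proof. by rewrite ler_pdivlMr // mul1r. Qed.
Let sgs : sg <= s%:R. Proof. by rewrite ler_pdivrMr // ler_peMr. Qed.
Let sgZ : sg <= Z. Proof. exact: le_trans sZ. Qed.
Let Bq1 : 1 <= Bq.
Proof.
have e := uL0; have e' := A1; rewrite -[leLHS]mulr1; apply: ler_pM => //; lra.
Qed.
Let Br11 : 1 <= Br1.
Proof.
have e := Cv0; have e1 := Bq1; have e2 := l01; have e3 := m01; have e4 := M0; have e5 := CL0.
have h1 : 0 <= 2 * M * (CL * (CL * (l0 + Bq) + CL)).
  by rewrite mulr_ge0 // ?mulr_ge0 // addr_ge0 // mulr_ge0 //; lra.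
have h2 : 0 <= 2 * M * Cv by rewrite mulr_ge0 // mulr_ge0.
by rewrite /Br1; lra.
Qed.
Let Bw11 : 1 <= Bw. Proof. by have := A1; have := c1; have := Bw1; lra. Qed.
Let Br20 : 0 <= Br2.
Proof.
rewrite mulr_ge0 ?(le_trans ler01 CG1) // addr_ge0 ?(le_trans ler01 Br11) // mulr_ge0 //.
  by rewrite addr_ge0.
exact: le_trans Bw11.
Qed.

Let vBq : v (Bq * Z) <= sg.
Proof.
have e1 := Bq1; have e2 := Br11; have e3 := Br20; have z0 := le_trans ler01 Z1.
by apply: vs; [apply: ler_wpM2r => //; lra|rewrite mulr_ge0 //; lra].
Qed.
Let vBr1 : v (Br1 * Z) <= sg.
Proof.
have e1 := Bq1; have e2 := Br11; have e3 := Br20; have z0 := le_trans ler01 Z1.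
by apply: vs; [apply: ler_wpM2r => //; lra|rewrite mulr_ge0 //; lra].
Qed.
Let vBr2 : v (Br2 * Z) <= sg.
Proof.
have e1 := Bq1; have e2 := Br11; have e3 := Br20; have z0 := le_trans ler01 Z1.
by apply: vs; [apply: ler_wpM2r => //; lra|rewrite mulr_ge0 //; lra].
Qed.

Variables (ga : nat -> 'rV[R]_p).
Hypotheses (nA : n%:R <= A * N%:R) (ga0 : ga 0%N = 0) (gan : ga n = 0).
Hypothesis gae : forall i, (i < n)%N -> hball sg (hmul (hinv (ga i)) (ga i.+1)).

Let y i := gmul y0 (jL (ga i, 0)).

Let gaB i : (i <= n)%N -> hball (sg * i%:R) (ga i).
Proof.
elim: i => [|i IH] hi; first by rewrite ga0; apply: hball0; rewrite mulr0.
rewrite -(hmulVKx (ga i) (ga i.+1)) -natr1 mulrDr mulr1.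
by apply: hballM; [exact/IH/ltnW|exact: gae].
Qed.

Let y_near i : (i <= n)%N -> dL y0 (y i) <= Bq * Z.
Proof.
move=> hi; have e1 := sg1; have e2 := uL0.
have h0 : 0 <= sg * i%:R by rewrite mulr_ge0 //; lra.
have hb : pball (sg * i%:R + 1) (ga i, 0 : 'rV[R]_k).
  by split; [apply: hball_leq (gaB hi) _; lra|apply: hball0; lra].
apply: (le_trans (upL1 y0 _ hb)); first by rewrite lerDr.
rewrite /Bq -mulrA; apply: ler_wpM2l; first lra.
rewrite mulrDl mul1r; apply: lerD; last exact: Z1.
rewrite /Z mulrCA; apply: ler_pM => //; first lra.
by apply: le_trans nA; rewrite ler_nat.
Qed.

Let y_step i : (i < n)%N -> dL (y i) (y i.+1) <= (uL + 1) * sg.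
Proof.
move=> hi; have -> : y i.+1 = gmul (y i) (jL (hmul (hinv (ga i)) (ga i.+1), 0)).
  by rewrite /y -(gmulA hL) -(model_hom mL) /pmul /= hmulVKx hmulx0.
by apply: upL1; [exact: sg1|split; [exact: gae|apply: hball0; exact: le_trans sg1]].
Qed.

Hypothesis fill : forall (lam : T -> T -> R) (K : R) (P : nat -> T) (n : nat) (m : R),
  (forall t P Q, lam (kappa s%:R t P) Q = lam P Q /\ lam P (kappa s%:R t Q) = lam P Q) ->
  (forall P h h', pball ((Bw - 2 * c) * N%:R) P -> pball c h -> pball c h' ->
    `|lam P (pmul P h) + lam (pmul P h) (pmul P (pmul h h')) - lam P (pmul P (pmul h h'))| <= K) ->
  n%:R <= A * N%:R -> P 0%N = (0, 0) ->
  (forall i, (i < n)%N -> pball 1 (pmul (pairinv (P i)) (P i.+1))) ->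
  P n = kappa s%:R m (0, 0) ->
  `|psum lam P n| <= C * K * (N ^ p.-1 * s ^ 3)%:R.
Hypothesis loop : forall y, psum (@lamL R p) (fun i => hmul y (ga i)) n = - (sg * N%:R) ^+ p.

Section Lift.
Variable X : nat -> G.
Hypotheses (Xn : X n = X 0%N) (XF : forall i, (i <= n)%N -> dL (F (X i)) (y i) <= v (Bq * Z)).

Let Xy i : (i <= n)%N -> dL (F (X i)) (y i) <= sg.
Proof. by move=> hi; apply: le_trans (XF hi) vBq. Qed.

Let X_near i : (i <= n)%N -> dG x0 (X i) <= Br1 * Z.
Proof.
move=> hi; have z1 := Z1; have BZ1 : 1 <= Bq * Z by rewrite -[leLHS]mulr1; apply: ler_pM.
apply: (le_trans (far_preimage BZ1 sg1 (y_near hi) (Xy hi))).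
have e1 := l01; have e2 := m01; have e3 := Cv0; have e4 := M0; have e5 := CL0; have e6 := sgZ.
have h1 : l0 + Bq * Z <= (l0 + Bq) * Z.
  by rewrite mulrDl lerD2r ler_peMr //; lra.
have h2 : CL * (CL * (l0 + Bq * Z) + CL * sg) <= CL * (CL * (l0 + Bq) + CL) * Z.
  rewrite -mulrA; apply: ler_wpM2l => //; rewrite mulrDl; apply: lerD; last exact: ler_wpM2l.
  by rewrite -mulrA; apply: ler_wpM2l.
have -> : Br1 * Z = 2 * M * (CL * (CL * (l0 + Bq) + CL) * Z) + m0 * Z + 2 * M * Cv * Z.
  by rewrite /Br1; ring.
apply: lerD; first apply: lerD.
- by apply: ler_wpM2l => //; exact: mulr_ge0.
- by rewrite ler_peMr //; lra.
by rewrite ler_peMr // mulr_ge0 // mulr_ge0.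
Qed.

Let X_step i : (i < n)%N -> dG (X i) (X i.+1) <= k2 * sg.
Proof.
move=> hi; have e1 := sg1; have e2 := uL0; have e5 := CL0; have e4 := M0.
have h1 : dL (F (X i)) (y i.+1) <= CL * (sg + (uL + 1) * sg).
  apply: (quasiL2 sg1 _ (Xy (ltnW hi)) (y_step hi)).
  by rewrite -[leLHS]mulr1; apply: ler_pM => //; lra.
have h2 : dL (y i.+1) (F (X i.+1)) <= CL * sg by apply: quasiL_sym sg1 _; exact: Xy.
have h3 : dL (F (X i)) (F (X i.+1)) <= k1 * sg.
  have -> : k1 * sg = CL * (CL * (sg + (uL + 1) * sg) + CL * sg) by rewrite /k1; ring.
  apply: quasiL2 h1 h2; apply: mulC1 => //.
  have : 0 <= (uL + 1) * sg by rewrite mulr_ge0 //; lra.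
  lra.
have z0 : 0 <= Br1 * Z by rewrite mulr_ge0 // ?(le_trans ler01 Br11) // (le_trans ler01 Z1).
have [h _] := hF z0; have [{}h _] := h _ _ (X_near (ltnW hi)) (X_near hi).
have vb := vBr1.
have h4 : M^-1 * dG (X i) (X i.+1) <= (k1 + 1) * sg by rewrite mulrDl mul1r; lra.
have Mp : 0 < M by apply: lt_le_trans M1.
by move: h4; rewrite mulrC ler_pdivrMr // /k2; lra.
Qed.

Let js Q := jG (pdil s%:R Q).

Let increments i : (i < n)%N -> exists g, pball 1 g /\ X i.+1 = gmul (X i) (js g).
Proof.
move=> hi; have e1 := k21; have e2 := sg1.
have [|S hS ->] := stepG _ (X_step hi); first by rewrite -[leLHS]mulr1; apply: ler_pM.
have sp : 0 < s%:R :> R by apply: lt_le_trans s1.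
have E : a * (k2 * sg) = s%:R by rewrite /sg mulrA -/C0 mulrC divfK // gt_eqF.
rewrite E in hS; have [u hu uE] := hball_undil sp hS.1; have [w hw wE] := hball_undil sp hS.2.
by exists (u, w); split => //; rewrite /js /pdil /= -uE -wE -surjective_pairing.
Qed.

Let jsM Q Q' : js (pmul Q Q') = gmul (js Q) (js Q').
Proof. by rewrite /js pdilM (model_hom mG). Qed.

Let js0 : js (0, 0) = 0.
Proof. by rewrite /js /pdil /= !hdilx0 (model_one hG mG). Qed.

Section Path.
Variable h : nat -> T.
Hypothesis hX : forall i, (i < n)%N -> pball 1 (h i) /\ X i.+1 = gmul (X i) (js (h i)).

Let P := fix P i : T := if i is j.+1 then pmul (P j) (h j) else (0, 0).

Let PX i : (i <= n)%N -> X i = gmul (X 0%N) (js (P i)).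
Proof.
elim: i => [|i IH] hi; first by rewrite js0 (gmul0 hG).
by rewrite /= jsM (gmulA hG) -IH ?(hX hi).2 // ltnW.
Qed.

Let f Q := eL (F (gmul (X 0%N) (js Q))).
Let lam Q Q' := lamL (f Q) (f Q').

(** Dilation by [s] multiplies the centre of L_p by [s^(p-1)] and that of L_(p-1) by [s^(p-2)] only,
    so the antidiagonal kernel of [jG] pulls back to [kappa], with its factor [s]. *)
Let f_kappa t Q : f (kappa s%:R t Q) = f Q.
Proof.
congr (eL (F (gmul _ _))); rewrite /js /pdil /kappa /= !hdilDz //.
have -> : s%:R ^+ q.-1 * - (s%:R * t) = - (s%:R ^+ p.-1 * t) :> R.
  by rewrite mulrN mulrA -exprSr prednK //; exact: ltnW.
exact: (jker (pdil s%:R Q)).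
Qed.

(** At the scale [s] the gauge, at most [sg <= s], is absorbed: a bounded step of the model becomes
    a step of size [O(s)] in L_p. *)
Let f_step Q g : pball ((Bw - c) * N%:R) Q -> pball c g ->
  hball (D * s%:R) (hmul (hinv (f Q)) (f (pmul Q g))).
Proof.
move=> hQ hg; have e1 := s1; have e2 := c1; have e3 := uG0; have e4 := N1; have e5 := Z1; have eB := Bw11.
have cN : c <= c * N%:R by rewrite ler_peMr //; lra.
have near Q' : pball (Bw * N%:R) Q' -> dG x0 (gmul (X 0%N) (js Q')) <= Br2 * Z.
  move=> hQ'; rewrite /Br2 -mulrA mulrDl.
  apply: (quasiG _ (X_near (leq0n n))).2.
  - by rewrite -[leLHS]mulr1; apply: ler_pM => //; exact: Br11.
  - rewrite -[leLHS]mulr1; apply: ler_pM => //; rewrite -[leLHS]mulr1; apply: ler_pM => //; lra.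
  have -> : (uG + 1) * Bw * Z = (uG + 1) * (s%:R * (Bw * N%:R)) by rewrite /Z; ring.
  apply: upG1; last by apply: pball_dil => //; lra.
  by rewrite -[leLHS]mulr1; apply: ler_pM => //; rewrite -[leLHS]mulr1; apply: ler_pM.
have b2 : (Bw - c) * N%:R + c <= Bw * N%:R by rewrite mulrBl; lra.
have b3 : (Bw - c) * N%:R <= Bw * N%:R by lra.
have n1 := near Q (pball_leq hQ b3).
have n2 : dG x0 (gmul (X 0%N) (js (pmul Q g))) <= Br2 * Z.
  by apply: near; exact: pball_leq (pballM hQ hg) b2.
have z0 : 0 <= Br2 * Z by rewrite mulr_ge0 // ?Br20 // (le_trans ler01 Z1).
have [hf _] := hF z0; have [_ {}hf] := hf _ _ n1 n2.
have vb := vBr2; have sgs' := sgs.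
have dd : dG (gmul (X 0%N) (js Q)) (gmul (X 0%N) (js (pmul Q g))) <= (uG + 1) * (s%:R * c).
  rewrite jsM (gmulA hG); apply: upG1; last by apply: pball_dil => //; lra.
  by rewrite -[leLHS]mulr1; apply: ler_pM.
have dF : dL (F (gmul (X 0%N) (js Q))) (F (gmul (X 0%N) (js (pmul Q g)))) <= (M * ((uG + 1) * c) + 1) * s%:R.
  have := ler_wpM2l M0 dd.
  have -> : (M * ((uG + 1) * c) + 1) * s%:R = M * ((uG + 1) * (s%:R * c)) + s%:R by ring.
  lra.
have m1 : 0 <= M * ((uG + 1) * c) by rewrite mulr_ge0 // mulr_ge0 //; lra.
have [|S hS Sf] := stepL _ dF.
  by rewrite -[leLHS]mulr1; apply: ler_pM => //; lra.
rewrite /f Sf eLM hmulKx; apply: hball_leq hS.1 _.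
rewrite mulrA; apply: ler_wpM2r => //; rewrite /D lerDl mulr_ge0 //.
exact: le_trans b1.
Qed.

Let PB i : (i <= n)%N -> pball n%:R (P i).
Proof.
move=> hi; have p00 : pball 0 (P 0%N) by split; exact: hball0.
apply: pball_leq (pball_path p00 _ hi) _; last by rewrite ler_nat.
by move=> j hj; rewrite /= pmulKx; exact: (hX hj).1.
Qed.

Let P_end : exists m, P n = kappa s%:R m (0, 0).
Proof.
have e : js (P n) = 0.
  have := PX (leqnn n); rewrite Xn => /(congr1 (gmul (- X 0%N))).
  by rewrite (gmulNx hG) (gmulKx hG).
have sn0 : s%:R != 0 :> R by rewrite pnatr_eq0 -lt0n.
have [t [h1 h2]] := jker0 e; exists (s%:R ^- p.-1 * t).
have un m (u : 'rV[R]_m) : u = hdil s%:R^-1 (hdil s%:R u) by rewrite hdil_dil mulVf ?hdil1.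
rewrite [P n]surjective_pairing (un _ (P n).1) (un _ (P n).2) h1 h2 !hdil_z // /kappa /= !add0r exprVn.
congr (_, hz q _); rewrite exprVn mulrN mulrA; congr (- (_ * _)).
have -> : p.-1 = q.-1.+1 by rewrite prednK //; exact: ltnW.
by rewrite exprS invfM mulrA mulfV // mul1r.
Qed.

Lemma path_bound : s%:R <= (C + 2 * A) * (2 * D * C0) ^+ p.
Proof.
have e1 := s1; have e2 := c1; have e3 := N1; have eB := Bw1; have eA := A1; have eb := b1.
pose K := (2 * (D * s%:R)) ^+ p.
have cN : c <= c * N%:R by rewrite ler_peMr //; lra.
have fl : `|psum lam P n| <= C * K * (N ^ p.-1 * s ^ 3)%:R.
  have [m Pm] := P_end; apply: (fill (m := m)) => //.
  - by move=> t Q Q'; rewrite /lam !f_kappa.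
  - move=> Q g g' hQ hg hg'; rewrite /lam (pmulA Q); apply: (lamL_triangle p2).
      by apply: f_step => //; apply: pball_leq hQ _; apply: ler_wpM2r; lra.
    by apply: f_step => //; apply: pball_leq (pballM hQ hg) _; rewrite !mulrBl; lra.
  - by move=> i hi; rewrite /= pmulKx; exact: (hX hi).1.
have uG1 : 0 <= M * ((uG + 1) * c).
  by rewrite mulr_ge0 // mulr_ge0 //; [have := uG0|]; lra.
have bD : 2 * b <= D by rewrite /D ler_wpDl // mulr_ge0 //; lra.
have D0 : 0 <= D by lra.
have D1s : s%:R <= D * s%:R by rewrite ler_peMl //; lra.
have sgs' := sgs; have sg1' := sg1.
have yE i : eL (y i) = hmul (eL y0) (ga i) by rewrite eLM.
have fX i : (i <= n)%N -> f (P i) = eL (F (X i)) by move=> hi; rewrite /f -PX.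
(* The loop and the image of the lifted path are within [O(s)] of each other vertex by vertex. Both
   are closed, so the two end rungs will cancel. *)
have lad : `|psum (@lamL R p) (fun i => hmul (eL y0) (ga i)) n - psum (@lamL R p) (fun i => f (P i)) n
    - lamL (hmul (eL y0) (ga 0%N)) (f (P 0%N)) + lamL (hmul (eL y0) (ga n)) (f (P n))| <= 2 * K * n%:R.
  have rung i : (i <= n)%N -> hball (D * s%:R) (hmul (hinv (hmul (eL y0) (ga i))) (f (P i))).
    move=> hi; rewrite fX // -yE; have [S hS ->] := stepL sg1 (Xy hi).
    rewrite eLM hinvM -hmulA hmulVx hmulx0; apply: hball_leq (hballV hS.1) _.
    rewrite mulrA; apply: ler_pM => //; lra.
  have edge i : (i < n)%N -> hball (D * s%:R) (hmul (hinv (hmul (eL y0) (ga i))) (hmul (eL y0) (ga i.+1))).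
    move=> hi; rewrite hinvM -hmulA (hmulA (hinv (eL y0))) hmulVx hmul0x.
    by apply: hball_leq (gae hi) _; lra.
  have edge' i : (i < n)%N -> hball (D * s%:R) (hmul (hinv (f (P i))) (f (P i.+1))).
    move=> hi; rewrite /=; apply: f_step; last by apply: pball_leq (hX hi).1 _.
    apply: pball_leq (PB (ltnW hi)) _; apply: (le_trans nA); apply: ler_wpM2r; lra.
  apply: ladder => i hi; apply: (lamL_triangle p2).
  - exact: edge.
  - exact: rung.
  - by apply: rung; exact: ltnW.
  exact: edge'.
have same : f (P n) = f (P 0%N) by rewrite !fX // Xn.
rewrite loop same ga0 gan in lad.
have fin : (sg * N%:R) ^+ p <= C * K * (N%:R ^+ p.-1 * s%:R ^+ 3) + 2 * K * n%:R.
  move: fl lad; rewrite natrM !natrX -[psum lam P n]/(psum (@lamL R p) (fun i => f (P i)) n).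
  move: (psum _ _ n) (lamL _ _) => x z; rewrite !ler_norml; lra.
apply: (@assembly_arith R p A C C0 D s%:R N%:R n%:R) => //; first lra.
by rewrite /N natrX; apply: ler_weXn2l => //; clear -p4; lia.
Qed.

End Path.

Lemma lift_bound : s%:R <= (C + 2 * A) * (2 * D * C0) ^+ p.
Proof.
have /choice[h hP] : forall i, exists g, (i < n)%N -> pball 1 g /\ X i.+1 = gmul (X i) (js g).
  move=> i; have [hi|hi] := boolP (i < n)%N; last by exists (0, 0).
  by have [g hg] := increments hi; exists g.
exact: (path_bound hP).
Qed.

End Lift.

Lemma assembly_bound : s%:R <= (C + 2 * A) * (2 * D * C0) ^+ p.
Proof.
have BZ0 : 0 <= Bq * Z by rewrite mulr_ge0 // ?(le_trans ler01 Bq1) // (le_trans ler01 Z1).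
have /choice[X hX] : forall i, exists x, (i <= n)%N -> dL (F x) (y i) <= v (Bq * Z).
  move=> i; have [hi|hi] := boolP (i <= n)%N; last by exists x0.
  by have [x hx] := (hF BZ0).2 (y i) (y_near hi); exists x.
have yn : y n = y 0%N by rewrite /y gan ga0.
(* The last vertex of the loop is the first, so its preimage may be chosen the same, and the lifted
   path closes exactly. *)
apply: (@lift_bound (fun i => if i == n then X 0%N else X i)).
  by rewrite eqxx; case: eqP.
move=> i hi; case: eqP => [->|_]; last exact: hX.
by rewrite yn; exact: hX.
Qed.

End Assembly.

Theorem theorem3 (R : realType) (p : nat) (hp : (4 <= p)%N)
    (e : R) (he0 : 0 <= e) (he : e <= 1 / (2 * p%:R))
    (dG : central_product_group R p p.-1 ->
          central_product_group R p p.-1 -> R)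
    (hdG : left_invariant_metric dG)
    (dL : prod_group (filiform_group R p) (filiform_group R (p - 2)) ->
          prod_group (filiform_group R p) (filiform_group R (p - 2)) -> R)
    (hdL : left_invariant_metric dL) :
  ~ exists (v : R -> R)
      (F : central_product_group R p p.-1 ->
           prod_group (filiform_group R p) (filiform_group R (p - 2))),
      is_SBE dG dL v F /\ big_O_power v e.
Proof.
have p2 : (2 <= p)%N by lia.
have q2 : (2 <= p.-1)%N by lia.
have k2' : (2 <= p - 2)%N by lia.
have pN : (2 * p - 3 = (2 * p - 4).+1)%N by lia.
move=> [v [F [[hv [x0 [y0 [M [M1 hF]]]]] hO]]].
have hG := central_polynomial R q2 (leq_pred p).
have hL := prod_polynomial_group (filiform_polynomial R (ltnW p2)) (filiform_polynomial R (ltnW k2')).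
have mG := central_model q2 (leq_pred p) hdG.
have mL := product_model p2 k2' hdL.
have dG0 := dist_ge0 (left_invariant_coarse hG hdG).
pose eL (x : prod_group (filiform_group R p) (filiform_group R (p - 2))) : 'rV[R]_p := hexp x.1.
have eLM x Q : eL (gmul x (@to_product R p (p - 2) Q)) = hmul (eL x) Q.1.
  rewrite /eL -{1}(hlogK (hexp x.1)) -[RHS]hlogK (hlog_bch (ltnW p2)) hexpK.
  by rewrite /= hexpK.
have [CG CG1 quasiG] := model_quasi hG mG; have [CL CL1 quasiL] := model_quasi hL mL.
have [a a1 stepG] := model_step hG mG; have [b b1 stepL] := model_step hL mL.
have [uG uG0 upG] := model_upper mG; have [uL uL0 upL] := model_upper mL.
have M0 : 0 < M by apply: lt_le_trans M1.
have [|Cv Cv0 vaff] := sublinear_affine hv (ep := (2 * M)^-1); first by rewrite invr_gt0 mulr_gt0.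
have [AL hloop] := horizontal_loop R p2.
pose A : R := AL.+1%:R; have A1 : 1 <= A by rewrite ler1n.
have [C [c [B [C0 c1 B0 hfill]]]] := filling hp A1.
(* The filling uses points in the ball of radius [B N] and the lifted path stays in that of radius
   [A N]; each of the two steps of a triangle adds at most [c]. *)
pose Bw := B + A + 1 + 2 * c.
have Bw1 : A + 1 + 2 * c <= Bw by rewrite /Bw -!addrA lerDr.
pose l0 := Num.max 1 (dL (F x0) y0).
pose m0 := Num.max 1 (dG x0 x0).
pose Bq := (uL + 1) * (A + 1).
pose Br1 := 2 * M * (CL * (CL * (l0 + Bq) + CL)) + m0 + 2 * M * Cv.
pose k1 := CL * (CL * (uL + 2) + CL).
pose k2 := M * (k1 + 1).
pose K0 := a * k2.
pose Br2 := CG * (Br1 + (uG + 1) * Bw).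
pose D := b * (M * ((uG + 1) * c) + 1) + 2 * b.
have A0 : 0 <= A := le_trans ler01 A1.
have CL0 : 0 <= CL := le_trans ler01 CL1.
have l00 : 0 <= l0 by rewrite le_max ler01.
have m00 : 0 <= m0 by rewrite le_max ler01.
have Bq1 : 1 <= Bq by rewrite /Bq -[leLHS]mulr1; apply: ler_pM; rewrite ?lerDl ?lerDr ?addr_ge0.
have Bq0 : 0 <= Bq := le_trans ler01 Bq1.
have Br10 : 0 <= Br1 by rewrite /Br1 !(addr_ge0, mulr_ge0) // ltW.
have Bw0 : 0 <= Bw by rewrite /Bw !(addr_ge0, mulr_ge0) // (le_trans ler01 c1).
have CG0 : 0 <= CG := le_trans ler01 CG1.
have Br20 : 0 <= Br2.
  by apply: mulr_ge0 => //; apply: addr_ge0 => //; apply: mulr_ge0 => //; exact: addr_ge0.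
have k10 : 0 <= k1 by rewrite /k1 !(addr_ge0, mulr_ge0).
have K01 : 1 <= K0.
  rewrite /K0 /k2 -[leLHS]mulr1; apply: ler_pM => //; rewrite -[leLHS]mulr1.
  by apply: ler_pM => //; rewrite lerDr.
have K0p : 0 < K0 := lt_le_trans ltr01 K01.
have Bs1 : 1 <= Bq + Br1 + Br2 by rewrite -addrA; apply: (le_trans Bq1); rewrite lerDl addr_ge0.
have K0V : 0 < K0^-1 by rewrite invr_gt0.
have [s0 hs0] := gauge_small p2 hv hO he Bs1 K0V.
pose fin := (C + 2 * A) * (2 * D * K0) ^+ p.
(* The three terms make the gauge small, the step [s / K0] at least 1, and [s] larger than the bound
   that [assembly_bound] puts on it. *)
pose s := (s0 + (Num.truncn K0).+1 + (Num.truncn `|fin|).+1)%N.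
have s0s : (s0 <= s)%N by rewrite /s -addnA leq_addr.
have {}hs0 := hs0 s s0s.
have sp : (0 < s)%N by rewrite /s addnS.
have K0s : K0 <= s%:R.
  apply: (le_trans (ltW (truncnS_gt K0))); rewrite ler_nat /s.
  by apply: leq_trans (leq_addr _ _); exact: leq_addl.
have : fin < s%:R.
  apply: (le_lt_trans (ler_norm _)); apply: (lt_le_trans (truncnS_gt _)).
  by rewrite ler_nat /s; exact: leq_addl.
rewrite ltNge => /negP; apply.
have sg1 : 1 <= s%:R / K0 by rewrite ler_pdivlMr // mul1r.
have N0 : (0 < s ^ (2 * p - 4))%N by rewrite expn_gt0 sp.
have [n [ga [nA ga0 gan gae loop]]] := hloop (s ^ (2 * p - 4))%N (s%:R / K0) N0 sg1.
apply: (assembly_bound hp hG hL mG mL dG0 _ _ eLM M1 hF CG1 CL1 a1 b1 uG0 uL0 Cv0 quasiG quasiL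
  stepG stepL upG upL vaff sp A1 c1 K0s _ Bw1 _ ga0 gan gae _ loop).
- by move=> P t; apply: (to_central_z q2 (leq_pred p)).
- by move=> P; apply: (to_central_eq0 q2 (leq_pred p)).
- move=> t ht t0; have [_ vm _] := hv.
  rewrite [leRHS]mulrC; apply: le_trans hs0; apply: vm => //.
  by rewrite pN expnS natrM; exact: ht.
- by apply: (@le_trans _ _ (AL * s ^ (2 * p - 4))%:R); rewrite ?ler_nat // natrM ler_wpM2r // ler_nat.
move=> lam K P m n' lamk lamc nA' P0 hP Pn.
apply: (hfill s lam K P m n' sp lamk _ nA' P0 hP Pn) => Q g g' hQ; apply: lamc.
apply: pball_leq hQ _; apply: ler_wpM2r => //.
by rewrite /Bw addrK -addrA lerDl addr_ge0.
Qed.
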